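(* Let $p\in(2,+\infty)$ and $q>p-1$, and let $$\Psi(z)=z+\frac{(p-1)^2}{2\,(2p-1)}\,(1+q-p)\,\lambda_1^{p-2}\int_0^{z}\frac{s^{p-1}}{1+(p-q)\,s}\,ds$$ for $z\ge0$ (with $1+(p-q)z>0$). Then for every $u\in\mathrm W^{1,p}(\mathbb S^1)\setminus\{0\}$ the following holds. If $p\neq q$, $$\|u'\|_{\mathrm L^p(\mathbb S^1)}^2\ \ge\ \lambda_1\,\|u\|_{\mathrm L^q(\mathbb S^1)}^2\,\Psi\left(\frac1{p-q}\,\frac{\|u\|_{\mathrm L^p(\mathbb S^1)}^2-\|u\|_{\mathrm L^q(\mathbb S^1)}^2}{\|u\|_{\mathrm L^q(\mathbb S^1)}^2}\right).$$ If $p=q$, $$\|u'\|_{\mathrm L^p(\mathbb S^1)}^2\ \ge\ \lambda_1\,\|u\|_{\mathrm L^p(\mathbb S^1)}^2\,\Psi\left(\frac2p\int_{\mathbb S^1}\frac{|u|^p}{\|u\|_{\mathrm L^p(\mathbb S^1)}^p}\,\log\left(\frac{|u|}{\|u\|_{\mathrm L^p(\mathbb S^1)}}\right)d\sigma\right).$$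
   Context: $\mathbb S^1$ is the unit circle, identified with $[0,2\pi)$ with periodic boundary conditions, and $d\sigma=\frac{dx}{2\pi}$ is the uniform probability measure on it. Functions are real-valued, $u'$ denotes the derivative in $x$, and $\|u\|_{\mathrm L^r(\mathbb S^1)}:=\left(\int_{\mathbb S^1}|u|^r\,d\sigma\right)^{1/r}$. The convention $0\log 0=0$ is used. Let $\mathcal W_1$ be the set of all $v\in\mathrm W^{1,p}(\mathbb S^1)\setminus\{0\}$ such that $\int_{\mathbb S^1}v\,d\sigma=0$, and define $$\lambda_1:=\inf_{v\in\mathcal W_1}\frac{\|v'\|_{\mathrm L^p(\mathbb S^1)}^2}{\|v\|_{\mathrm L^p(\mathbb S^1)}^2}.$$ *)

(* Defs.v *)
From HB Require Import structures.
From mathcomp Require Import all_boot all_order all_algebra.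
From mathcomp Require Import all_classical all_reals all_analysis.

Set Implicit Arguments.
Unset Strict Implicit.
Unset Printing Implicit Defensive.

Import Order.TTheory GRing.Theory Num.Theory.
Import numFieldNormedType.Exports.

Local Open Scope classical_set_scope.
Local Open Scope ring_scope.

(* Functions on the circle are represented by functions [u : R -> R], seen only
   through [sigma], hence only up to a.e. equality on [0, 2 pi]; only the test
   functions below carry the periodic boundary condition explicitly. *)

Lemma two_pi_gt0 (R : realType) : 0 < 2 * pi :> R.
Proof. by rewrite mulr_gt0 ?pi_gt0 ?ltr0n. Qed.

(* The end point 2 pi, identified with 0, is a null set. *)
Definition sigma (R : realType) : probability (measurableTypeR R) R :=
  uniform_prob (two_pi_gt0 R).

(* [fine] loses nothing on W^{1,p}(S^1), which embeds in L^oo(S^1). *)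
Definition norm_L (R : realType) (r : R) (u : R -> R) : R :=
  fine ('N[sigma R]_(r%:E)[EFin \o u])%E.

(* C^oo(S^1), as 2 pi-periodic functions on R. *)
Definition smooth_periodic (R : realType) (phi : R -> R) : Prop :=
  periodic phi (2 * pi) /\
  (forall (n : nat) (x : R), derivable (derive1n n phi) x 1).

(* [g] is the distributional derivative of [u] on the circle. *)
Definition weak_derivative (R : realType) (u g : R -> R) : Prop :=
  forall phi : R -> R, smooth_periodic phi ->
    \int[sigma R]_x (u x * derive1 phi x) = - \int[sigma R]_x (g x * phi x).

(* [u] belongs to W^{1,p}(S^1), with derivative [du].  Taking the (a.e. unique)
   derivative as an argument avoids choosing a representative of it. *)
Definition W1 (R : realType) (p : R) (u du : R -> R) : Prop :=
  [/\ u \in Lfun (sigma R) p%:E, du \in Lfun (sigma R) p%:E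
    & weak_derivative u du].

Definition ae_zero (R : realType) (u : R -> R) : Prop :=
  u = cst 0 %[ae sigma R].

Definition W1_mean0 (R : realType) (p : R) (v dv : R -> R) : Prop :=
  [/\ W1 p v dv, ~ ae_zero v & \int[sigma R]_x v x = 0].

Definition lambda1 (R : realType) (p : R) : R :=
  inf [set l | exists v dv : R -> R, W1_mean0 p v dv /\
         l = norm_L p dv ^+ 2 / norm_L p v ^+ 2].

(* Meaningful for 0 <= z and 0 < 1 + (p - q) * z. *)
Definition Psi (R : realType) (p q z : R) : R :=
  z + (p - 1) ^+ 2 / (2 * (2 * p - 1)) * (1 + q - p) * lambda1 p `^ (p - 2) *
      \int[lebesgue_measure]_(s in `[0, z]) (s `^ (p - 1) / (1 + (p - q) * s)).

(* [ln 0 = 0] in the library, in accordance with 0 log 0 = 0. *)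
Definition entropy (R : realType) (p : R) (u : R -> R) : R :=
  \int[sigma R]_x (`|u x| `^ p / norm_L p u `^ p * ln (`|u x| / norm_L p u)).

(* Main.v *)
(** Let i = |u'|_p^2 and e = (|u|_p^2 - |u|_q^2) / (p - q) for |u|_q = 1.  A
    positive solution of the Euler-Lagrange equation
    - (|u'|^(p-2) u')' = al u^(p-1) + ga u^(q-1) is tested against
    u^(2-p) (|u'|^(p-2) u')' + (1 + q - p) u^(1-p) |u'|^p.  Together with the
    Poincare inequality this carre du champ computation bounds al from below,
    which excludes minimizers of i - mu f(e), mu < lambda1, with a negative
    value, as soon as
    f' <= 1 + kap i / (lambda1 |u|_p^2), kap = (1 + q - p) (p - 1)^2 / (2 p - 1).
    Hence lambda1 f(e) <= i.  The choice f(e) = e is always allowed and gives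
    lambda1 e <= i; with lambda1 <= 1 and an oscillation bound it improves to
    (lambda1 e)^(p-1) <= 2 i, which allows f = Psi.

    Minimizers are constructed on grids of n + 1 points, where they exist by
    compactness of the sphere; the equation passes to the limit along an
    ultrafilter.  Sobolev functions are replaced by their continuous
    representatives, whose grid energies are bounded by the L^p norm of the weak
    derivative.  The case p = q is the limit of q = p + t as t decreases to 0. *)

Require Import Defs.
From mathcomp Require Import all_boot all_order all_algebra.
From mathcomp Require Import all_classical all_reals all_analysis measurable_realfun.
From mathcomp Require Import ring lra zify.

Set Implicit Arguments.
Unset Strict Implicit.
Unset Printing Implicit Defensive.

Import Order.TTheory GRing.Theory Num.Theory.
Import numFieldNormedType.Exports.

Local Open Scope classical_set_scope.
Local Open Scope ring_scope.

(** * Signed and absolute powers *)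

Section SignedPowers.
Context {R : realType}.
Implicit Types (x s : R).

(** A minimizer is only known to be nonnegative, whereas the test function contains u^(2-p) and
    u^(1-p). These powers are taken at u + t; the error tends to 0 with t because the test function
    stays bounded, and this rests on the first integral of the equation, which bounds |u'|^p by a
    multiple of u^p + u^q, and on 1 + q - p > 0. The equation is used as a first order system for u
    and w = |u'|^(p-2) u', since w is differentiable where u' need not be. The test function is made
    such that its integral against u^(q-1) vanishes, so ga, of which no sign is known, drops out and
    al alone is estimated. The bound obtained contains |u|_p^2, which is 1 + (p - q) e when |u|_q =
    1: this is the denominator in the integrand of Psi, and the factor 1/2 in front of its integral
    is paid for by the 2 in the a priori bound. The a priori bound has two regimes. With z = lambda1
    e, the inequality z <= i is enough as long as z^(p-2) <= 2; beyond that, a large e forces a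
    large maximum of u, hence a large oscillation and a large energy. *)

Lemma is_derive_epsP (f : R -> R) x l :
  (forall e, 0 < e -> exists2 d, 0 < d &
     forall h, `|h| < d -> `|f (x + h) - f x - l * h| <= e * `|h|) ->
  is_derive x 1 f l.
Proof.
move=> H.
have cv : h^-1 *: ((f \o shift x) (h *: (1 : R)) - f x) @[h --> (0:R)^'] --> l.
  apply/cvgrPdist_le => e e0; have [d d0 Hd] := H _ e0.
  near=> h.
  have h0 : h != 0 by near: h; exact: nbhs_dnbhs_neq.
  have hd : `|h| < d by near: h; exact: dnbhs0_lt.
  rewrite /= /shift [X in f X](_ : _ = x + h); last by rewrite [_ *: _]mulr1 addrC.
  have -> : l - h^-1 *: (f (x + h) - f x) = - h^-1 * (f (x + h) - f x - l * h).
    by rewrite /GRing.scale /=; field.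
  rewrite normrM normrN normfV ler_pdivrMl ?normr_gt0// [leRHS]mulrC.
  exact: Hd.
by split; [apply/cvg_ex; exists l | apply/cvg_lim].
Unshelve. all: by end_near. Qed.

Lemma continuous_epsP (f : R -> R) x :
  (forall e, 0 < e -> exists2 d, 0 < d &
     forall h, `|h| < d -> `|f (x + h) - f x| <= e) ->
  {for x, continuous f}.
Proof.
move=> H; apply/cvgrPdist_le => e e0; have [d d0 Hd] := H _ e0.
exists d => //= y xy; have := Hd (y - x).
by rewrite subrKC distrC [`|f x - _|]distrC; apply.
Qed.

Definition apow (r s : R) := `|s| `^ r.
(** The odd power, against the even [apow]: [spow (p - 1) s] is |s|^(p-2) s, the flux of the
    p-Laplacian, and [spow (p - 1)^-1] is its inverse. *)
Definition spow (r s : R) := Num.sg s * `|s| `^ r.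

Lemma powR_small r e : 0 < r -> 0 < e ->
  exists2 d : R, 0 < d & forall h : R, `|h| < d -> `|h| `^ r <= e.
Proof.
move=> r0 e0; exists (e `^ r^-1); first by rewrite powR_gt0.
move=> h hd; apply: le_trans (_ : (e `^ r^-1) `^ r <= e).
  by rewrite ge0_ler_powR ?nnegrE ?powR_ge0 ?(ltW hd)// ltW.
by rewrite -powRrM mulVf ?gt_eqF// powRr1// ltW.
Qed.

Lemma powRS x r : 0 < x -> x `^ r = x * x `^ (r - 1).
Proof.
move=> x0; rewrite -{2}(powRr1 (ltW x0)) -powRD; last by rewrite (gt_eqF x0) implybT.
by congr powR; ring.
Qed.

Lemma is_derive_apow r x : 1 < r -> is_derive x 1 (apow r) (r * spow (r - 1) x).
Proof.
move=> r1; have [x0|x0|->] := ltgtP x 0.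
- have -> : r * spow (r - 1) x = (r * (- x) `^ (r - 1)) * (-1).
    by rewrite /spow ltr0_sg// ltr0_norm//; ring.
  have H : is_derive x 1 (fun y : R => (- y) `^ r) (r * (- x) `^ (r - 1) * (-1)).
    have ? : is_derive (- x) 1 (@powR R ^~ r) (r * (- x) `^ (r - 1)).
      by apply: is_derive1_powR; rewrite oppr_gt0.
    exact: (@is_derive1_comp _ (fun z => z `^ r) (fun y => - y)).
  apply: near_eq_is_derive H.
  by apply: filterS (lt_nbhsl (x0 : x < 0)) => y y0; rewrite /apow ltr0_norm.
- have -> : r * spow (r - 1) x = (r * x `^ (r - 1)).
    by rewrite /spow gtr0_sg// gtr0_norm//; ring.
  have H := is_derive1_powR r x0.
  apply: near_eq_is_derive H.
  by apply: filterS (lt_nbhsr x0) => y y0; rewrite /apow gtr0_norm.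
- apply: is_derive_epsP => e e0.
  have [|d d0 Hd] := @powR_small (r - 1) e _ e0; first by rewrite subr_gt0.
  exists d => // h hd; rewrite /spow /apow sgr0 normr0 powR0; last by lra.
  rewrite !(add0r, mul0r, mulr0, subr0) ger0_norm ?powR_ge0//.
  have [->|h0] := eqVneq h 0; first by rewrite normr0 powR0 ?mulr0//; lra.
  by rewrite powRS ?normr_gt0// mulrC ler_wpM2r// Hd.
Qed.

(** Away from 0 the exponent may be below 1: this serves for the power 2 / p in the functional to be
    minimized. *)
Lemma is_derive_apow_gt0 r x : 0 < x -> is_derive x 1 (apow r) (r * x `^ (r - 1)).
Proof.
move=> x0; apply: near_eq_is_derive (is_derive1_powR r x0).
by apply: filterS (lt_nbhsr x0) => y y0; rewrite /apow gtr0_norm.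
Qed.

(** Minimality is asked only near 0, since a perturbed grid function is admissible only while its
    q-mean stays positive. The one-sided difference quotients have opposite signs. *)
Lemma is_derive_loc_min (g : R -> R) l :
  (\forall t \near (0 : R), g 0 <= g t) -> is_derive (0 : R) 1 g l -> l = 0.
Proof.
move=> gmin [dg <-].
have cv : h^-1 *: (g (h *: (1 : R) + 0) - g 0) @[h --> (0 : R)^'] --> derive g 0 1 by exact: dg.
apply/eqP; rewrite eq_le; apply/andP; split.
  apply: (cvgr_to_le (cvg_dnbhs_at_left cv)).
  near=> h; rewrite [_ *: 1]mulr1 addr0 nmulr_rle0 ?invr_lt0//.
  by rewrite subr_ge0; near: h; apply: cvg_within gmin.
apply: (cvgr_to_ge (cvg_dnbhs_at_right cv)).
near=> h; rewrite [_ *: 1]mulr1 addr0 mulr_ge0 ?invr_ge0//.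
by rewrite subr_ge0; near: h; apply: cvg_within gmin.
Unshelve. all: by end_near. Qed.

Lemma apow_continuous r : 0 < r -> continuous (apow r).
Proof.
move=> r0 x; have [->|x0] := eqVneq x 0.
  apply: continuous_epsP => e e0; have [d d0 Hd] := @powR_small r e r0 e0.
  exists d => // h hd; rewrite /apow add0r normr0 powR0 ?gt_eqF// subr0.
  by rewrite ger0_norm ?powR_ge0// Hd.
apply: (@continuous_comp _ _ _ (@Num.norm _ R) (@powR R ^~ r)).
  exact: norm_continuous.
apply: differentiable_continuous; apply/derivable1_diffP.
by apply: derivable_powR; rewrite in_itv/= andbT normr_gt0.
Qed.

Lemma spow_continuous r : 0 < r -> continuous (spow r).
Proof.
move=> r0 x; have [->|x0] := eqVneq x 0.
  apply: continuous_epsP => e e0; have [d d0 Hd] := @powR_small r e r0 e0.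
  exists d => // h hd; rewrite /spow add0r sgr0 mul0r subr0 normrM normr_sg.
  apply: (@le_trans _ _ (`|h| `^ r)); last exact: Hd.
  by rewrite ger0_norm ?powR_ge0// ler_piMl ?powR_ge0// lern1 leq_b1.
have H : {for x, continuous (fun y => Num.sg x * apow r y)}.
  by apply: continuousM; [exact: cst_continuous|exact: apow_continuous].
apply: cvg_trans H; apply: near_eq_cvg; near=> y.
rewrite /spow /apow; congr (_ * _); near: y.
move: x0; rewrite neq_lt => /orP[x0|x0].
  by apply: filterS (lt_nbhsl x0) => y y0; rewrite !ltr0_sg.
by apply: filterS (lt_nbhsr x0) => y y0; rewrite !gtr0_sg.
Unshelve. all: by end_near. Qed.

Lemma powRDp x r s : 0 < x -> x `^ (r + s) = x `^ r * x `^ s.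
Proof. by move=> x0; rewrite powRD// (gt_eqF x0) implybT. Qed.

Lemma le_powR_neg x y r : 0 < x -> x <= y -> r <= 0 -> y `^ r <= x `^ r.
Proof.
move=> x0 xy r0; rewrite -(opprK r) !(powRN _ (- r)).
have y0 := lt_le_trans x0 xy.
by rewrite lef_pV2 ?posrE ?powR_gt0// ge0_ler_powR ?nnegrE ?oppr_ge0// ltW.
Qed.

Lemma powR_modulus r K e : 0 < r -> 0 < K -> 0 < e -> exists2 d, 0 < d &
  forall s t, 0 <= s <= K -> 0 <= t <= K -> `|t - s| < d ->
    `|t `^ r - s `^ r| <= e.
Proof.
move=> r0 K0 e0.
suff [d d0 Hd] : exists2 d, 0 < d & forall s t, 0 < s -> s < t -> t <= K ->
    t - s < d -> t `^ r - s `^ r <= e.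
  have [d' d'0 Hd'] := @powR_small r e r0 e0.
  exists (Num.min d d'); first by rewrite lt_min d0.
  move=> s t; wlog st : s t / s <= t.
    move=> W sK tK dst; have [st|/ltW ts] := leP s t; first exact: W.
    by rewrite distrC W// distrC.
  move=> /andP[s0 sK] /andP[t0 tK].
  rewrite (ger0_norm (_ : 0 <= t - s)) ?subr_ge0// lt_min => /andP[dd dd'].
  rewrite ger0_norm ?subr_ge0 ?ge0_ler_powR ?nnegrE ?(ltW r0)//.
  move: s0; rewrite le_eqVlt => /predU1P[s0|s0].
    rewrite -s0 powR0 ?gt_eqF// subr0.
    have := Hd' t; rewrite ger0_norm//; apply.
    by move: dd'; rewrite -s0 subr0.
  move: st; rewrite le_eqVlt => /predU1P[->|st]; first by rewrite subrr ltW.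
  exact: Hd.
have [r1|r1] := leP r 1.
  have [d d0 Hd] := @powR_small r e r0 e0; exists d => // s t s0 st tK dst.
  have t0 := lt_trans s0 st.
  have ts0 : 0 < t - s by rewrite subr_gt0.
  have := Hd (t - s); rewrite ger0_norm ?(ltW ts0)// => /(_ dst).
  apply: le_trans.
  (* Subadditivity for r <= 1: t^r = (t - s) t^(r-1) + s t^(r-1), and t^(r-1) is at most both (t -
     s)^(r-1) and s^(r-1). *)
  rewrite (powRS r t0) (powRS r s0) (powRS r ts0).
  have h1 : t `^ (r - 1) <= s `^ (r - 1) by apply: le_powR_neg; rewrite ?(ltW st)//; lra.
  have h2 : t `^ (r - 1) <= (t - s) `^ (r - 1) by apply: le_powR_neg; lra.
  nra.
(* For r > 1 this is a Lipschitz constant on [0, K], by the mean value theorem. *)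
pose L := r * K `^ (r - 1).
have L0 : 0 < L by rewrite /L mulr_gt0 ?powR_gt0.
exists (e / L); first by rewrite divr_gt0.
move=> s t s0 st tK dst.
have [c cst E] : exists2 c, c \in `]s, t[%R & apow r t - apow r s = r * spow (r - 1) c * (t - s).
  apply: MVT => //; first by move=> x _; exact: is_derive_apow.
  by apply: continuous_subspaceT; exact: apow_continuous.
move: cst; rewrite in_itv/= => /andP[sc ct].
have c0 := lt_trans s0 sc.
move: E; rewrite /apow /spow gtr0_sg// mul1r !gtr0_norm ?(lt_trans s0 st)// => ->.
apply: (@le_trans _ _ (L * (e / L))); last by rewrite mulrCA divff ?mulr1 ?gt_eqF.
rewrite ler_pM ?(ltW dst)//.
- by rewrite mulr_ge0 ?powR_ge0// ltW.
- by rewrite subr_ge0 ltW.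
- rewrite ler_wpM2l ?(ltW r0)// ge0_ler_powR ?nnegrE ?subr_ge0 ?(ltW r1)// ?ltW//.
  exact: lt_le_trans tK.
Qed.

Lemma ge1_powR x r : 1 <= x -> 0 <= r -> 1 <= x `^ r.
Proof. by move=> x1 r0; have := ler_powR x1 r0; rewrite powRr0. Qed.

Lemma le1_powR x r : 0 <= x <= 1 -> 0 <= r -> x `^ r <= 1.
Proof.
move=> /andP[x0 x1] r0; have := @ge0_ler_powR _ _ r0 x 1.
by rewrite powR1 !nnegrE; apply.
Qed.

Lemma spow_ge0E r s : 0 < r -> 0 <= s -> spow r s = s `^ r.
Proof.
move=> r0; rewrite le_eqVlt /spow => /predU1P[<-|s0].
  by rewrite sgr0 mul0r powR0 ?gt_eqF.
by rewrite gtr0_sg// mul1r gtr0_norm.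
Qed.

Lemma apow_ge0 r s : 0 <= apow r s.
Proof. exact: powR_ge0. Qed.

Lemma spowM r s : 0 < r -> spow r s * s = apow (r + 1) s.
Proof.
move=> r0; rewrite /spow /apow; have [->|s0] := eqVneq s 0.
  by rewrite mulr0 normr0 powR0// gt_eqF//; lra.
rewrite powRDp ?normr_gt0// powRr1 ?normr_ge0//.
by rewrite mulrC mulrA [s * _]mulrC -normrEsg mulrC.
Qed.

Lemma normr_spow r s : 0 < r -> `|spow r s| = apow r s.
Proof.
move=> r0; rewrite /spow /apow normrM normr_sg.
rewrite (ger0_norm (powR_ge0 _ _)).
have [->|s0] := eqVneq s 0; first by rewrite normr0 powR0 ?mulr0 ?gt_eqF.
by rewrite mul1r.
Qed.

End SignedPowers.

(** * Integration on the circle *)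

Section CircleIntegral.
Context {R : realType}.
Implicit Types (f g F : R -> R).
Notation mu := (@lebesgue_measure R).
Notation T := (2 * pi : R).

Let T0 : 0 < T := two_pi_gt0 R.

Lemma integral_sigma (f : R -> \bar R) : measurable_fun setT f ->
  (\int[sigma R]_x f x = (T^-1)%:E * \int[mu]_(x in `[0%R, T]) f x)%E.
Proof.
move=> mf; rewrite [LHS]integralE [in RHS]integralE.
have c0 : (0 < (T^-1)%:E :> \bar R)%E by rewrite lte_fin invr_gt0.
rewrite !integral_uniform ?subr0//; [|exact: measurable_funeneg|exact: measurable_funepos].
set A := integral _ _ _; set B := integral _ _ _.
have A0 : (0 <= A)%E by apply: integral_ge0.
have B0 : (0 <= B)%E by apply: integral_ge0.
(* Either part may be infinite; multiplication by a positive constant commutes with the difference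
   in all four cases. *)
case: A A0 => [a| |]// a0; case: B B0 => [b| |]// b0;
  rewrite ?gt0_muley// ?gt0_muleNy// -?EFinM -?EFinB -?EFinM ?mulrBr//.
Qed.

Lemma integrable_sigma f : measurable_fun setT f ->
  (sigma R).-integrable setT (EFin \o f) <-> mu.-integrable `[0%R, T] (EFin \o f).
Proof.
move=> mf; have mf' : measurable_fun setT (EFin \o f) by exact/measurable_EFinP.
have E : (\int[sigma R]_x `|(EFin \o f) x| = (T^-1)%:E * \int[mu]_(x in `[0%R, T]) `|(EFin \o f) x|)%E.
  by rewrite integral_sigma//; exact: measurableT_comp.
have A0 : (0 <= \int[mu]_(x in `[0%R, T]) `|(EFin \o f) x|)%E by apply: integral_ge0.
split => /integrableP[_ H]; apply/integrableP; split => //.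
- exact: measurable_funTS.
- move: H; rewrite E; move: A0; case: (integral _ _ _) => [a| |]//.
    by move=> _ _; exact: ltry.
  by rewrite gt0_muley// lte_fin invr_gt0.
- rewrite E; move: H A0; case: (integral _ _ _) => [a| |]// _ _.
  by rewrite -EFinM ltry.
Qed.

Lemma Rintegral_sigma f : measurable_fun setT f ->
  \int[sigma R]_x f x = T^-1 * \int[mu]_(x in `[0%R, T]) f x.
Proof.
move=> mf; rewrite /Rintegral integral_sigma; last exact/measurable_EFinP.
set A := integral _ _ _.
(* Infinite integrals are sent to 0 by [fine] on both sides. *)
case: A => [a| |]//=; rewrite mulr0.
  by rewrite gt0_muley ?lte_fin ?invr_gt0.
by rewrite gt0_muleNy ?lte_fin ?invr_gt0.
Qed.

Lemma cont_measurable f : continuous f -> measurable_fun setT f.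
Proof. exact: continuous_measurable_fun. Qed.

Lemma cont_integrable f a b : continuous f -> mu.-integrable `[a, b] (EFin \o f).
Proof.
move=> cf; apply: continuous_compact_integrable; first exact: segment_compact.
exact: continuous_subspaceT.
Qed.

Lemma cont_sigma f : continuous f -> (sigma R).-integrable setT (EFin \o f).
Proof.
move=> cf; apply/integrable_sigma; first exact: cont_measurable.
exact: cont_integrable.
Qed.

Lemma contD f g : continuous f -> continuous g -> continuous (fun x => f x + g x).
Proof. by move=> cf cg x; apply: continuousD; [exact: cf|exact: cg]. Qed.

Lemma contB f g : continuous f -> continuous g -> continuous (fun x => f x - g x).
Proof. by move=> cf cg x; apply: continuousB; [exact: cf|exact: cg]. Qed.

Lemma contM f g : continuous f -> continuous g -> continuous (fun x => f x * g x).
Proof. by move=> cf cg x; apply: continuousM; [exact: cf|exact: cg]. Qed.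

Lemma contN f : continuous f -> continuous (fun x => - f x).
Proof. by move=> cf x; apply: continuousN; exact: cf. Qed.

Lemma contZ c f : continuous f -> continuous (fun x => c * f x).
Proof. by move=> cf; apply: contM => //; exact: cst_continuous. Qed.

Lemma cont_cst (c : R) : continuous (fun _ : R => c).
Proof. exact: cst_continuous. Qed.

Lemma cont_comp f g : continuous g -> continuous f -> continuous (fun x => g (f x)).
Proof.
by move=> cg cf x; apply: (@continuous_comp _ _ _ f g); [exact: cf|exact: cg].
Qed.

Lemma cont_norm f : continuous f -> continuous (fun x => `|f x|).
Proof. by move=> cf; apply: cont_comp cf; exact: norm_continuous. Qed.

Definition cint f := \int[sigma R]_x f x.

Lemma cint_cst c : cint (fun=> c) = c.
Proof.
rewrite /cint Rintegral_cst//.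
transitivity (c * fine (1 : \bar R)); last by rewrite /= mulr1.
congr (_ * fine _); exact: (probability_setT (sigma R)).
Qed.

Lemma cintD f g : continuous f -> continuous g ->
  cint (fun x => f x + g x) = cint f + cint g.
Proof. by move=> cf cg; rewrite /cint RintegralD//; exact: cont_sigma. Qed.

Lemma cintB f g : continuous f -> continuous g ->
  cint (fun x => f x - g x) = cint f - cint g.
Proof. by move=> cf cg; rewrite /cint RintegralB//; exact: cont_sigma. Qed.

Lemma cintZ c f : continuous f -> cint (fun x => c * f x) = c * cint f.
Proof. by move=> cf; rewrite /cint RintegralZl//; exact: cont_sigma. Qed.

Lemma le_cint f g : continuous f -> continuous g -> (forall x, f x <= g x) ->
  cint f <= cint g.
Proof. by move=> cf cg fg; rewrite /cint le_Rintegral//; exact: cont_sigma. Qed.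

Lemma cint_ge0 f : (forall x, 0 <= f x) -> 0 <= cint f.
Proof. by move=> f0; apply: Rintegral_ge0. Qed.

Lemma eq_cint f g : f =1 g -> cint f = cint g.
Proof. by move=> /funext ->. Qed.

Lemma norm_cint_le f : continuous f -> `|cint f| <= cint (fun x => `|f x|).
Proof. by move=> cf; apply: le_normr_Rintegral => //; exact: cont_sigma. Qed.

Lemma is_derive_continuous F f : (forall x : R, is_derive x 1 F (f x)) -> continuous F.
Proof.
move=> dF x; apply: differentiable_continuous; apply/derivable1_diffP.
exact: (@ex_derive _ _ _ _ _ _ _ (dF x)).
Qed.

Lemma FTC_itv F f a b : (forall x : R, is_derive x 1 F (f x)) -> continuous f ->
  a <= b -> \int[mu]_(x in `[a, b]) f x = F b - F a.
Proof.
move=> dF cf; rewrite le_eqVlt => /predU1P[->|ab].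
  by rewrite set_itv1 Rintegral_set1 subrr.
have cF := is_derive_continuous dF.
rewrite /Rintegral (@continuous_FTC2 _ f F a b)//.
- exact: continuous_subspaceT.
- split.
  + by move=> x _; apply: (@ex_derive _ _ _ _ _ _ _ (dF x)).
  + by apply: cvg_at_right_filter; exact: cF.
  + by apply: cvg_at_left_filter; exact: cF.
- by move=> x _; rewrite derive1E (@derive_val _ _ _ _ _ _ _ (dF x)).
Qed.

Lemma cint_FTC F f : (forall x : R, is_derive x 1 F (f x)) -> continuous f ->
  cint f = T^-1 * (F T - F 0).
Proof.
move=> dF cf; rewrite /cint Rintegral_sigma; last exact: cont_measurable.
by rewrite (FTC_itv dF cf)// ltW.
Qed.

Lemma cint_periodic F f : (forall x : R, is_derive x 1 F (f x)) -> continuous f ->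
  F T = F 0 -> cint f = 0.
Proof. by move=> dF cf FT; rewrite (cint_FTC dF cf) FT subrr mulr0. Qed.

Lemma cint_gt0 f x : continuous f -> (forall x, 0 <= f x) -> 0 <= x <= T ->
  0 < f x -> 0 < cint f.
Proof.
move=> cf f0 /andP[x0 xT] fx.
have : \forall y \near x, f x / 2 <= f y.
  have fx2 : f x / 2 < f x by lra.
  by apply: filterS (cvgr_gt (f x) (cf x) _ fx2) => y /ltW.
move=> [d /= d0 Hd].
(* The interval is cut to [0, 2 pi] because x may be an end point. *)
pose a := Num.max 0 (x - d / 2); pose b := Num.min T (x + d / 2).
have ab : a < b.
  by rewrite /a /b gt_max !lt_min T0 /=; apply/andP; split; [|apply/andP; split]; lra.
have c0 : 0 < f x / 2 * (b - a) by rewrite mulr_gt0 ?subr_gt0//; lra.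
rewrite /cint Rintegral_sigma; last exact: cont_measurable.
rewrite mulr_gt0 ?invr_gt0//; apply: lt_le_trans c0 _.
have iab (u v : R) : (\int[mu]_(x in `[u, v]) (f x)%:E \is a fin_num)%E.
  by apply: integrable_fin_num => //; exact: cont_integrable.
have -> : f x / 2 * (b - a) = \int[mu]_(y in `[a, b]) (f x / 2).
  by rewrite Rintegral_cst//= lebesgue_measure_itv/= lte_fin ab.
apply: (@le_trans _ _ (\int[mu]_(y in `[a, b]) f y)).
  apply: le_Rintegral => //; [exact: cont_integrable (@cst_continuous _ _ _)|exact: cont_integrable|].
  move=> y /=; rewrite in_itv/= /a /b ge_max le_min => /andP[/andP[_ y1] /andP[_ y2]].
  apply: Hd => /=; rewrite ltr_norml; lra.
rewrite /Rintegral fine_le//; apply: ge0_subset_integral => //.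
- by apply/measurable_EFinP/measurable_funTS; exact: cont_measurable.
- by move=> y _; rewrite lee_fin.
- apply: subset_itvScc; rewrite bnd_simp /a /b ?le_max ?lexx// ge_min lexx//.
Qed.

Lemma periodic_reduce f : (forall x : R, f (x + T) = f x) ->
  forall x : R, exists2 y, 0 <= y < T & f y = f x.
Proof.
move=> fT x.
have fn (n : nat) y : f (y + n%:R * T) = f y.
  elim: n => [|n IH]; first by rewrite mul0r addr0.
  by rewrite -natr1 mulrDl mul1r addrA fT IH.
have fz (k : int) y : f (y + k%:~R * T) = f y.
  case: k => n; first exact: fn.
  by rewrite NegzE -(fn n.+1 (y + _)) -addrA mulrNz mulNr addNr addr0.
exists (x + (- Num.floor (x / T))%:~R * T); last by rewrite fz.
have := floor_itv (x / T).
rewrite intrD => /andP[h1 h2]; rewrite mulrNz mulNr subr_ge0 ltrBlDr.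
rewrite -ler_pdivlMr// h1 /= -[X in X + _]mul1r -mulrDl.
by rewrite -ltr_pdivrMr// addrC.
Qed.

Lemma periodic_max f : continuous f -> (forall x : R, f (x + T) = f x) ->
  exists2 x0 : R, 0 <= x0 <= T & forall x : R, f x <= f x0.
Proof.
move=> cf fT; have [|c cT H] := @EVT_max R f 0 T (ltW T0).
  exact: continuous_subspaceT.
exists c; first by move: cT; rewrite in_itv.
move=> x; have [y /andP[y0 yT] <-] := periodic_reduce fT x.
by apply: H; rewrite in_itv/= y0 ltW.
Qed.

Lemma periodic_min f : continuous f -> (forall x : R, f (x + T) = f x) ->
  exists2 x0 : R, 0 <= x0 <= T & forall x : R, f x0 <= f x.
Proof.
move=> cf fT; have [||c cT H] := @periodic_max (fun x => - f x).
- exact: contN.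
- by move=> x; rewrite fT.
- by exists c => // x; rewrite -lerN2.
Qed.

Lemma is_derive_min_eq0 F f (x0 : R) : (forall x : R, is_derive x 1 F (f x)) ->
  (forall x, F x0 <= F x) -> f x0 = 0.
Proof.
move=> dF Fmin.
have H : is_derive x0 1 F 0.
  apply: (@derive1_at_min _ F (x0 - 1) (x0 + 1)).
  - by lra.
  - by move=> t _; apply: (@ex_derive _ _ _ _ _ _ _ (dF t)).
  - by rewrite in_itv/=; apply/andP; split; lra.
  - by move=> t _; exact: Fmin.
by rewrite -(@derive_val _ _ _ _ _ _ _ H) (@derive_val _ _ _ _ _ _ _ (dF x0)).
Qed.

Lemma is_derive0_cst F : (forall x : R, is_derive x 1 F 0) -> forall x y, F x = F y.
Proof. by move=> dF x y; exact: is_derive_0_is_cst. Qed.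

End CircleIntegral.

Section CircleNorms.
Context {R : realType}.
Implicit Types (f g F : R -> R).
Notation T := (2 * pi : R).

Lemma apow_comp_continuous r f : 0 < r -> continuous f ->
  continuous (fun x => apow r (f x)).
Proof. by move=> r0 cf; apply: cont_comp cf; exact: apow_continuous. Qed.

Lemma Lnorm_cont r f : 0 < r -> continuous f ->
  ('N[sigma R]_(r%:E)[EFin \o f] = (cint (fun x => apow r (f x)) `^ r^-1)%:E)%E.
Proof.
move=> r0 cf; rewrite unlock /=.
rewrite /cint /Rintegral -poweR_EFin; congr (_ `^ _)%E; rewrite fineK//.
apply: integrable_fin_num => //; apply: (@cont_sigma _ (fun x => apow r (f x))).
exact: apow_comp_continuous.
Qed.

Lemma norm_L_cont r f : 0 < r -> continuous f ->
  norm_L r f = cint (fun x => apow r (f x)) `^ r^-1.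
Proof. by move=> r0 cf; rewrite /norm_L Lnorm_cont. Qed.

Lemma cint_hoelder r s f g : 0 < r -> 0 < s -> r^-1 + s^-1 = 1 ->
  continuous f -> continuous g ->
  cint (fun x => `|f x * g x|) <=
  cint (fun x => apow r (f x)) `^ r^-1 * cint (fun x => apow s (g x)) `^ s^-1.
Proof.
move=> r0 s0 rs cf cg.
have := hoelder (sigma R) (cont_measurable cf) (cont_measurable cg) r0 s0 rs.
have cfg : continuous (fun x => f x * g x) by exact: contM.
rewrite (_ : (f \* g) = (fun x => f x * g x))// !Lnorm_cont// -EFinM lee_fin.
have -> : (fun x => apow 1 (f x * g x)) = (fun x => `|f x * g x|).
  by apply/funext => x; exact: powRr1 (normr_ge0 _).
have h0 : 0 <= cint (fun x => `|f x * g x|) by apply: cint_ge0 => x; exact: normr_ge0.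
have E1 : cint (fun x => `|f x * g x|) `^ 1^-1 = cint (fun x => `|f x * g x|).
  by move: h0; move: (cint _) => z z0; rewrite invr1 powRr1.
by rewrite E1.
Qed.

Lemma cint_CS f g : continuous f -> continuous g ->
  (cint (fun x => `|f x * g x|)) ^+ 2 <=
  cint (fun x => f x ^+ 2) * cint (fun x => g x ^+ 2).
Proof.
move=> cf cg; have i2 : 2^-1 + 2^-1 = 1 :> R by field.
have := @cint_hoelder 2 2 f g (ltr0Sn _ _) (ltr0Sn _ _) i2 cf cg.
have E h : (fun x => apow 2 (h x)) = (fun x => h x ^+ 2) :> (R -> R).
  by apply/funext => x; rewrite /apow powR_mulrn// real_normK// num_real.
have h0 h : 0 <= cint (fun x => h x ^+ 2) :> R.
  by apply: cint_ge0 => x; exact: sqr_ge0.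
rewrite !E !powR12_sqrt// -sqrtrM// => H.
apply: le_trans (_ : Num.sqrt (cint (fun x => f x ^+ 2) * cint (fun x => g x ^+ 2)) ^+ 2 <= _).
  by rewrite ler_pXn2r ?nnegrE ?sqrtr_ge0//; apply: cint_ge0.
by rewrite sqr_sqrtr// mulr_ge0.
Qed.

End CircleNorms.

(** * The carre du champ identity *)

(* Matching the head symbol avoids failed unifications, which unfold a lot. *)
Ltac cts := repeat match goal with
  | H : forall x, continuous_at x ?f |- forall x, continuous_at x ?f => exact H
  | H : forall x, continuous_at x ?f |- forall x, continuous_at x (fun y => ?f y) =>
      exact H
  | |- forall x, continuous_at x (fun y => @?f y - @?g y) => apply: (@contB _ f g)
  | |- forall x, continuous_at x (fun y => @?f y + @?g y) => apply: (@contD _ f g)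
  | |- forall x, continuous_at x (fun y => @?f y * @?g y) => apply: (@contM _ f g)
  | |- forall x, continuous_at x (fun y => @?f y ^+ 2) => apply: (@contM _ f f)
  | |- forall x, continuous_at x (fun y => - @?f y) => apply: (@contN _ f)
  | |- forall x, continuous_at x (fun y => `|@?f y|) => apply: (@cont_norm _ f)
  | |- forall x, continuous_at x (fun y => apow ?r (@?f y)) =>
      apply: (@apow_comp_continuous _ r f)
  | |- forall x, continuous_at x (fun _ => ?c) => apply: (@cont_cst _ c)
  | |- _ => assumption
  end.

(** The left-hand side of the carre du champ estimate as a function of x = P. Being nonincreasing
    and continuous in x, it tolerates the replacement of u by a shifted function. *)
Definition profile (R : realType) (a b r x : R) : R := a * x `^ (- r) + b * x `^ (- 1).

Lemma profileE (R : realType) (a k c r x : R) : 0 < x ->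
  a * x `^ (- r) + k * (c / x) = profile a (k * c) r x.
Proof. by move=> x0; rewrite /profile (powRN x 1) powRr1 ?(ltW x0)// mulrA. Qed.

Lemma profile_noninc (R : realType) (a b r x y : R) : 0 <= a -> 0 <= b -> 0 <= r ->
  0 < x -> x <= y -> profile a b r y <= profile a b r x.
Proof.
move=> a0 b0 r0 x0 xy; apply: lerD; apply: ler_wpM2l => //; apply: le_powR_neg => //.
  by rewrite oppr_le0.
Qed.

Lemma profile_continuous (R : realType) (a b r x : R) : 0 < x ->
  {for x, continuous (profile a b r)}.
Proof.
move=> x0.
have cP s : {for x, continuous (@powR R ^~ s)}.
  apply: differentiable_continuous; apply/derivable1_diffP.
  by apply: derivable_powR; rewrite in_itv/= andbT.
by apply: continuousD; apply: continuousM; [exact: cst_continuous|exact: cP|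
  exact: cst_continuous|exact: cP].
Qed.

(** Serves for both limits of the proof, the shift of u tending to 0 and q decreasing to p. The same
    e measures the displacement and the error. *)
Lemma le_of_right_limit (R : realType) (phi : R -> R) (x c : R) :
  {for x, continuous phi} -> (forall e, 0 < e -> phi (x + e) <= c + e) -> phi x <= c.
Proof.
move=> cphi key; rewrite leNgt; apply/negP => lt.
pose g := phi x - c; have g0 : 0 < g by rewrite subr_gt0.
have /cphi[d /= d0 Hd] : nbhs (phi x) (ball (phi x) (g / 2)).
  by apply: nbhsx_ballx; rewrite divr_gt0.
pose e := Num.min d g / 4.
have m0 : 0 < Num.min d g by rewrite lt_min d0.
have e0 : 0 < e by rewrite divr_gt0.
have : e < Num.min d g by rewrite /e; lra.
have : e <= Num.min d g / 4 by [].
have : Num.min d g <= g by rewrite ge_min lexx orbT.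
move=> mg emg; rewrite lt_min => /andP[ed eg].
have := Hd (x + e); rewrite /= /ball /= opprD addNKr normrN gtr0_norm// => /(_ ed).
move=> /(le_lt_trans (ler_norm _)); have := key e e0; rewrite /g in mg *.
lra.
Qed.

(** The chain lam A^2 <= lam V S B <= A^k S B, divided by A^k S. Here A is the energy, B the
    dissipation, V the squared p-norm of u minus its mean, and S = P^(1-2/p). *)
Lemma dissipation_algebra (R : realType) (k lam A X S V B : R) :
  0 <= lam -> 0 < A -> 0 < S -> 0 <= B -> A ^+ 2 <= X * B -> X <= V * S ->
  lam * V <= A `^ k -> lam * A `^ (2 - k) * S^-1 <= B.
Proof.
move=> lam0 A0 S0 B0 AB fH HP.
rewrite ler_pdivrMr// powRDp// powRN (_ : A `^ 2 = A ^+ 2); last first.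
  by rewrite powR_mulrn// ltW.
have a0 : 0 < A `^ k by rewrite powR_gt0.
rewrite mulrA ler_pdivrMr//.
apply: (@le_trans _ _ (lam * (V * S * B))).
  by rewrite ler_wpM2l// (le_trans AB)// ler_wpM2r.
rewrite (_ : lam * (V * S * B) = lam * V * (B * S)); last by ring.
by rewrite mulrC ler_wpM2l// mulr_ge0// ltW.
Qed.

Section CarreDuChamp.
Context {R : realType}.
Notation T := (2 * pi : R).
Context (p q al ga : R) (u w : R -> R).
Context (hp : 2 < p) (hq : p - 1 < q).
Context (u_ge0 : forall x, 0 <= u x).
Context (uT : forall x, u (x + T) = u x) (wT : forall x, w (x + T) = w x).
Context (du : forall x : R, is_derive x 1 u (spow (p - 1)^-1 (w x))).
Context (dw : forall x : R,
  is_derive x 1 w (- (al * u x `^ (p - 1) + ga * u x `^ (q - 1)))).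

(** The exponent conjugate to p. With v = u' and w = |u'|^(p-2) u', the density E below is |w|^p' =
    v w = |u'|^p. *)
Let p' := 1 + (p - 1)^-1.
Let kap := (1 + q - p) * ((p - 1) ^+ 2 / (2 * p - 1)).
Let E x := apow p' (w x).
Let v x := spow (p - 1)^-1 (w x).
Let w' x := - (al * u x `^ (p - 1) + ga * u x `^ (q - 1)).
Let A := cint E.

Let p1_gt0 : 0 < p - 1. Proof. by rewrite subr_gt0 (lt_trans _ hp)// ltr1n. Qed.
Let ip_gt0 : 0 < (p - 1)^-1. Proof. by rewrite invr_gt0. Qed.

Let p'_gt1 : 1 < p'. Proof. by rewrite /p' ltrDl. Qed.

Let contu : continuous u. Proof. exact: is_derive_continuous du. Qed.
Let contw : continuous w. Proof. exact: is_derive_continuous dw. Qed.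
Let contv : continuous v.
Proof. by apply: cont_comp contw; exact: spow_continuous. Qed.
Let contE : continuous E.
Proof. by apply: apow_comp_continuous => //; exact: lt_trans p'_gt1. Qed.

Let powE r x : 0 < r -> u x `^ r = apow r (u x).
Proof. by move=> r0; rewrite /apow ger0_norm. Qed.

Let contw' : continuous w'.
Proof.
rewrite (_ : w' = fun x => - (al * apow (p - 1) (u x) + ga * apow (q - 1) (u x))).
  by cts; (move: hp hq; lra).
by apply/funext => x; rewrite /w' !powE//; (move: hp hq; lra).
Qed.

Let vw x : v x * w x = E x.
Proof. by rewrite /v spowM// /E /p' addrC. Qed.

Let E_ge0 x : 0 <= E x. Proof. exact: apow_ge0. Qed.

Let dE (x : R) : is_derive x 1 E (p' * (v x * w' x)).
Proof.
have H : is_derive (w x) 1 (apow p') (p' * v x).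
  have -> : v x = spow (p' - 1) (w x) by rewrite /v /p' [1 + _]addrC addrK.
  exact: is_derive_apow.
by have := is_derive1_comp H (dw x); rewrite -mulrA.
Qed.

Let dEw (x : R) : is_derive x 1 (fun y => E y * w y) ((p' + 1) * (E x * w' x)).
Proof.
have := is_deriveM (dE x) (dw x).
rewrite /GRing.scale /= => H.
have <- : E x * w' x + w x * (p' * (v x * w' x)) = (p' + 1) * (E x * w' x).
  by rewrite -vw; ring.
exact: H.
Qed.

Let u_bounded : exists2 K, 0 < K & forall x, u x <= K.
Proof.
have [x0 _ H] := periodic_max contu uT.
by exists (u x0 + 1) => [|x]; [rewrite ltr_wpDl|rewrite (le_trans (H x))// lerDl].
Qed.

(* First integral: [|u'|^p + p' (al u^p / p + ga u^q / q)] is constant; its value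
   is read off at a minimum of [u], where [u' = 0]. *)
Let E_le : exists2 C, 0 <= C & forall x, E x <= C * (u x `^ p + u x `^ q).
Proof.
have [x0 _ H0] := periodic_min contu uT.
have v0 : v x0 = 0 by exact: is_derive_min_eq0 du H0.
have E0 : E x0 = 0 by rewrite -vw v0 mul0r.
pose G (x : R) := al / p * apow p (u x) + ga / q * apow q (u x).
have p0 : p != 0 by rewrite gt_eqF// (lt_trans _ hp).
have q1 : 1 < q by rewrite (lt_trans _ hq)// ltrBrDr.
have q0 : q != 0 by rewrite gt_eqF// (lt_trans _ q1).
have dG (x : R) : is_derive x 1 G (- (v x * w' x)).
  have H1 := is_derive1_comp (is_derive_apow (u x) (lt_trans (ltr1n R 2) hp)) (du x).
  have H2 := is_derive1_comp (is_derive_apow (u x) q1) (du x).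
  have := is_deriveD (is_deriveZ (al / p) H1) (is_deriveZ (ga / q) H2).
  rewrite /GRing.scale /= => H.
  have -> : - (v x * w' x) = al / p * (p * spow (p - 1) (u x) * spow (p - 1)^-1 (w x)) +
     ga / q * (q * spow (q - 1) (u x) * spow (p - 1)^-1 (w x)).
    rewrite (spow_ge0E p1_gt0)// (@spow_ge0E _ (q - 1)) ?subr_gt0//.
    by rewrite /w' -/(v x); field; rewrite p0 q0.
  exact: H.
have cstE x y : E x + p' * G x = E y + p' * G y.
  apply: (is_derive0_cst (F := fun x => E x + p' * G x)) => z.
  have := is_deriveD (dE z) (is_deriveZ p' (dG z)).
  rewrite /GRing.scale /= => H.
  have -> : 0 = p' * (v z * w' z) + p' * - (v z * w' z) by ring.
  exact: H.
exists (p' * (`|al / p| + `|ga / q|)).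
  by rewrite mulr_ge0 ?addr_ge0// ltW// (lt_trans _ p'_gt1).
move=> x; have -> : E x = p' * (G x0 - G x) by have := cstE x x0; rewrite E0 mulrBr; lra.
rewrite -mulrA ler_wpM2l ?(ltW (lt_trans _ p'_gt1))//.
have mono r : 0 < r -> 0 <= u x `^ r - u x0 `^ r <= u x `^ r.
  move=> r0; rewrite subr_ge0 lerBlDr lerDl powR_ge0 andbT.
  by rewrite ge0_ler_powR ?nnegrE// ltW.
have -> : G x0 - G x = - (al / p) * (u x `^ p - u x0 `^ p) + - (ga / q) * (u x `^ q - u x0 `^ q).
  by rewrite /G !powE ?(lt_trans _ hp)// ?(lt_trans _ q1)//; ring.
have /andP[m1 m1'] := mono p (lt_trans (ltr0n R 2) hp).
have /andP[m2 m2'] := mono q (lt_trans ltr01 q1).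
have n1 := ler_norm (- (al / p)); have n2 := ler_norm (- (ga / q)).
rewrite !normrN in n1 n2.
have k1 := normr_ge0 (al / p); have k2 := normr_ge0 (ga / q).
move: n1 n2 k1 k2 m1 m1' m2 m2'.
move: (- (al / p)) (- (ga / q)) `|al / p| `|ga / q| (u x `^ p) (u x0 `^ p) (u x `^ q) (u x0 `^ q).
by move=> a b c d X Y Z W *; nra.
Qed.

Section Shift.
Context (e : R) (e0 : 0 < e).
Let U x := u x + e.
Let U_gt0 x : 0 < U x. Proof. by rewrite /U ltr_wpDl. Qed.

Let UD x s t : U x `^ (s + t) = U x `^ s * U x `^ t.
Proof. exact: powRDp. Qed.

Let dU s (x : R) : is_derive x 1 (fun y => U y `^ s) (s * U x `^ (s - 1) * v x).
Proof.
have H : is_derive (U x) 1 (@powR R ^~ s) (s * U x `^ (s - 1)).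
  exact: is_derive1_powR.
have H2 : is_derive x 1 U (v x).
  by rewrite -[v x]addr0; apply: is_deriveD.
exact: (is_derive1_comp H H2).
Qed.

Let contU s : continuous (fun x => U x `^ s).
Proof. exact: is_derive_continuous (dU s). Qed.

Let contU0 : continuous U. Proof. by rewrite /U; cts. Qed.

Let UT s : U T `^ s = U 0 `^ s.
Proof. by rewrite /U -(uT 0) add0r. Qed.

Let wTT : w T = w 0. Proof. by rewrite -(wT 0) add0r. Qed.

(** The factor 1 + q - p is the one for which U^(q-1) [test] is the derivative of the periodic
    function U^(1+q-p) w; this eliminates ga. *)
Let test x := U x `^ (2 - p) * w' x + (1 + q - p) * (U x `^ (1 - p) * E x).

Let conttest : continuous test. Proof. by rewrite /test; cts; exact: contU. Qed.

Let test_q : cint (fun x => U x `^ (q - 1) * test x) = 0.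
Proof.
apply: (@cint_periodic _ (fun x => U x `^ (1 + q - p) * w x)).
- move=> x; have := is_deriveM (dU (1 + q - p) x) (dw x).
  rewrite /GRing.scale /= => H.
  have -> : U x `^ (q - 1) * test x = U x `^ (1 + q - p) * w' x +
     w x * ((1 + q - p) * U x `^ (1 + q - p - 1) * v x).
    rewrite /test -vw (_ : 1 + q - p - 1 = (q - 1) + (1 - p)); last by ring.
    rewrite (_ : 1 + q - p = (q - 1) + (2 - p)); last by ring.
    by rewrite !UD; ring.
  exact: H.
- by cts; exact: contU.
- by rewrite UT wTT.
Qed.

(** The integrand is (U w)' + (q - p) E, and the first term integrates to 0. *)
Let test_p : cint (fun x => U x `^ (p - 1) * test x) = (q - p) * A.
Proof.
have H1 : cint (fun x => U x * w' x + E x) = 0.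
  apply: (@cint_periodic _ (fun x => U x `^ 1 * w x)).
  - move=> x; have := is_deriveM (dU 1 x) (dw x).
    rewrite /GRing.scale /= => H.
    have -> : U x * w' x + E x = U x `^ 1 * w' x + w x * (1 * U x `^ (1 - 1) * v x).
      by rewrite -vw subrr powRr0 powRr1 ?ltW//; ring.
    exact: H.
  - by cts.
  - by rewrite UT wTT.
rewrite (_ : (fun x => _) = (fun x => (U x * w' x + E x) + (q - p) * E x)).
  by rewrite cintD ?H1 ?add0r ?cintZ//; cts.
apply/funext => x; rewrite /test mulrDr mulrA -UD mulrCA [_ * (_ * E x)]mulrA -UD.
rewrite (_ : p - 1 + (2 - p) = 1); last by ring.
by rewrite (_ : p - 1 + (1 - p) = 0) ?powRr0 ?powRr1 ?ltW//; ring.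
Qed.

Let B := cint (fun x => U x `^ (2 - p) * w' x ^+ 2).
Let D := cint (fun x => E x ^+ 2 * U x `^ (- p)).

(** Integrates the derivative of U^(1-p) E w, where E w has derivative (p' + 1) E w'. The constant
    is (p - 1) / (p' + 1), which is the origin of [kap]. *)
Let cross : cint (fun x => w' x * (U x `^ (1 - p) * E x)) = (p - 1) ^+ 2 / (2 * p - 1) * D.
Proof.
have : cint (fun x => (p' + 1) * (w' x * (U x `^ (1 - p) * E x)) -
   (p - 1) * (E x ^+ 2 * U x `^ (- p))) = 0.
  apply: (@cint_periodic _ (fun x => U x `^ (1 - p) * (E x * w x))).
  - move=> x; have := is_deriveM (dU (1 - p) x) (dEw x).
    rewrite /GRing.scale /= => H.
    have -> : (p' + 1) * (w' x * (U x `^ (1 - p) * E x)) -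
       (p - 1) * (E x ^+ 2 * U x `^ (- p)) =
       U x `^ (1 - p) * ((p' + 1) * (E x * w' x)) +
       (E x * w x) * ((1 - p) * U x `^ (1 - p - 1) * v x).
      by rewrite (_ : 1 - p - 1 = - p) -?vw; ring.
    exact: H.
  - by cts; exact: contU.
  - rewrite UT /E wTT//.
have cD : continuous (fun x => E x ^+ 2 * U x `^ (- p)).
  by apply: contM; [rewrite (_ : (fun x => _) = (fun x => E x * E x))//; cts|exact: contU].
rewrite cintB; [|by cts; exact: contU|by apply: contZ].
rewrite !cintZ//; last by cts; exact: contU.
rewrite /p' => /eqP; rewrite subr_eq0 => /eqP H.
have : (1 + (p - 1)^-1 + 1) != 0 by rewrite gt_eqF// !addr_gt0.
move=> n0; apply: (mulfI n0); rewrite H /D; field.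
by rewrite !gt_eqF//; (move: hp hq; lra).
Qed.

(** The price of the shift: the equation holds with powers of u, while [test] is adapted to powers
    of U. *)
Let dlt x := al * (U x `^ (p - 1) - u x `^ (p - 1)) + ga * (U x `^ (q - 1) - u x `^ (q - 1)).

Let contdlt : continuous dlt.
Proof.
rewrite (_ : dlt = fun x => al * (U x `^ (p - 1) - apow (p - 1) (u x)) + ga * (U x `^ (q - 1) - apow (q - 1) (u x))).
  by cts; try exact: contU; (move: hp hq; lra).
by apply/funext => x; rewrite /dlt !powE//; (move: hp hq; lra).
Qed.

(** Both sides are the integral of w' [test], expanded on the left by the definition of [test] and
    on the right by the equation for w'. *)
Let balance : B + kap * D = al * (p - q) * A + cint (fun x => dlt x * test x).
Proof.
have cw2 : continuous (fun x => U x `^ (2 - p) * w' x ^+ 2).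
  by apply: contM; [exact: contU|rewrite (_ : (fun x => _) = (fun x => w' x * w' x))//; cts].
have -> : B + kap * D = cint (fun x => w' x * test x).
  rewrite (_ : (fun x => w' x * test x) = (fun x => U x `^ (2 - p) * w' x ^+ 2 +
    (1 + q - p) * (w' x * (U x `^ (1 - p) * E x)))); last first.
    by apply/funext => x; rewrite /test; ring.
  rewrite cintD//; last by cts; exact: contU.
  by rewrite cintZ ?cross -?mulrA//; cts; exact: contU.
rewrite (_ : (fun x => w' x * test x) = (fun x => (- al * (U x `^ (p - 1) * test x) +
   - ga * (U x `^ (q - 1) * test x)) + dlt x * test x)); last first.
  by apply/funext => x; rewrite /dlt /w'; ring.
have c1 : continuous (fun x => U x `^ (p - 1) * test x) by cts; exact: contU.
have c2 : continuous (fun x => U x `^ (q - 1) * test x) by cts; exact: contU.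
rewrite cintD; [|by cts|by cts].
rewrite cintD; [|by cts|by cts].
by rewrite !cintZ// test_p test_q; ring.
Qed.

Let Pe := cint (fun x => U x `^ p).

Let Pe_gt0 : 0 < Pe.
Proof.
have := @cint_gt0 R (fun x => U x `^ p) 0 (@contU p); apply.
- by move=> x; exact: powR_ge0.
- by rewrite lexx ltW// two_pi_gt0.
- by rewrite powR_gt0.
Qed.

Lemma energy_CS : A ^+ 2 <= D * Pe.
Proof.
pose f x := E x * U x `^ (- (p / 2)); pose g x := U x `^ (p / 2).
have cf : continuous f by rewrite /f; cts; exact: contU.
have cg : continuous g by exact: contU.
have := cint_CS cf cg.
rewrite (_ : (fun x => `|f x * g x|) = E); last first.
  apply/funext => x; rewrite /f /g -mulrA -UD addNr powRr0 mulr1 ger0_norm//.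
rewrite (_ : (fun x => f x ^+ 2) = (fun x => E x ^+ 2 * U x `^ (- p))); last first.
  apply/funext => x; rewrite /f exprMn; congr (_ * _); rewrite expr2 -UD; congr powR; by field.
rewrite (_ : (fun x => g x ^+ 2) = (fun x => U x `^ p))//.
by apply/funext => x; rewrite /g expr2 -UD; congr powR; by field.
Qed.

(** The energy is minus the integral of (u - m) w'. With the weight U^((p-2)/2) moved between the
    factors, Cauchy-Schwarz leaves B and a weighted variance; Hoelder with exponents p / 2 and p /
    (p - 2) reduces the latter to the Poincare inequality for u. *)
Lemma energy_dissipation lam : 0 <= lam -> 0 < A ->
  lam * cint (fun x => apow p (u x - cint u)) `^ (2 / p) <= A `^ (2 / p) ->
  lam * A `^ (2 - 2 / p) * Pe `^ (- (1 - 2 / p)) <= B.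
Proof.
move=> lam0 A0 HP.
set m := cint u in HP *.
pose f x := (u x - m) * U x `^ ((p - 2) / 2).
pose g x := w' x * U x `^ (- ((p - 2) / 2)).
have cf : continuous f by rewrite /f; cts; exact: contU.
have cg : continuous g by rewrite /g; cts; exact: contU.
have cum : continuous (fun x => u x - m) by cts.
have H1 : A = cint (fun x => - (f x * g x)).
  have : cint (fun x => E x + (f x * g x)) = 0.
    apply: (@cint_periodic _ (fun x => (u x - m) * w x)).
    + move=> x; have du' : is_derive x 1 (fun y => u y - m) (v x).
        by rewrite -[v x]subr0; apply: is_deriveB.
      have := is_deriveM du' (dw x); rewrite /GRing.scale /= => H.
      have -> : E x + f x * g x = (u x - m) * w' x + w x * v x.
        rewrite /f /g mulrACA -UD subrr powRr0 -vw; ring.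
      exact: H.
    + by cts.
    + by rewrite wTT -(uT 0) add0r.
  rewrite cintD//; last by cts.
  move=> H; rewrite (_ : (fun x => - _) = (fun x => (-1) * (f x * g x))); last first.
    by apply/funext => x; ring.
  by rewrite cintZ; [rewrite mulN1r; apply/eqP; rewrite -addr_eq0; apply/eqP|cts].
have AB : A ^+ 2 <= cint (fun x => f x ^+ 2) * B.
  have := cint_CS cf cg.
  rewrite (_ : (fun x => g x ^+ 2) = (fun x => U x `^ (2 - p) * w' x ^+ 2)); last first.
    apply/funext => x; rewrite /g exprMn mulrC; congr (_ * _); rewrite expr2 -UD; congr powR; by field.
  apply: le_trans; rewrite ler_pXn2r ?nnegrE ?(ltW A0)//; last first.
    by apply: cint_ge0.
  rewrite H1; apply: le_cint; [by cts|by cts|].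
  by move=> x; rewrite -normrN; exact: ler_norm.
have fH : cint (fun x => f x ^+ 2) <=
    cint (fun x => apow p (u x - m)) `^ (2 / p) * Pe `^ (1 - 2 / p).
  pose F x := (u x - m) ^+ 2; pose G x := U x `^ (p - 2).
  have cF : continuous F by rewrite /F; cts.
  have cG : continuous G by exact: contU.
  have p0 : p != 0 by rewrite gt_eqF// (lt_trans _ hp).
  have p2 : p - 2 != 0 by rewrite gt_eqF// subr_gt0.
  have e1 : (p / 2)^-1 = 2 / p by field.
  have e2 : (p / (p - 2))^-1 = 1 - 2 / p by field; rewrite p0.
  have := @cint_hoelder R (p / 2) (p / (p - 2)) F G _ _ _ cF cG.
  rewrite e1 e2.
  rewrite (_ : (fun x => `|F x * G x|) = (fun x => f x ^+ 2)); last first.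
    apply/funext => x; rewrite ger0_norm; last first.
      by apply: mulr_ge0; [exact: sqr_ge0|exact: powR_ge0].
    by rewrite [RHS]exprMn; congr (_ * _); rewrite expr2 -UD; congr powR; field.
  rewrite (_ : (fun x => apow (p / 2) (F x)) = (fun x => apow p (u x - m))); last first.
    apply/funext => x; rewrite /apow /F normrX -powR_mulrn// -powRrM; congr powR; by field.
  rewrite (_ : (fun x => apow (p / (p - 2)) (G x)) = (fun x => U x `^ p)); last first.
    apply/funext => x; rewrite /apow /G ger0_norm ?powR_ge0// -powRrM; congr powR.
    by field.
  apply; [by rewrite divr_gt0// (lt_trans _ hp)| by rewrite divr_gt0// ?subr_gt0// (lt_trans _ hp)|by ring].
have B0 : 0 <= B by apply: cint_ge0 => x; rewrite mulr_ge0 ?powR_ge0 ?sqr_ge0.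
have S0 : 0 < Pe `^ (1 - 2 / p) by exact: powR_gt0 Pe_gt0.
have := dissipation_algebra lam0 A0 S0 B0 AB fH HP.
by move: (Pe) => y; rewrite -powRN.
Qed.

(** Facts stated with [Let] do not survive the section; these names keep the ones required when the
    shift varies. *)
Definition shift_contU := contU.
Definition shift_contdlt := contdlt.
Definition shift_conttest := conttest.
Definition shift_balance := balance.
Definition shift_Pe_gt0 := Pe_gt0.

End Shift.

(** The functions of the section just closed, with the shift as an argument. *)
Let dlt e x := al * ((u x + e) `^ (p - 1) - u x `^ (p - 1)) +
  ga * ((u x + e) `^ (q - 1) - u x `^ (q - 1)).
Let test e x := (u x + e) `^ (2 - p) * w' x +
  (1 + q - p) * ((u x + e) `^ (1 - p) * E x).

(** The negative powers of U = u + e are compensated by positive powers of u <= U, coming from w'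
    and from the first integral bound on E. The total exponents are 1 and 1 + q - p, both
    positive. *)
Let test_bounded : exists2 C, 0 < C & forall e x, 0 < e <= 1 -> `|test e x| <= C.
Proof.
have [K K0 HK] := u_bounded; have [C C0 HC] := E_le.
have a0 : 0 < 1 + q - p by move: hp hq; lra.
pose M := (K + 1) + (K + 1) `^ (1 + q - p).
have M0 : 0 < M by rewrite addr_gt0 ?powR_gt0//; lra.
exists ((`|al| + `|ga| + (1 + q - p) * (C + C)) * M + 1).
  apply: ltr_wpDl => //; apply: mulr_ge0; last exact: ltW.
  apply: addr_ge0; first exact: addr_ge0.
  by apply: mulr_ge0; [exact: ltW|exact: addr_ge0].
move=> e x /andP[e0 e1]; rewrite /test.
set U := u x + e; have U0 : 0 < U by rewrite /U ltr_wpDl.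
have uU : u x <= U by rewrite lerDl ltW.
have UK : U <= K + 1 by rewrite lerD.
have le_u r : 0 < r -> u x `^ r <= U `^ r.
  by move=> r0; rewrite ge0_ler_powR ?nnegrE// ?ltW.
have U1 : U <= M by rewrite (le_trans UK)// lerDl powR_ge0.
have Ua : U `^ (1 + q - p) <= M.
  apply: le_trans (_ : (K + 1) `^ (1 + q - p) <= _); last by rewrite lerDr addr_ge0// ltW.
  by rewrite ge0_ler_powR ?nnegrE// ?(ltW a0)// ?(ltW U0)// ltW// ltr_wpDl// ltW.
have p0 : 0 < p by move: hp; lra.
have q1 : 0 < q - 1 by move: hp hq; lra.
have q0 : 0 < q by move: hp hq; lra.
have t1 : U `^ (2 - p) * u x `^ (p - 1) <= M.
  apply: le_trans (_ : U `^ (2 - p) * U `^ (p - 1) <= _).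
    by rewrite ler_wpM2l ?powR_ge0 ?le_u.
  by rewrite -powRDp// (_ : 2 - p + (p - 1) = 1) ?powRr1 ?(ltW U0)//; ring.
have t2 : U `^ (2 - p) * u x `^ (q - 1) <= M.
  apply: le_trans (_ : U `^ (2 - p) * U `^ (q - 1) <= _).
    by rewrite ler_wpM2l ?powR_ge0 ?le_u.
  by rewrite -powRDp// (_ : 2 - p + (q - 1) = 1 + q - p)//; ring.
have t3 : U `^ (1 - p) * u x `^ p <= M.
  apply: le_trans (_ : U `^ (1 - p) * U `^ p <= _).
    by rewrite ler_wpM2l ?powR_ge0 ?le_u.
  by rewrite -powRDp// (_ : 1 - p + p = 1) ?powRr1 ?(ltW U0)//; ring.
have t4 : U `^ (1 - p) * u x `^ q <= M.
  apply: le_trans (_ : U `^ (1 - p) * U `^ q <= _).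
    by rewrite ler_wpM2l ?powR_ge0 ?le_u.
  by rewrite -powRDp// (_ : 1 - p + q = 1 + q - p)//; ring.
have s1 : `|U `^ (2 - p) * w' x| <= (`|al| + `|ga|) * M.
  rewrite normrM /w' normrN ger0_norm ?powR_ge0//.
  apply: le_trans (_ : U `^ (2 - p) * (`|al| * u x `^ (p - 1) + `|ga| * u x `^ (q - 1)) <= _).
    rewrite ler_wpM2l ?powR_ge0// (le_trans (ler_normD _ _))// !normrM.
    by rewrite !(ger0_norm (powR_ge0 _ _)).
  rewrite mulrDr !(mulrCA (U `^ _)) mulrDl lerD// ler_wpM2l//.
have s2 : U `^ (1 - p) * E x <= C * (M + M).
  apply: le_trans (_ : U `^ (1 - p) * (C * (u x `^ p + u x `^ q)) <= _).
    by rewrite ler_wpM2l ?powR_ge0.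
  by rewrite mulrCA ler_wpM2l// mulrDr lerD.
rewrite (le_trans (ler_normD _ _))// [`|(1 + q - p) * _|]ger0_norm; last first.
  by rewrite mulr_ge0 ?(ltW a0)// mulr_ge0 ?powR_ge0.
apply: (@le_trans _ _ ((`|al| + `|ga|) * M + (1 + q - p) * (C * (M + M)))); last by lra.
by rewrite lerD// ler_wpM2l// ltW.
Qed.

Let err_small eta : 0 < eta -> exists2 d, 0 < d & forall e, 0 < e < d ->
  `|cint (fun x => dlt e x * test e x)| <= eta.
Proof.
move=> eta0; have [C C0 HC] := test_bounded; have [K K0 HK] := u_bounded.
have q1 : 0 < q - 1 by move: hp hq; lra.
have K1 : 0 < K + 1 by lra.
pose L := `|al| + `|ga| + 1.
have L0 : 0 < L by rewrite ltr_wpDl ?addr_ge0.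
have t0 : 0 < eta / (L * C) by rewrite divr_gt0 ?mulr_gt0.
have [d1 d10 H1] := powR_modulus p1_gt0 K1 t0.
have [d2 d20 H2] := powR_modulus q1 K1 t0.
exists (Num.min 1 (Num.min d1 d2)); first by rewrite !lt_min ltr01 d10.
move=> e /andP[e0]; rewrite !lt_min => /and3P[e1 ed1 ed2].
have cd : continuous (dlt e) by exact: shift_contdlt.
have ct : continuous (test e) by exact: shift_conttest.
apply: le_trans (norm_cint_le _) _; first by cts.
rewrite -[leRHS](@cint_cst R); apply: le_cint; [by cts|by cts|].
move=> x; rewrite normrM.
have b x' : `|u x' + e - u x'| = e by rewrite addrC addKr gtr0_norm.
have i1 : 0 <= u x <= K + 1 by rewrite u_ge0 (le_trans (HK x))// lerDl.
have i2 : 0 <= u x + e <= K + 1 by rewrite addr_ge0 ?(ltW e0)// lerD// ltW.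
have h1 := H1 _ _ i1 i2; have h2 := H2 _ _ i1 i2.
rewrite b in h1 h2; have {}h1 := h1 ed1; have {}h2 := h2 ed2.
apply: le_trans (_ : L * (eta / (L * C)) * C <= _); last first.
  by rewrite le_eqVlt; apply/orP; left; apply/eqP; field; rewrite !gt_eqF.
rewrite ler_pM ?HC ?e0 ?(ltW e1)//.
move: (eta / _) h1 h2 t0 => t h1 h2 t0.
rewrite /dlt (le_trans (ler_normD _ _))// !normrM /L.
apply: le_trans (_ : `|al| * t + `|ga| * t <= _).
  by apply: lerD; apply: ler_wpM2l.
by rewrite -mulrDl [leRHS]mulrDl mul1r lerDl ltW.
Qed.

Lemma carre_du_champ lam (P := cint (fun x => apow p (u x))) : 0 <= lam -> 0 < A -> 0 < P ->
  lam * cint (fun x => apow p (u x - cint u)) `^ (2 / p) <= A `^ (2 / p) ->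
  lam * A `^ (2 - 2 / p) * P `^ (- (1 - 2 / p)) + kap * (A ^+ 2 / P) <= al * (p - q) * A.
Proof.
move=> lam0 A0 P0 HP.
have p0 : 0 < p by exact: lt_trans hp.
have [K K0 HK] := u_bounded.
have K1 : 0 < K + 1 by exact: addr_gt0.
have kap0 : 0 <= kap.
  have p21 : 0 <= 2 * p - 1.
    by rewrite subr_ge0 (le_trans (ltW (lt_trans (ltr1n R 2) hp)))// ler_peMl ?ler1n// ltW.
  have q1 : 0 <= 1 + q - p by rewrite subr_ge0 addrC -lerBlDr ltW.
  by apply: mulr_ge0 => //; apply: divr_ge0 => //; exact: sqr_ge0.
pose a := lam * A `^ (2 - 2 / p).
have a0 : 0 <= a by exact: (mulr_ge0 lam0 (powR_ge0 _ _)).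
pose b := kap * A ^+ 2; have b0 : 0 <= b by exact: (mulr_ge0 kap0 (sqr_ge0 _)).
have r0 : 0 <= 1 - 2 / p.
  by rewrite subr_ge0 ler_pdivrMr// mul1r ltW.
(* The estimate is obtained at a small shift t, with the p-mean Pt of u + t; since Pt <= P + e,
   monotonicity of the profile replaces Pt by P + e. *)
have key e : 0 < e -> profile a b (1 - 2 / p) (P + e) <= al * (p - q) * A + e.
  move=> e0; have [d1 d10 H1] := err_small e0; have [d2 d20 H2] := powR_modulus p0 K1 e0.
  have [t t0 /and3P[t1' td1 td2]] : exists2 t, 0 < t & [&& t < 1, t < d1 & t < d2].
    exists (Num.min (Num.min 1 d1) d2 / 2); first by rewrite divr_gt0// !lt_min ltr01 d10.
    rewrite andbA -!lt_min ltr_pdivrMr// ltr_pMr ?ltr1n// !lt_min ltr01 d10//.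
  pose Pt := cint (fun x => (u x + t) `^ p).
  have Pt0 : 0 < Pt by exact: (shift_Pe_gt0 t0).
  have PtP : Pt <= P + e.
    rewrite -[e](@cint_cst R) -cintD; [|by cts|by cts].
    apply: le_cint; [exact: (shift_contU t0)|by cts|].
    move=> x; rewrite -powE//.
    have i1 : 0 <= u x <= K + 1 by rewrite u_ge0 (le_trans (HK x))// lerDl.
    have t1 : t <= 1 by exact: ltW.
    have i2 : 0 <= u x + t <= K + 1 by rewrite addr_ge0 ?(ltW t0)// lerD.
    have := H2 _ _ i1 i2; rewrite addrC addKr gtr0_norm// => /(_ td2).
    by move=> /(le_trans (ler_norm _)); rewrite lerBlDl addrC [t + _]addrC.
  apply: le_trans (profile_noninc a0 b0 r0 Pt0 PtP) _.
  have bal := shift_balance t0; have cs := energy_CS t0.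
  have ed := energy_dissipation t0 lam0 A0 HP.
  have er : `|cint (fun x => dlt t x * test t x)| <= e by apply: H1; rewrite t0.
  have er' := ler_norm (cint (fun x => dlt t x * test t x)).
  have D1 : b * Pt `^ (-1) <= kap * cint (fun x => E x ^+ 2 * (u x + t) `^ (- p)).
    rewrite -[b * _]mulrA; apply: (ler_wpM2l kap0).
    by rewrite powRN (powRr1 (ltW Pt0)) (ler_pdivrMr _ _ Pt0).
  apply: le_trans (lerD ed D1) _; rewrite bal lerD2l.
  exact: le_trans er' er.
have -> : lam * A `^ (2 - 2 / p) * P `^ (- (1 - 2 / p)) + kap * (A ^+ 2 / P) =
    profile a b (1 - 2 / p) P.
  exact: (profileE _ kap (A ^+ 2) _ P0).
exact: (le_of_right_limit (profile_continuous (a := a) (b := b) (r := 1 - 2 / p) P0) key).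
Qed.

End CarreDuChamp.

(** * Limits of functions on grids *)

Section UltraLimits.
Context {R : realType} (U : set_system nat) {UF : UltraFilter U}.
Implicit Types a b : nat -> R.

(** One ultrafilter gives limits of all bounded sequences at once, in particular at every point x of
    the line, in place of diagonal extraction. *)
Lemma ultra_cvg a K : (forall n, `|a n| <= K) -> exists l : R, a @ U --> l.
Proof.
move=> aK.
have /= := @segment_compact R (- K) K (a @ U) _.
case=> [|p [_ clp]].
  by apply: filterE => n /=; rewrite in_itv/= -ler_norml.
exists p => B Bp.
have [//|nB] := in_ultra_setVsetC (a @^-1` B) UF.
by have [y []] := clp (~` B) B nB Bp.
Qed.

End UltraLimits.

Section HeineCantor.
Context {R : realType}.

Lemma cont_modulus (phi : R -> R) K e : continuous phi -> 0 < e ->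
  exists2 d, 0 < d & forall s t, `|s| <= K -> `|t| <= K -> `|t - s| < d ->
    `|phi t - phi s| <= e.
Proof.
move=> cphi e0; apply: contrapT => H.
have bad (n : nat) : exists st : R * R, [/\ `|st.1| <= K, `|st.2| <= K,
    `|st.2 - st.1| < n.+1%:R^-1 & e < `|phi st.2 - phi st.1|].
  apply: contrapT => nb; apply: H; exists n.+1%:R^-1; first by rewrite invr_gt0.
  move=> s t sK tK st; rewrite leNgt; apply/negP => es.
  by apply: nb; exists (s, t).
have [st Hst] := choice bad.
have [U [UU ooU]] := ultraFilterLemma eventually_filter.
have [s sl] : exists s : R, (fun n => (st n).1) @ U --> s.
  by apply: (@ultra_cvg R U UU _ K) => n; case: (Hst n).
have [t tl] : exists t : R, (fun n => (st n).2) @ U --> t.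
  by apply: (@ultra_cvg R U UU _ K) => n; case: (Hst n).
have ts0 : (fun n => (st n).2 - (st n).1) @ U --> (0 : R).
  have : (fun n => (n.+1%:R : R)^-1) @ U --> (0 : R).
    by apply: cvg_trans (@cvg_harmonic R) => B HB; exact: ooU.
  move=> /cvgrPdist_lt H0; apply/cvgrPdist_lt => eps eps0.
  apply: filterS (H0 _ eps0) => n; rewrite !sub0r !normrN.
  rewrite [X in X < _ -> _]ger0_norm ?invr_ge0//; apply: lt_trans.
  by case: (Hst n).
have st0 : t = s.
  apply/eqP; rewrite -subr_eq0; apply/eqP.
  exact: (cvg_unique (@Rhausdorff R) (cvgB tl sl) ts0).
have cs : (fun n => `|phi (st n).2 - phi (st n).1|) @ U --> (0 : R).
  rewrite -(@normr0 _ R) -(subrr (phi t)); apply: cvg_norm; apply: cvgB.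
    exact: (cvg_comp _ _ tl (cphi t)).
  by rewrite st0; exact: (cvg_comp _ _ sl (cphi s)).
move/cvgrPdist_lt : cs => /(_ e e0) /filter_ex[n].
rewrite sub0r normrN normr_id; case: (Hst n) => _ _ _ h /(lt_trans h).
by rewrite ltxx.
Qed.

End HeineCantor.

Section GridLimits.
Context {R : realType} (U : set_system nat) {UF : UltraFilter U}.
Context (h : nat -> R) (h_gt0 : forall n, 0 < h n) (h0 : h @ U --> (0 : R)).
Implicit Types f g : nat -> int -> R.

(** Grid functions are read on the line as step functions, with the value at the left end of the
    cell of x. *)
Definition gfl n (x : R) : int := Num.floor (x / h n).

(** Equicontinuity uniform over all grids, with distances h m measured on the line rather than in
    indices. *)
Definition equicont g := forall e, 0 < e -> exists2 d, 0 < d & forall n k (m : nat),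
  h n * m%:R < d -> `|g n (k + m%:Z) - g n k| <= e.

Lemma grid_telescope (f g : int -> R) (s c e : R) (k : int) (m : nat) :
  (forall k, f (k + 1) - f k = s * g k) -> 0 <= s ->
  (forall i : nat, (i < m)%N -> `|g (k + i%:Z) - c| <= e) ->
  `|f (k + m%:Z) - f k - s * m%:R * c| <= s * m%:R * e.
Proof.
move=> fg s0; elim: m => [|m IH] H.
  by rewrite addr0 subrr mulr0 !mul0r subrr normr0.
have H1 := IH (fun i im => H i (leqW im)).
have H2 := H m (ltnSn m).
have -> : f (k + m.+1%:Z) - f k - s * m.+1%:R * c =
   (f (k + m%:Z) - f k - s * m%:R * c) + s * (g (k + m%:Z) - c).
  have -> : k + m.+1%:Z = k + m%:Z + 1 by rewrite -addrA -PoszD addn1.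
  by rewrite mulrBr -fg -natr1; ring.
apply: le_trans (ler_normD _ _) _.
rewrite normrM (ger0_norm s0) -natr1 mulrDr mulrDl mulr1 lerD//.
by rewrite ler_wpM2l.
Qed.

Lemma gfl_itv n x : (gfl n x)%:~R * h n <= x < ((gfl n x)%:~R + 1) * h n.
Proof.
have := floor_itv (x / h n); rewrite intrD -/(gfl n x).
by rewrite ler_pdivlMr// ltr_pdivrMr.
Qed.

(** For fixed t, the increment of f between the cells of x and x + t telescopes to t g up to e |t|,
    by equicontinuity of g, and up to a rounding error of order h n. The latter vanishes in the
    limit, which leaves the definition of the derivative. *)
Lemma grid_derive f g (F G : R -> R) (C : R) :
  (forall n k, f n (k + 1) - f n k = h n * g n k) ->
  (forall n k, `|g n k| <= C) -> equicont g ->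
  (forall x, (fun n => f n (gfl n x)) @ U --> F x) ->
  (forall x, (fun n => g n (gfl n x)) @ U --> G x) ->
  forall x : R, is_derive x 1 F (G x).
Proof.
move=> fg gC eqg Ff Gg x; apply: is_derive_epsP => e e0.
have [d d0 Hd] := eqg _ e0.
exists (d / 2); first by rewrite divr_gt0.
move=> t td.
have H : \forall n \near U, `|f n (gfl n (x + t)) - f n (gfl n x) - t * g n (gfl n x)| <=
    e * `|t| + h n * (e + C).
  have : \forall n \near U, `|0 - h n| < d / 2.
    by move/cvgrPdist_lt : h0; apply; rewrite divr_gt0.
  apply: filterS => n; rewrite sub0r normrN gtr0_norm// => hd.
  have /andP[k1 k2] := gfl_itv n x; have /andP[l1 l2] := gfl_itv n (x + t).
  set k := gfl n x in k1 k2 *; set l := gfl n (x + t) in l1 l2 *.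
  have hn := h_gt0 n; set s := h n in hd hn k1 k2 l1 l2 *.
  have C0 : 0 <= C by exact: le_trans (gC n 0).
  have dist : `|s * (l - k)%:~R - t| <= s.
    rewrite intrB; move: (l%:~R : R) (k%:~R : R) l1 l2 k1 k2 => a b *.
    by rewrite ler_norml; apply/andP; split; lra.
  have main : `|f n l - f n k - s * (l - k)%:~R * g n k| <= (`|t| + s) * e.
    have [kl|lk] := leP k l.
      pose m := `|(l - k)%R|%N.
      have mE : l - k = m%:Z by rewrite gez0_abs// subr_ge0.
      have lE : l = k + m%:Z by rewrite -mE addrC subrK.
      have sm : s * m%:R <= `|t| + s.
        move: dist; rewrite mE => /(le_trans (ler_norm _)); have := ler_norm t.
        by rewrite -[m%:Z%:~R]/(m%:R); lra.
      apply: le_trans (_ : s * m%:R * e <= _); last by rewrite ler_wpM2r// ltW.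
      rewrite mE lE; apply: (grid_telescope (fg n)); first exact: ltW.
      move=> i im; apply: Hd; apply: (@le_lt_trans _ _ (s * m%:R)).
        by rewrite ler_wpM2l ?(ltW hn)// ler_nat ltnW.
      by apply: le_lt_trans sm _; lra.
    pose m := `|(k - l)%R|%N.
    have mE : k - l = m%:Z by rewrite gez0_abs// subr_ge0 ltW.
    have lE : k = l + m%:Z by rewrite -mE addrC subrK.
    have mE' : (l - k)%:~R = - m%:R :> R by rewrite -opprB mE mulrNz.
    have sm : s * m%:R <= `|t| + s.
      move: dist; rewrite mE' => /ler_normlP[+ _]; have := ler_norm (- t); rewrite normrN; lra.
    apply: le_trans (_ : s * m%:R * e <= _); last by rewrite ler_wpM2r// ltW.
    have := @grid_telescope (f n) (g n) s (g n k) e l m (fg n) (ltW hn).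
    rewrite -lE mE' => /= H; rewrite -normrN.
    have -> : - (f n l - f n k - s * - m%:R * g n k) = f n k - f n l - s * m%:R * g n k by ring.
    apply: H => i im; rewrite distrC.
    have -> : k = l + i%:Z + (m - i)%N%:Z by rewrite -addrA -PoszD subnKC// ltnW.
    apply: Hd; apply: (@le_lt_trans _ _ (s * m%:R)).
      by rewrite ler_wpM2l ?(ltW hn)// ler_nat leq_subr.
    by apply: le_lt_trans sm _; lra.
  have -> : f n l - f n k - t * g n k = (f n l - f n k - s * (l - k)%:~R * g n k) +
     (s * (l - k)%:~R - t) * g n k by ring.
  apply: le_trans (ler_normD _ _) _; rewrite normrM.
  have gk := gC n k.
  have : `|s * (l - k)%:~R - t| * `|g n k| <= s * C by rewrite ler_pM.
  lra.
have c1 : (fun n => `|f n (gfl n (x + t)) - f n (gfl n x) - t * g n (gfl n x)|) @ U -->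
    `|F (x + t) - F x - t * G x|.
  apply: cvg_norm; apply: cvgB; first by apply: cvgB.
  by apply: cvgM => //; exact: cvg_cst.
have c2 : (fun n => e * `|t| + h n * (e + C)) @ U --> e * `|t| + 0 * (e + C).
  by apply: cvgD; [exact: cvg_cst|apply: cvgM => //; exact: cvg_cst].
have := ler_cvg_to c1 c2 H; rewrite mul0r addr0.
by rewrite [G x * t]mulrC; apply.
Qed.

End GridLimits.

Section GridMeans.
Context {R : realType}.
Notation T := (2 * pi : R).

Definition hstep (n : nat) : R := T / n.+1%:R.

Lemma hstep_gt0 n : 0 < hstep n.
Proof. by rewrite divr_gt0 ?two_pi_gt0. Qed.

Lemma hstep_cvg0 : hstep n @[n --> \oo] --> (0 : R).
Proof.
rewrite -[0](mulr0 T); apply: cvgM; first exact: cvg_cst.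
exact: cvg_harmonic.
Qed.

Lemma hstepT n (k : int) : (k%:~R * hstep n = T) <-> (k = n.+1%:Z).
Proof.
split=> [|->]; last by rewrite /hstep mulrC divfK// pnatr_eq0.
move/eqP; rewrite /hstep mulrCA -[X in _ == X]mulr1.
rewrite -subr_eq0 -mulrBr mulf_eq0 gt_eqF ?two_pi_gt0//= subr_eq0 => /eqP H.
apply/eqP; rewrite -(eqr_int R); apply/eqP.
by rewrite -[LHS](divfK (_ : n.+1%:R != 0 :> R)) ?pnatr_eq0// H mul1r.
Qed.

Lemma gfl0 n : gfl hstep n 0 = 0.
Proof. by rewrite /gfl mul0r floor0. Qed.

Lemma gflDT n x : gfl hstep n (x + T) = gfl hstep n x + n.+1%:Z.
Proof.
rewrite /gfl mulrDl; have -> : T / hstep n = n.+1%:Z%:~R.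
  by rewrite /hstep invfM invrK mulrA divff ?mul1r// gt_eqF ?two_pi_gt0.
by rewrite floorDrz ?intr_int// intrKfloor.
Qed.

(** These build a discrete primitive on all integers, vanishing at 0. A Riemann sum is its value at
    n + 1, so that [grid_derive] applies to Riemann sums. *)
Fixpoint zsum_pos (s : int -> R) (n : nat) : R :=
  if n is m.+1 then zsum_pos s m + s m%:Z else 0.
Fixpoint zsum_neg (s : int -> R) (n : nat) : R :=
  if n is m.+1 then zsum_neg s m - s (- m.+1%:Z) else 0.
Definition zsum s (k : int) : R :=
  match k with Posz n => zsum_pos s n | Negz n => zsum_neg s n.+1 end.

Lemma zsumS s k : zsum s (k + 1) - zsum s k = s k.
Proof.
case: k => [n|[|n]].
- by rewrite -PoszD addn1 /= addrC addKr.
- by rewrite /= sub0r add0r opprK.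
- have -> : Negz n.+1 + 1 = Negz n by rewrite !NegzE; lia.
  by rewrite /= NegzE; ring.
Qed.

Lemma zsum_natE s n : zsum s n%:Z = \sum_(k < n) s k%:Z.
Proof. by elim: n => [|n IH] /=; rewrite ?big_ord0// big_ord_recr /= -IH. Qed.

Lemma zsum_bound s C k : (forall k, `|s k| <= C) -> `|zsum s k| <= C * `|k|%N%:R.
Proof.
move=> sC; case: k => n /=.
  elim: n => [|n IH] /=; first by rewrite normr0 mulr0.
  by rewrite (le_trans (ler_normD _ _))// -natr1 mulrDr mulr1 lerD.
rewrite -/(zsum_neg s n.+1); elim: n.+1 => [|m IH] /=; first by rewrite normr0 mulr0.
by rewrite (le_trans (ler_normB _ _))// -natr1 mulrDr mulr1 lerD.
Qed.

Context (U : set_system nat) {UF : UltraFilter U} (ooU : \oo `<=` U).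

Lemma hstep_cvg : hstep @ U --> (0 : R).
Proof. by move=> B HB; apply: ooU; exact: hstep_cvg0. Qed.

(** The limit F of the discrete primitives has derivative G, so the fundamental theorem of calculus
    identifies F (2 pi) with the integral of G. *)
Lemma grid_mean (g : nat -> int -> R) (G : R -> R) (C : R) :
  (forall n k, `|g n k| <= C) -> equicont hstep g ->
  (forall x, (fun n => g n (gfl hstep n x)) @ U --> G x) -> continuous G ->
  (fun n => n.+1%:R^-1 * \sum_(k < n.+1) g n k%:Z) @ U --> cint G.
Proof.
move=> gC eqg Gg cG.
pose f n k := hstep n * zsum (g n) k.
have fb n x : `|f n (gfl hstep n x)| <= C * (`|x| + T).
  have C0 : 0 <= C by exact: le_trans (gC 0%N 0).
  have h0 := hstep_gt0 n.
  rewrite /f normrM (gtr0_norm h0).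
  apply: le_trans (_ : hstep n * (C * `|gfl hstep n x|%N%:R) <= _).
    by rewrite ler_wpM2l ?(ltW h0)// zsum_bound.
  rewrite mulrCA ler_wpM2l//.
  have hT : hstep n <= T.
    by rewrite /hstep ler_pdivrMr// ler_peMr ?ler1n// ltW ?two_pi_gt0.
  have -> : `|gfl hstep n x|%N%:R = `|(gfl hstep n x)%:~R| :> R.
    by rewrite -intr_norm -abszE.
  rewrite -{1}(gtr0_norm h0) -normrM mulrC.
  have /andP[k1 k2] := gfl_itv hstep_gt0 n x.
  rewrite mulrDl mul1r in k2.
  have := ler_norm x; have := ler_norm (- x); rewrite normrN => n1 n2.
  by rewrite ler_norml; apply/andP; split; lra.
have Fex x : exists l : R, (fun n => f n (gfl hstep n x)) @ U --> l.
  by apply: (@ultra_cvg R U UF _ (C * (`|x| + T))) => n; exact: fb.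
have [F HF] := choice Fex.
have dF : forall x : R, is_derive x 1 F (G x).
  apply: (@grid_derive R U UF hstep hstep_gt0 hstep_cvg f g F G C) => //.
  by move=> n k; rewrite /f -mulrBr zsumS.
rewrite (cint_FTC dF cG).
have F0 : F 0 = 0.
  apply: (cvg_unique (@Rhausdorff R) (HF 0)).
  rewrite (_ : (fun n => _) = (fun=> 0)); first exact: cvg_cst.
  by apply/funext => n; rewrite /f gfl0 /= mulr0.
rewrite F0 subr0.
have -> : (fun n => n.+1%:R^-1 * \sum_(k < n.+1) g n k%:Z) =
    (fun n => T^-1 * f n (gfl hstep n T)).
  apply/funext => n; rewrite /f -{2}[T]add0r gflDT gfl0 add0r zsum_natE /hstep.
  by rewrite [RHS]mulrA mulKf// gt_eqF ?two_pi_gt0.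
by apply: cvgM; [exact: cvg_cst|exact: HF].
Qed.

End GridMeans.

Section MorePowers.
Context {R : realType}.

Lemma spowK (r s : R) : 0 < r -> spow r^-1 (spow r s) = s.
Proof.
move=> r0; have [s0|s0|->] := ltgtP s 0.
- have h : 0 < `|s| `^ r by rewrite powR_gt0 ?normr_gt0// lt_eqF.
  rewrite /spow (ltr0_sg s0) mulN1r normrN (gtr0_norm h) ltr0_sg ?oppr_lt0//.
  by rewrite -powRrM divff ?gt_eqF// powRr1// ltr0_norm// mulN1r opprK.
- have h : 0 < `|s| `^ r by rewrite powR_gt0 ?normr_gt0// gt_eqF.
  rewrite /spow (gtr0_sg s0) mul1r (gtr0_norm h) gtr0_sg//.
  by rewrite -powRrM divff ?gt_eqF// powRr1// gtr0_norm// mul1r.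
- by rewrite /spow sgr0 !mul0r sgr0 mul0r.
Qed.

Lemma apow_spow (r t s : R) : 0 < r -> apow t (spow r s) = apow (r * t) s.
Proof. by move=> r0; rewrite {1}/apow normr_spow// /apow -powRrM. Qed.

End MorePowers.

Section Equicont.
Context {R : realType} (h : nat -> R).
Implicit Types f g : nat -> int -> R.

Lemma equicont_lip f C : 0 < C ->
  (forall n k, `|f n (k + 1) - f n k| <= h n * C) -> equicont h f.
Proof.
move=> C0 fC e e0; exists (e / C); first by rewrite divr_gt0.
move=> n k m; rewrite ltr_pdivlMr// => hm.
apply: le_trans (ltW hm); elim: m {hm} => [|m IH].
  by rewrite addr0 subrr normr0 mulr0 mul0r.
have -> : k + m.+1%:Z = k + m%:Z + 1 by rewrite -addrA -PoszD addn1.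
have -> : f n (k + m%:Z + 1) - f n k =
  (f n (k + m%:Z + 1) - f n (k + m%:Z)) + (f n (k + m%:Z) - f n k) by ring.
rewrite (le_trans (ler_normD _ _))// -natr1 mulrDr mulr1 mulrDl addrC lerD//.
Qed.

Lemma equicont_comp f (phi : R -> R) K : continuous phi ->
  (forall n k, `|f n k| <= K) -> equicont h f -> equicont h (fun n k => phi (f n k)).
Proof.
move=> cphi fK ef e e0.
have [d d0 Hd] := cont_modulus K cphi e0.
have d2 : 0 < d / 2 by rewrite divr_gt0.
have [d' d'0 Hd'] := ef _ d2; exists d' => // n k m hm.
by apply: Hd => //; apply: le_lt_trans (Hd' n k m hm) _; lra.
Qed.

Lemma equicont_shift f : equicont h f -> equicont h (fun n k => f n (k + 1)).
Proof.
move=> ef e e0; have [d d0 Hd] := ef _ e0; exists d => // n k m hm.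
by rewrite addrAC; exact: Hd.
Qed.

Lemma equicont_lin f g (a b : nat -> R) K : 0 < K -> (forall n, `|a n| <= K) ->
  (forall n, `|b n| <= K) -> equicont h f -> equicont h g ->
  equicont h (fun n k => - (a n * f n k + b n * g n k)).
Proof.
move=> K0 aK bK ef eg e e0.
have t0 : 0 < e / (K + K) by rewrite divr_gt0 ?addr_gt0.
have [d1 d10 H1] := ef _ t0; have [d2 d20 H2] := eg _ t0.
exists (Num.min d1 d2); first by rewrite lt_min d10.
move=> n k m; rewrite lt_min => /andP[hm1 hm2].
have -> : - (a n * f n (k + m%:Z) + b n * g n (k + m%:Z)) - - (a n * f n k + b n * g n k) =
  - (a n * (f n (k + m%:Z) - f n k) + b n * (g n (k + m%:Z) - g n k)) by ring.
rewrite normrN (le_trans (ler_normD _ _))// !normrM.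
apply: le_trans (_ : K * (e / (K + K)) + K * (e / (K + K)) <= _).
  by rewrite lerD// ler_pM// ?H1 ?H2.
by rewrite -mulrDl mulrCA divff ?mulr1// gt_eqF ?addr_gt0.
Qed.

End Equicont.

Section GridCompactness.
Context {R : realType} (U : set_system nat) {UF : UltraFilter U} (ooU : \oo `<=` U).
Notation T := (2 * pi : R).
Context (p q K : R) (uN : nat -> int -> R) (alN gaN : nat -> R).
Context (hp : 2 < p) (hq : p - 1 < q) (K0 : 0 < K).

Definition gslope (uN : nat -> int -> R) n k : R := (uN n (k + 1) - uN n k) / @hstep R n.
Let wN n k := spow (p - 1) (gslope uN n k).

Context (uper : forall n k, uN n (k + n.+1%:Z) = uN n k).
Context (uge0 : forall n k, 0 <= uN n k) (uK : forall n k, uN n k <= K).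
Context (wK : forall n k, `|wN n k| <= K).
Context (alK : forall n, `|alN n| <= K) (gaK : forall n, `|gaN n| <= K).
Context (EL : forall n k, wN n (k + 1) - wN n k = hstep n *
  - (alN n * apow (p - 1) (uN n (k + 1)) + gaN n * apow (q - 1) (uN n (k + 1)))).

Let p1_gt0 : 0 < p - 1. Proof. by rewrite subr_gt0 (lt_trans _ hp)// ltr1n. Qed.
Let ip_gt0 : 0 < (p - 1)^-1. Proof. by rewrite invr_gt0. Qed.
Let q1_gt0 : 0 < q - 1. Proof. by move: hp hq; lra. Qed.
Let h_gt0 := @hstep_gt0 R.
Let h0 : @hstep R @ U --> (0 : R). Proof. exact: hstep_cvg. Qed.

Let uNK n k : `|uN n k| <= K. Proof. by rewrite ger0_norm. Qed.

Let slopeE n k : gslope uN n k = spow (p - 1)^-1 (wN n k).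
Proof. by rewrite /wN spowK. Qed.

Let C1 := K `^ (p - 1)^-1.
Let C1_gt0 : 0 < C1. Proof. exact: powR_gt0. Qed.

Let slopeK n k : `|gslope uN n k| <= C1.
Proof.
by rewrite slopeE normr_spow// /apow ge0_ler_powR ?nnegrE ?(ltW K0) ?(ltW ip_gt0).
Qed.

Let uS n k : uN n (k + 1) - uN n k = hstep n * gslope uN n k.
Proof. by rewrite /gslope mulrCA divff ?mulr1// gt_eqF. Qed.

Let eu : equicont hstep uN.
Proof.
apply: (equicont_lip C1_gt0) => n k.
by rewrite uS normrM gtr0_norm// ler_wpM2l ?(ltW (h_gt0 n)).
Qed.

Let rhs n k := - (alN n * apow (p - 1) (uN n (k + 1)) + gaN n * apow (q - 1) (uN n (k + 1))).
Let C2 := K * K `^ (p - 1) + K * K `^ (q - 1).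
Let C2_gt0 : 0 < C2. Proof. by rewrite addr_gt0// mulr_gt0 ?powR_gt0. Qed.

Let rhsK n k : `|rhs n k| <= C2.
Proof.
rewrite /rhs normrN (le_trans (ler_normD _ _))// !normrM.
by rewrite lerD// ler_pM// ger0_norm ?powR_ge0// ge0_ler_powR ?nnegrE ?(ltW K0) ?(ltW p1_gt0) ?(ltW q1_gt0).
Qed.

Let ew : equicont hstep wN.
Proof.
apply: (equicont_lip C2_gt0) => n k.
by rewrite EL normrM gtr0_norm// ler_wpM2l ?(ltW (h_gt0 n))//; exact: rhsK.
Qed.

(* Solutions of the discretized Euler-Lagrange equation converge, along an
   ultrafilter, to a solution of the equation itself: this replaces compactness
   in Sobolev spaces. *)
Theorem grid_compactness : exists (u w : R -> R) (al ga : R),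
  [/\ forall x, 0 <= u x, forall x, u (x + T) = u x, forall x, w (x + T) = w x,
      forall x : R, is_derive x 1 u (spow (p - 1)^-1 (w x)) &
      forall x : R, is_derive x 1 w (- (al * u x `^ (p - 1) + ga * u x `^ (q - 1)))] /\
  [/\ alN @ U --> al, gaN @ U --> ga,
      forall r, 0 < r ->
      (fun n => n.+1%:R^-1 * \sum_(k < n.+1) apow r (uN n k%:Z)) @ U --> cint (fun x => apow r (u x)) &
      (fun n => n.+1%:R^-1 * \sum_(k < n.+1) apow p (gslope uN n k%:Z)) @ U -->
        cint (fun x => apow (1 + (p - 1)^-1) (w x))].
Proof.
have Hexu (x : R) : exists l : R, (fun n => uN n (gfl hstep n x)) @ U --> l.
  by apply: (@ultra_cvg R U UF _ K) => n; exact: uNK.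
have [u Hu] := choice Hexu.
have Hexw (x : R) : exists l : R, (fun n => wN n (gfl hstep n x)) @ U --> l.
  by apply: (@ultra_cvg R U UF _ K) => n; exact: wK.
have [w Hw] := choice Hexw.
have [al Hal] := @ultra_cvg R U UF alN K alK.
have [ga Hga] := @ultra_cvg R U UF gaN K gaK.
exists u, w, al, ga.
have u0 x : 0 <= u x.
  by apply: (ler_cvg_to (@cvg_cst _ (0 : R) _ U _) (Hu x)); exact: nearW.
have du (x : R) : is_derive x 1 u (spow (p - 1)^-1 (w x)).
  apply: (@grid_derive R U UF hstep h_gt0 h0 uN (gslope uN) u (fun x => spow (p - 1)^-1 (w x)) C1) => //.
    rewrite (_ : gslope uN = (fun n k => spow (p - 1)^-1 (wN n k))).
      by apply: equicont_comp wK ew; exact: spow_continuous.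
    by apply/funext => n; apply/funext => k.
  move=> y; rewrite (_ : (fun n => _) = (fun n => spow (p - 1)^-1 (wN n (gfl hstep n y)))).
    by apply: (cvg_comp _ _ (Hw y)); exact: spow_continuous.
  by apply/funext => n.
(* Summation by parts puts the right-hand side of the discrete equation at k + 1; bounded slopes
   make this shift by one cell harmless. *)
have Hu1 x : (fun n => uN n (gfl hstep n x + 1)) @ U --> u x.
  rewrite -[u x]addr0.
  rewrite (_ : (fun n => _) = (fun n => uN n (gfl hstep n x) + hstep n * gslope uN n (gfl hstep n x))); last first.
    by apply/funext => n; rewrite -uS subrKC.
  apply: cvgD; first exact: Hu.
  apply/cvgrPdist_le => e e0.
  have e1 : 0 < e / C1 by rewrite divr_gt0.
  move/cvgrPdist_le : (h0) => /(_ _ e1); apply: filterS => n.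
  rewrite !sub0r !normrN ler_pdivlMr// => H; rewrite normrM.
  by apply: le_trans H; rewrite ler_wpM2l.
have dw (x : R) : is_derive x 1 w (- (al * u x `^ (p - 1) + ga * u x `^ (q - 1))).
  have -> : - (al * u x `^ (p - 1) + ga * u x `^ (q - 1)) = - (al * apow (p - 1) (u x) + ga * apow (q - 1) (u x)).
    by rewrite /apow ger0_norm.
  apply: (@grid_derive R U UF hstep h_gt0 h0 wN rhs w
    (fun x => - (al * apow (p - 1) (u x) + ga * apow (q - 1) (u x))) C2) => //.
    apply: (equicont_lin K0 alK gaK).
      by apply: (equicont_shift (f := fun n k => apow (p - 1) (uN n k))); apply: equicont_comp uNK eu; exact: apow_continuous.
    by apply: (equicont_shift (f := fun n k => apow (q - 1) (uN n k))); apply: equicont_comp uNK eu; exact: apow_continuous.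
  move=> y; apply: cvgN; apply: cvgD; apply: cvgM => //.
    by apply: (cvg_comp _ _ (Hu1 y)); exact: apow_continuous.
  by apply: (cvg_comp _ _ (Hu1 y)); exact: apow_continuous.
split; split => //.
- move=> x; apply: (cvg_unique (@Rhausdorff R) _ (Hu x)).
  rewrite (_ : (fun n => _) = (fun n => uN n (gfl hstep n (x + T)))); first exact: Hu.
  by apply/funext => n; rewrite gflDT uper.
- move=> x; apply: (cvg_unique (@Rhausdorff R) _ (Hw x)).
  rewrite (_ : (fun n => _) = (fun n => wN n (gfl hstep n (x + T)))); first exact: Hw.
  by apply/funext => n; rewrite gflDT /wN /gslope addrAC !uper.
- move=> r r0.
  apply: (@grid_mean R U UF ooU (fun n k => apow r (uN n k)) (fun x => apow r (u x)) (K `^ r)).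
  + by move=> n k; rewrite ger0_norm ?powR_ge0// ge0_ler_powR ?nnegrE ?(ltW K0)// ltW.
  + by apply: equicont_comp uNK eu; exact: apow_continuous.
  + by move=> x; apply: (cvg_comp _ _ (Hu x)); exact: apow_continuous.
  + by apply: apow_comp_continuous => //; exact: is_derive_continuous du.
- have p'0 : 0 < 1 + (p - 1)^-1 by rewrite addr_gt0.
  rewrite (_ : (fun n => _) = (fun n => n.+1%:R^-1 * \sum_(k < n.+1) apow (1 + (p - 1)^-1) (wN n k%:Z))); last first.
    apply/funext => n; congr (_ * _); apply: eq_bigr => k _.
    by rewrite slopeE apow_spow//; congr apow; field; rewrite gt_eqF.
  apply: (@grid_mean R U UF ooU (fun n k => apow (1 + (p - 1)^-1) (wN n k)) _ (K `^ (1 + (p - 1)^-1))).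
  + by move=> n k; rewrite ger0_norm ?powR_ge0// ge0_ler_powR ?nnegrE ?(ltW K0)// ltW.
  + by apply: equicont_comp wK ew; exact: apow_continuous.
  + by move=> x; apply: (cvg_comp _ _ (Hw x)); exact: apow_continuous.
  + by apply: apow_comp_continuous => //; exact: is_derive_continuous dw.
Qed.

End GridCompactness.

(** * Minimizers on a grid *)

Lemma continuous_big (X : topologicalType) (R : realType) (n : nat) (F : nat -> X -> R) :
  (forall k, continuous (F k)) -> continuous (fun x => \sum_(k < n) F k x).
Proof.
move=> cF; elim: n => [|n IH].
  rewrite (_ : (fun x => _) = (fun=> 0)); first exact: cst_continuous.
  by apply/funext => x; rewrite big_ord0.
rewrite (_ : (fun x => _) = (fun x => \sum_(k < n) F k x + F n x)).
  by move=> x; apply: continuousD; [exact: IH|exact: cF].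
by apply/funext => x; rewrite big_ord_recr.
Qed.

Lemma continuous_compR (X : topologicalType) (R : realType) (f : X -> R) (g : R -> R) :
  continuous f -> continuous g -> continuous (fun x => g (f x)).
Proof.
by move=> ctf cg x; apply: (@continuous_comp _ _ _ f g); [exact: ctf|exact: cg].
Qed.

(** The stationarity condition multiplied by - c / 2, in letters free of powers: X1, X2 are
    A^(2/p-1), A^(2/p), the Y are the same powers of P, and a1, p1, q1 are the pairings of the three
    terms of the equation with the variation. *)
Lemma el_identity (R : realType) (p q c m t ai X1 X2 Y1 Y2 a1 p1 q1 : R) :
  p != 0 -> q != 0 ->
  - c / 2 * (2 / p * X1 * - (p * a1) - 2 / q * X2 * (q * q1) -
    m * (t * (ai * (2 / p * Y1 * (p * p1) - 2 / q * Y2 * (q * q1))))) =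
  c * X1 * a1 + (m * t * ai * Y1 * c * p1 + c * (X2 - m * t * ai * Y2) * q1).
Proof. by move=> p0 q0; field; rewrite p0 q0. Qed.

Section Discrete.
Context {R : realType} (n : nat).
Implicit Types (u v d : int -> R).
Notation h := (@hstep R n).
Notation T := (2 * pi : R).

Definition gper u := forall k, u (k + n.+1%:Z) = u k.
Definition slope u k : R := (u (k + 1) - u k) / h.
Definition gmean (F : int -> R) : R := n.+1%:R^-1 * \sum_(k < n.+1) F k%:Z.
Definition genergy p u := gmean (fun k => apow p (slope u k)).
Definition gpow r u := gmean (fun k => apow r (u k)).

Lemma eq_gmean F G : F =1 G -> gmean F = gmean G.
Proof. by move=> /funext ->. Qed.

Lemma gmeanZ c F : gmean (fun k => c * F k) = c * gmean F.
Proof. by rewrite /gmean -big_distrr /= mulrCA. Qed.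

Lemma gmeanD F G : gmean (fun k => F k + G k) = gmean F + gmean G.
Proof. by rewrite /gmean big_split /= mulrDr. Qed.

Lemma gmeanB F G : gmean (fun k => F k - G k) = gmean F - gmean G.
Proof. by rewrite /gmean sumrB mulrBr. Qed.

Lemma gmean_cst (c : R) : gmean (fun=> c) = c.
Proof.
by rewrite /gmean sumr_const card_ord -[c *+ _]mulr_natl mulrA mulVf ?mul1r// pnatr_eq0.
Qed.

Lemma le_gmean F G : (forall k, F k <= G k) -> gmean F <= gmean G.
Proof.
by move=> FG; rewrite /gmean ler_wpM2l ?invr_ge0// ler_sum.
Qed.

Lemma gmean_ge0 F : (forall k, 0 <= F k) -> 0 <= gmean F.
Proof. by move=> F0; rewrite -[0](gmean_cst 0); exact: le_gmean. Qed.

Lemma gper_int (F : int -> R) (k j : int) : gper F -> F (k + j * n.+1%:Z) = F k.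
Proof.
move=> Fp; have fn (m : nat) y : F (y + m%:Z * n.+1%:Z) = F y.
  elim: m => [|m IH]; first by rewrite mul0r addr0.
  by rewrite -[m.+1]addn1 PoszD mulrDl mul1r addrA Fp IH.
case: j => m; first exact: fn.
by rewrite NegzE -(fn m.+1 (k + _)) -addrA mulNr addNr addr0.
Qed.

Lemma gper_reduce (F : int -> R) (k k0 : int) : gper F ->
  exists2 m : nat, (m < n.+1)%N & F k = F (k0 + m%:Z).
Proof.
move=> Fp.
have E := divz_eq (k - k0) n.+1%:Z.
have m0 : 0 <= ((k - k0) %% n.+1%:Z)%Z by rewrite modz_ge0.
have mn : ((k - k0) %% n.+1%:Z)%Z < n.+1%:Z by rewrite ltz_pmod.
exists `|((k - k0) %% n.+1%:Z)%Z|%N; first by lia.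
rewrite gez0_abs// -[RHS](gper_int _ ((k - k0) %/ n.+1%:Z)%Z Fp); congr F.
by lia.
Qed.

Lemma gmean_shift F : gper F -> gmean (fun k => F (k + 1)) = gmean F.
Proof.
move=> Fp; rewrite /gmean; congr (_ * _).
rewrite big_ord_recr [RHS]big_ord_recl /= addrC; congr (_ + _).
  by rewrite -PoszD addn1 -(Fp 0) add0r.
by apply: eq_bigr => i _; rewrite -PoszD addn1 /bump /=.
Qed.

Lemma gmean_by_parts (w d : int -> R) : gper w -> gper d ->
  gmean (fun k => w k * slope d k) = - gmean (fun k => (w (k + 1) - w k) / h * d (k + 1)).
Proof.
move=> wp dp.
have S := @gmean_shift (fun k => w k * d k) _.
apply/eqP; rewrite -subr_eq0 opprK -gmeanD; apply/eqP.
rewrite (eq_gmean (G := fun k => h^-1 * (w (k + 1) * d (k + 1)) - h^-1 * (w k * d k))).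
  by rewrite gmeanB !gmeanZ S ?subrr// => k; rewrite wp dp.
by move=> k; rewrite /slope; ring.
Qed.

Lemma slope_lin u d t k : slope (fun k => u k + t * d k) k = slope u k + t * slope d k.
Proof. by rewrite /slope; ring. Qed.

Lemma is_derive_gmean (F : int -> R -> R) (dF : int -> R) (t : R) :
  (forall k, is_derive t 1 (F k) (dF k)) ->
  is_derive t 1 (fun s => gmean (fun k => F k s)) (gmean dF).
Proof.
move=> HF; rewrite /gmean.
have H m : is_derive t 1 (fun s => \sum_(k < m) F k%:Z s) (\sum_(k < m) dF k%:Z).
  elim: m => [|m IH].
    rewrite big_ord0 (_ : (fun s => _) = (fun=> 0)); first exact: is_derive_cst.
    by apply/funext => s; rewrite big_ord0.
  rewrite big_ord_recr (_ : (fun s => _) = (fun s => \sum_(k < m) F k%:Z s + F m%:Z s)).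
    exact: is_deriveD.
  by apply/funext => s; rewrite big_ord_recr.
exact: (is_deriveZ _ (H n.+1)).
Qed.

Lemma is_derive_apow_line r (a b t : R) : 1 < r ->
  is_derive t 1 (fun s => apow r (a + s * b)) (r * spow (r - 1) (a + t * b) * b).
Proof.
move=> r1; have H := @is_derive_apow _ r (a + t * b) r1.
have H2 : is_derive t 1 (fun s => a + s * b) b.
  have := is_deriveD (is_derive_cst a t 1) (is_deriveM (is_derive_id t 1) (is_derive_cst b t 1)).
  by rewrite /GRing.scale /= mulr0 !add0r mulr1.
exact: (@is_derive1_comp R (apow r) (fun s => a + s * b) t _ _ H H2).
Qed.

Section Minimization.
Context (p q mu a : R) (f th : R -> R).
Context (hp : 2 < p) (hq : 1 < q) (cf : continuous f).
Let N1 : 0 < n.+1%:R :> R. Proof. by []. Qed.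

(** The functional i - mu f(e) in terms of the means A of |u'|^p, P of |u|^p and Q of |u|^q, made
    invariant under scaling of u by the powers of Q. Taking [apow] makes it continuous in A and P on
    the whole line. *)
Definition gval (A P Q : R) : R := apow (2 / p) A * Q `^ (- (2 / q))
   - mu * f (a^-1 * (apow (2 / p) P * Q `^ (- (2 / q)) - 1)).

Definition gfun u : R := gval (genergy p u) (gpow p u) (gpow q u).

Lemma gval_Q1 (A P : R) : gval A P 1 = apow (2 / p) A - mu * f (a^-1 * (apow (2 / p) P - 1)).
Proof. by rewrite /gval powR1 !mulr1. Qed.

Lemma le_gval (A A' P Q : R) : 0 <= A -> A <= A' -> gval A P Q <= gval A' P Q.
Proof.
move=> A0 AA'; rewrite /gval lerD2r ler_wpM2r ?powR_ge0// /apow.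
rewrite ge0_ler_powR ?nnegrE ?normr_ge0 ?divr_ge0 ?(ltW (lt_trans _ hp))//.
by rewrite !ger0_norm// (le_trans A0).
Qed.

Lemma gval_scale (c A P Q : R) : 0 < c -> 0 <= A -> 0 <= P -> 0 < Q ->
  gval (c `^ p * A) (c `^ p * P) (c `^ q * Q) = gval A P Q.
Proof.
move=> c0 A0 P0 Q0; rewrite /gval.
have p0 : 0 < p by exact: lt_trans hp.
have q0 : 0 < q by exact: lt_trans hq.
have E x : 0 <= x -> apow (2 / p) (c `^ p * x) * (c `^ q * Q) `^ (- (2 / q)) =
    apow (2 / p) x * Q `^ (- (2 / q)).
  move=> x0; rewrite /apow normrM !powRM ?normr_ge0 ?powR_ge0 ?(ltW Q0)//.
  rewrite (ger0_norm (powR_ge0 _ _)) -!powRrM mulrACA -powRDp//.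
  by rewrite (_ : _ + _ = 0) ?powRr0 ?mul1r//; field; rewrite !gt_eqF.
by rewrite (E A)// (E P).
Qed.

(** Periodic grid functions are identified with row vectors, where compactness of closed bounded
    sets is available. *)
Definition ext (x : 'rV[R]_n.+1) (k : int) : R := x 0 (inord `|(k %% n.+1%:Z)%Z|%N).

Lemma ext_per x : gper (ext x).
Proof. by move=> k; rewrite /ext modzDr. Qed.

Lemma extK u : gper u -> ext (\row_j u j%:Z) = u.
Proof.
move=> up; apply/funext => k; rewrite /ext mxE.
have m0 : 0 <= (k %% n.+1%:Z)%Z by rewrite modz_ge0.
have mn : (k %% n.+1%:Z)%Z < n.+1%:Z by rewrite ltz_pmod.
rewrite inordK; last by lia.
rewrite gez0_abs// [in RHS](divz_eq k n.+1%:Z) addrC.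
by rewrite gper_int.
Qed.

Lemma ext_continuous k : continuous (fun x : 'rV[R]_n.+1 => ext x k).
Proof. exact: coord_continuous. Qed.

Lemma gmean_ext_continuous (F : int -> 'rV[R]_n.+1 -> R) :
  (forall k, continuous (F k)) -> continuous (fun x => gmean (fun k => F k x)).
Proof.
move=> cF x; have FF : Filter (nbhs x) by exact: nbhs_filter.
apply: cvgM; first exact: cvg_cst.
exact: (@continuous_big _ R n.+1 (fun k x => F k%:Z x) (fun k => cF k%:Z)).
Qed.

Lemma gpow_continuous r : 0 < r -> continuous (fun x => gpow r (ext x)).
Proof.
move=> r0; apply: gmean_ext_continuous => k.
exact: (continuous_compR (@ext_continuous k) (apow_continuous r0)).
Qed.

Lemma genergy_continuous r : 0 < r -> continuous (fun x => genergy r (ext x)).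
Proof.
move=> r0; apply: gmean_ext_continuous => k.
have H : continuous (fun x => slope (ext x) k).
  move=> x; have FF : Filter (nbhs x) by exact: nbhs_filter.
  by apply: cvgM; [apply: cvgB; exact: ext_continuous|exact: cvg_cst].
exact: (continuous_compR H (apow_continuous r0)).
Qed.

Lemma gpow_scale r c u : 0 <= c -> gpow r (fun k => c * u k) = c `^ r * gpow r u.
Proof.
move=> c0; rewrite /gpow -gmeanZ; apply: eq_gmean => k.
by rewrite /apow normrM powRM// ger0_norm.
Qed.

Lemma genergy_scale r c u : 0 <= c -> genergy r (fun k => c * u k) = c `^ r * genergy r u.
Proof.
move=> c0; rewrite /genergy -gmeanZ; apply: eq_gmean => k.
rewrite (_ : slope _ _ = c * slope u k); last by rewrite /slope; ring.
by rewrite /apow normrM powRM// ger0_norm.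
Qed.

Lemma gpow_ge0 r u : 0 <= gpow r u.
Proof. by apply: gmean_ge0 => k; exact: powR_ge0. Qed.

Lemma genergy_ge0 r u : 0 <= genergy r u.
Proof. by apply: gmean_ge0 => k; exact: powR_ge0. Qed.

Lemma gfun_scale c u : 0 < c -> 0 < gpow q u -> gfun (fun k => c * u k) = gfun u.
Proof.
move=> c0 Q0; rewrite /gfun !gpow_scale ?genergy_scale ?(ltW c0)//.
by apply: gval_scale; rewrite ?genergy_ge0 ?gpow_ge0.
Qed.

Lemma gpow_coord_le r u k : 0 < r -> gper u -> gpow r u <= 1 -> `|u k| <= n.+1%:R `^ r^-1.
Proof.
move=> r0 up Q1.
have [m mn ->] := gper_reduce k 0 up; rewrite add0r.
have H : apow r (u m%:Z) <= n.+1%:R.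
  have : n.+1%:R * gpow r u <= n.+1%:R by rewrite ler_piMr.
  rewrite /gpow /gmean mulrA divff ?gt_eqF// mul1r; apply: le_trans.
  rewrite (bigD1 (Ordinal mn)) //= lerDl; apply: sumr_ge0 => i _; exact: powR_ge0.
have -> : `|u m%:Z| = (`|u m%:Z| `^ r) `^ r^-1.
  by rewrite -powRrM divff ?gt_eqF// powRr1.
by rewrite ge0_ler_powR ?nnegrE ?powR_ge0 ?invr_ge0 ?(ltW r0).
Qed.

Lemma gfun_min : exists u, [/\ gper u, gpow q u = 1 &
  forall y, gper y -> 0 < gpow q y -> gfun u <= gfun y].
Proof.
have p0 : 0 < p by exact: lt_trans hp.
have q0 : 0 < q by exact: lt_trans hq.
pose S := [set x : 'rV[R]_n.+1 | gpow q (ext x) = 1].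
(* On the sphere Q = 1 the functional has no quotient left and agrees with this continuous function;
   scale invariance extends the minimum to all functions with positive q-mean. *)
pose g x := apow (2 / p) (genergy p (ext x))
   - mu * f (a^-1 * (apow (2 / p) (gpow p (ext x)) - 1)).
have gE x : S x -> gfun (ext x) = g x.
  by rewrite /S /= => Sx; rewrite /gfun Sx gval_Q1.
have cQ := gpow_continuous q0.
have clS : closed S.
  rewrite (_ : S = (fun x => gpow q (ext x)) @^-1` [set 1]); last by [].
  by apply: closed_comp => [x _|]; [exact: cQ|exact: closed_eq].
pose B := n.+1%:R `^ q^-1 : R.
have cS : compact S.
  have boxc := @rV_compact R n.+1 (fun=> `[- B, B]%classic) (fun _ => @segment_compact _ _ _).
  apply: subclosed_compact clS boxc _ => x Sx i.
  rewrite /= in_itv/= -ler_norml.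
  have := @gpow_coord_le q (ext x) (i : nat)%:Z q0 (ext_per x).
  rewrite Sx lexx => /(_ isT); rewrite {1}/ext modz_small; last by have := ltn_ord i; lia.
  by rewrite absz_nat inord_val.
have cg : continuous g.
  have i0 : 0 < 2 / p by rewrite divr_gt0.
  move=> x; have FF : Filter (nbhs x) by exact: nbhs_filter.
  apply: cvgB.
    exact: (continuous_compR (genergy_continuous p0) (apow_continuous i0)).
  apply: cvgM; first exact: cvg_cst.
  have H : continuous (fun x => a^-1 * (apow (2 / p) (gpow p (ext x)) - 1)).
    move=> y; have FFy : Filter (nbhs y) by exact: nbhs_filter.
    apply: cvgM; first exact: cvg_cst.
    apply: cvgB; last exact: cvg_cst.
    exact: (continuous_compR (gpow_continuous p0) (apow_continuous i0)).
  exact: (continuous_compR H cf).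
have norm1 y : gper y -> 0 < gpow q y -> exists2 c, 0 < c & gpow q (fun k => c * y k) = 1.
  move=> yp Q0; exists (gpow q y `^ (- q^-1)); first by rewrite powR_gt0.
  rewrite gpow_scale ?powR_ge0// -powRrM mulNr mulVf ?gt_eqF// powRN powRr1 ?(ltW Q0)//.
  by rewrite mulVf ?gt_eqF.
have perZ c y : gper y -> gper (fun k => c * y k) by move=> yp k; rewrite yp.
have S0 : S !=set0.
  have [||c c0 Hc] := norm1 (fun=> 1); first by [].
    by rewrite /gpow /apow normr1 powR1 gmean_cst.
  exists (\row_j c); rewrite /S /=.
  have -> : ext (\row_j c) = (fun k => c * 1) by apply/funext => k; rewrite /ext mxE mulr1.
  exact: Hc.
have [x xS xmin] := compact_EVT_min S0 cS (continuous_subspaceT cg).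
rewrite inE in xS.
exists (ext x); split; [exact: ext_per|exact: xS|].
move=> y yp Q0; have [c c0 Hc] := norm1 y yp Q0.
rewrite -(gfun_scale c0 Q0) (gE _ xS).
have e := extK (perZ c y yp).
have Sy : S (\row_j (c * y j%:Z)) by rewrite /S /= e.
rewrite -e (gE _ Sy); apply: xmin; exact/mem_set.
Qed.

Lemma genergy_norm u : 0 < p -> genergy p (fun k => `|u k|) <= genergy p u.
Proof.
move=> p0; apply: le_gmean => k; rewrite /apow /slope ge0_ler_powR ?nnegrE ?normr_ge0 ?(ltW p0)//.
by rewrite !normrM ler_wpM2r// ler_dist_dist.
Qed.

Lemma gpow_norm r u : gpow r (fun k => `|u k|) = gpow r u.
Proof. by apply: eq_gmean => k; rewrite /apow normr_id. Qed.

Lemma gfun_min_ge0 : exists u, [/\ gper u, gpow q u = 1, forall k, 0 <= u k &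
  forall y, gper y -> 0 < gpow q y -> gfun u <= gfun y].
Proof.
have [u [up Q1 um]] := gfun_min.
have p0 : 0 < p by exact: lt_trans hp.
exists (fun k => `|u k|); split.
- by move=> k; rewrite up.
- by rewrite gpow_norm.
- by [].
- move=> y yp Qy; apply: le_trans (um y yp Qy).
  rewrite /gfun (gpow_norm p u) (gpow_norm q u); apply: le_gval.
    exact: genergy_ge0.
  exact: genergy_norm.
Qed.

(** The first variation along u + t d. The factor A^(1-2/p) in the multipliers normalizes the
    coefficient A^(2/p-1) that the chain rule puts on the flux term. *)
Lemma weak_euler_lagrange u d (w := fun k => spow (p - 1) (slope u k)) (A := genergy p u)
   (P := gpow p u) (e := a^-1 * (P `^ (2 / p) - 1))
   (al := mu * th e / a * P `^ (2 / p - 1) * A `^ (1 - 2 / p))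
   (ga := A `^ (1 - 2 / p) * (A `^ (2 / p) - mu * th e / a * P `^ (2 / p)))
   (res := fun j => (w (j + 1) - w j) / h + (al * apow (p - 1) (u (j + 1)) + ga * apow (q - 1) (u (j + 1)))) :
  gper u -> gpow q u = 1 -> (forall k, 0 <= u k) -> 0 < A -> 0 < P ->
  is_derive e 1 f (th e) ->
  (forall y, gper y -> 0 < gpow q y -> gfun u <= gfun y) ->
  gper d -> gmean (fun j => res j * d (j + 1)) = 0.
Proof.
move=> up Q1 u0 A0 P0 df umin dp.
have p0 : 0 < p by exact: lt_trans hp.
have q0 : 0 < q by exact: lt_trans hq.
have p1 : 1 < p by rewrite (lt_trans _ hp)// ltr1n.
pose y t := fun j => u j + t * d j.
have yp t : gper (y t) by move=> j; rewrite /y up dp.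
have y0 : y 0 = u by apply/funext => j; rewrite /y mul0r addr0.
pose A' := gmean (fun j => p * spow (p - 1) (slope u j) * slope d j).
have dA : is_derive (0 : R) 1 (fun t => genergy p (y t)) A'.
  apply: is_derive_gmean => j.
  rewrite (_ : (fun s => apow p (slope (y s) j)) = (fun s => apow p (slope u j + s * slope d j))).
    by have := is_derive_apow_line (slope u j) (slope d j) 0 p1; rewrite mul0r addr0.
  by apply/funext => s; rewrite /y slope_lin.
have dPow r : 1 < r -> is_derive (0 : R) 1 (fun t => gpow r (y t)) (gmean (fun j => r * spow (r - 1) (u j) * d j)).
  move=> r1; apply: is_derive_gmean => j.
  by have := is_derive_apow_line (u j) (d j) 0 r1; rewrite mul0r addr0.
have dP := dPow p p1; have dQ := dPow q hq.
set P' := gmean _ in dP; set Q' := gmean _ in dQ.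
have dQs : is_derive (0 : R) 1 (fun t => gpow q (y t) `^ (- (2 / q))) (- (2 / q) * Q').
  have H : is_derive (gpow q (y 0)) 1 (@powR R ^~ (- (2 / q))) (- (2 / q)).
    rewrite y0 Q1; have := @is_derive1_powR R (- (2 / q)) 1 ltr01.
    by rewrite powR1 mulr1.
  exact: (@is_derive1_comp R (@powR R ^~ (- (2 / q))) (fun t => gpow q (y t)) 0 _ _ H dQ).
have comb (F : R -> R) F' : 0 < F 0 -> is_derive (0 : R) 1 F F' ->
    is_derive (0 : R) 1 (fun t => apow (2 / p) (F t) * gpow q (y t) `^ (- (2 / q)))
      (2 / p * F 0 `^ (2 / p - 1) * F' - 2 / q * F 0 `^ (2 / p) * Q').
  move=> F0 dF.
  have H := @is_derive_apow_gt0 R (2 / p) (F 0) F0.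
  have H2 := @is_derive1_comp R (apow (2 / p)) F 0 _ _ H dF.
  have := is_deriveM H2 dQs; rewrite /GRing.scale /= y0 Q1 powR1 => H3.
  have -> : 2 / p * F 0 `^ (2 / p - 1) * F' - 2 / q * F 0 `^ (2 / p) * Q' =
     apow (2 / p) (F 0) * (- (2 / q) * Q') + 1 * (2 / p * F 0 `^ (2 / p - 1) * F').
    by rewrite /apow (gtr0_norm F0); ring.
  exact: H3.
have A0' : 0 < genergy p (y 0) by rewrite y0.
have P0' : 0 < gpow p (y 0) by rewrite y0.
have d1 := comb _ _ A0' dA; have d2 := comb _ _ P0' dP.
rewrite y0 -/A -/P in d1 d2.
set D1 := (X in is_derive _ _ _ X) in d1; set D2 := (X in is_derive _ _ _ X) in d2.
have dg : is_derive (0 : R) 1 (fun t => gfun (y t)) (D1 - mu * (th e * (a^-1 * D2))).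
  have d3 : is_derive (0 : R) 1 (fun t => a^-1 * (apow (2 / p) (gpow p (y t)) * gpow q (y t) `^ (- (2 / q)) - 1)) (a^-1 * D2).
    have := is_deriveZ a^-1 (is_deriveB d2 (is_derive_cst (1 : R) (0 : R) 1)).
    by rewrite subr0.
  have dfe : is_derive (a^-1 * (apow (2 / p) (gpow p (y 0)) * gpow q (y 0) `^ (- (2 / q)) - 1)) 1 f (th e).
    by rewrite y0 Q1 powR1 mulr1 /apow (gtr0_norm P0).
  have d4 := @is_derive1_comp R f _ 0 _ _ dfe d3.
  exact: (is_deriveB d1 (is_deriveZ mu d4)).
(* The variation keeps a positive q-mean for small t only, by continuity. *)
have near0 : \forall t \near (0 : R), gfun (y 0) <= gfun (y t).
  have cQ : {for 0, continuous (fun t => gpow q (y t))}.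
    apply: differentiable_continuous; apply/derivable1_diffP.
    exact: (@ex_derive _ _ _ _ _ _ _ dQ).
  have lt : 0 < gpow q (y 0) by rewrite y0 Q1.
  by apply: filterS (cvgr_gt _ cQ _ lt) => t Qt; rewrite y0; apply: umin.
have := is_derive_loc_min near0 dg.
move=> stat.
have wp : gper w by move=> j; rewrite /w /slope addrAC !up.
pose a1 := gmean (fun j => (w (j + 1) - w j) / h * d (j + 1)).
pose p1' := gmean (fun j => apow (p - 1) (u (j + 1)) * d (j + 1)).
pose q1' := gmean (fun j => apow (q - 1) (u (j + 1)) * d (j + 1)).
have A'E : A' = - (p * a1).
  rewrite /A' (eq_gmean (G := fun j => p * (w j * slope d j))); last by move=> j; rewrite -mulrA.
  by rewrite gmeanZ (gmean_by_parts wp dp) mulrN.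
have powE r : 1 < r -> gmean (fun j => r * spow (r - 1) (u j) * d j) =
    r * gmean (fun j => apow (r - 1) (u (j + 1)) * d (j + 1)).
  move=> r1; rewrite -gmeanZ.
  rewrite -(gmean_shift (F := fun j => r * spow (r - 1) (u j) * d j)); last by move=> j; rewrite up dp.
  by apply: eq_gmean => j; rewrite spow_ge0E ?subr_gt0// /apow ger0_norm// mulrA.
have P'E : P' = p * p1' by exact: powE.
have Q'E : Q' = q * q1' by exact: powE.
set c := A `^ (1 - 2 / p).
have cA : c * A `^ (2 / p - 1) = 1.
  by rewrite /c -powRDp// (_ : _ + _ = 0) ?powRr0//; ring.
have : a1 + (al * p1' + ga * q1') = 0.
  have := congr1 (fun z => - c / 2 * z) stat.
  rewrite mulr0 /D1 /D2 A'E P'E Q'E /al /ga -/c => E.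
  rewrite -E.
  rewrite (@el_identity R p q) ?gt_eqF//.
  by rewrite cA mul1r.
rewrite -2!gmeanZ -2!gmeanD => H; rewrite -H; apply: eq_gmean => j.
rewrite /res; ring.
Qed.

Lemma euler_lagrange u (w := fun k => spow (p - 1) (slope u k)) (A := genergy p u)
   (P := gpow p u) (e := a^-1 * (P `^ (2 / p) - 1)) :
  gper u -> gpow q u = 1 -> (forall k, 0 <= u k) -> 0 < A -> 0 < P ->
  is_derive e 1 f (th e) ->
  (forall y, gper y -> 0 < gpow q y -> gfun u <= gfun y) ->
  forall k, w (k + 1) - w k = h *
   - (mu * th e / a * P `^ (2 / p - 1) * A `^ (1 - 2 / p) * apow (p - 1) (u (k + 1)) +
     A `^ (1 - 2 / p) * (A `^ (2 / p) - mu * th e / a * P `^ (2 / p)) * apow (q - 1) (u (k + 1))).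
Proof.
move=> up Q1 u0 A0 P0 df umin.
pose al := mu * th e / a * P `^ (2 / p - 1) * A `^ (1 - 2 / p).
pose ga := A `^ (1 - 2 / p) * (A `^ (2 / p) - mu * th e / a * P `^ (2 / p)).
pose res j := (w (j + 1) - w j) / h + (al * apow (p - 1) (u (j + 1)) + ga * apow (q - 1) (u (j + 1))).
have wp : gper w by move=> j; rewrite /w /slope addrAC !up.
have resp : gper res by move=> j; rewrite /res addrAC !wp !up.
(* Testing with the residual itself, shifted back by one, makes its mean square vanish. *)
have H := weak_euler_lagrange up Q1 u0 A0 P0 df umin (d := fun j => res (j - 1)).
have {}H : gmean (fun j => res j * res j) = 0.
  rewrite -[RHS]H => [|j]; last by rewrite addrAC resp.
  by apply: eq_gmean => j; rewrite addrK.
have res0 (k : int) : res k = 0.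
  have [m mn ->] := gper_reduce k 0 resp; rewrite add0r.
  move/eqP: H; rewrite /gmean mulf_eq0 invr_eq0 pnatr_eq0 /= psumr_eq0; last first.
    by move=> i _; rewrite -expr2 sqr_ge0.
  by move=> /allP /(_ (Ordinal mn)); rewrite mem_index_enum => /(_ isT) /=; rewrite mulf_eq0 orbb => /eqP.
move=> k.
have E : (w (k + 1) - w k) / h =
    - (al * apow (p - 1) (u (k + 1)) + ga * apow (q - 1) (u (k + 1))).
  by apply/eqP; rewrite -addr_eq0; apply/eqP; exact: (res0 k).
have hK x : x = h * (x / h) by rewrite mulrCA divff ?mulr1// gt_eqF ?hstep_gt0.
by rewrite [LHS]hK E.
Qed.

End Minimization.
End Discrete.

(** * Bounds on grid minimizers, uniform in the mesh *)

Section DiscreteBounds.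
Context {R : realType} (n : nat).
Implicit Types (u w : int -> R).
Notation T := (2 * pi : R).
Notation h := (@hstep R n).

Lemma gmean_le_pt (F : int -> R) : exists k : nat, F k%:Z <= gmean n F.
Proof.
apply: contrapT => H.
have lt k : gmean n F < F k%:Z.
  by rewrite ltNge; apply/negP => le; apply: H; exists k.
have : gmean n (fun k => F k - gmean n F) = 0.
  by rewrite gmeanB gmean_cst subrr.
move/eqP; rewrite {1}/gmean mulf_eq0 invr_eq0 pnatr_eq0 /= psumr_eq0; last first.
  by move=> i _; rewrite subr_ge0 ltW.
move=> /allP /(_ ord0); rewrite mem_index_enum => /(_ isT) /=.
by rewrite subr_eq0 gt_eqF.
Qed.

Lemma gmean_shiftn (F : int -> R) (m : nat) : gper n F ->
  gmean n (fun k => F (k + m%:Z)) = gmean n F.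
Proof.
move=> Fp; elim: m => [|m IH]; first by apply: eq_gmean => k; rewrite addr0.
rewrite -IH -(@gmean_shift _ _ (fun k => F (k + m%:Z))).
  by apply: eq_gmean => k; rewrite -addrA -PoszD add1n.
by move=> k; rewrite addrAC Fp.
Qed.

Lemma le_sum_ord (F : nat -> R) (i N : nat) : (forall j, 0 <= F j) -> (i <= N)%N ->
  \sum_(j < i) F j <= \sum_(j < N) F j.
Proof.
move=> F0 iN; rewrite -(subnKC iN) big_split_ord /= lerDl.
by apply: sumr_ge0.
Qed.

(** By periodicity, k is reached from m in at most n forward steps, so one turn of the circle bounds
    the total variation used. *)
Lemma gper_osc u (m : nat) (k : int) : gper n u ->
  u k <= u m%:Z + T * gmean n (fun j => `|slope n u j|).
Proof.
move=> up; have h0 := @hstep_gt0 R n.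
have [i iN ->] := gper_reduce k m%:Z up.
have step j : u (j + 1) <= u j + h * `|slope n u j|.
  rewrite -(gtr0_norm h0) -normrM /slope mulrCA divff ?mulr1 ?gt_eqF ?normr_gt0//.
  by rewrite -lerBlDl; exact: ler_norm.
have tele : u (m%:Z + i%:Z) <= u m%:Z + \sum_(j < i) h * `|slope n u (j%:Z + m%:Z)|.
  elim: i {iN} => [|i IH]; first by rewrite big_ord0 !addr0.
  rewrite big_ord_recr /= -addn1 PoszD !addrA.
  apply: le_trans (step _) _; rewrite [i%:Z + _]addrC lerD2r; exact: IH.
apply: le_trans tele _; rewrite lerD2l.
have sp : gper n (fun j => `|slope n u j|).
  by move=> j; rewrite /slope addrAC !up.
rewrite -(@gmean_shiftn _ m sp) /gmean mulrA -/h -big_distrr /= ler_wpM2l ?(ltW h0)//.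
exact: (@le_sum_ord (fun j => `|slope n u (j%:Z + m%:Z)|) _ _ (fun _ => normr_ge0 _) (ltnW iN)).
Qed.

(** An elementary substitute for Hoelder at the price of a factor 2: |s| <= t + t^(1-p) |s|^p, by
    comparing |s| with t. *)
Lemma gmean_slope_le (p t : R) u : 1 < p -> 0 < t -> genergy n p u <= t `^ p ->
  gmean n (fun j => `|slope n u j|) <= 2 * t.
Proof.
move=> p1 t0 At.
have pt (s : R) : `|s| <= t + t `^ (1 - p) * apow p s.
  have [st|ts] := leP `|s| t; first by rewrite (le_trans st)// lerDl mulr_ge0 ?powR_ge0.
  have s0 := lt_trans t0 ts.
  apply: le_trans (_ : t `^ (1 - p) * apow p s <= _); last by rewrite lerDr ltW.
  have {1}-> : `|s| = `|s| `^ (1 - p) * `|s| `^ p by rewrite -powRDp// subrK powRr1.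
  by rewrite /apow ler_wpM2r ?powR_ge0//; apply: le_powR_neg => //; [exact: ltW|lra].
apply: le_trans (le_gmean n (fun k => pt (slope n u k))) _.
rewrite gmeanD gmean_cst gmeanZ mulr2n mulrDl mul1r lerD2l.
apply: le_trans (_ : t `^ (1 - p) * t `^ p <= _); first by rewrite ler_wpM2l ?powR_ge0.
by rewrite -powRDp// subrK powRr1 ?(ltW t0).
Qed.

Lemma grid_sup_le (p q t : R) u : 1 < p -> 0 < q -> 0 < t -> genergy n p u <= t `^ p ->
  gper n u -> gpow n q u = 1 -> (forall k, 0 <= u k) -> forall k, u k <= 1 + 2 * T * t.
Proof.
move=> p1 q0 t0 At up Q1 u0 k.
(* As the q-mean is 1, the function is at most 1 somewhere; the oscillation bound does the rest. *)
have [m mle] := gmean_le_pt (fun k => apow q (u k)).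
have um : u m%:Z <= 1.
  rewrite leNgt; apply/negP => u1; move: mle; rewrite -/(gpow n q u) Q1 leNgt => /negP; apply.
  have E1 : (1 : R) `^ q = 1 by rewrite powR1.
  rewrite /apow ger0_norm// -E1.
  by apply: gt0_ltr_powR; rewrite ?nnegrE.
apply: le_trans (gper_osc m k up) _; rewrite lerD//.
rewrite (_ : 2 * T * t = T * (2 * t)); last by ring.
by rewrite ler_wpM2l ?(ltW (two_pi_gt0 R))//; exact: gmean_slope_le p1 t0 At.
Qed.

Lemma gpow_le (p q B : R) u : q <= p -> 0 < q -> (forall k, 0 <= u k <= B) ->
  gpow n p u <= B `^ (p - q) * gpow n q u.
Proof.
move=> qp q0 uB; rewrite -gmeanZ; apply: le_gmean => k.
have /andP[u0 ub] := uB k; rewrite /apow ger0_norm//.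
move: u0; rewrite le_eqVlt => /predU1P[<-|u0].
  by rewrite !powR0 ?mulr0// gt_eqF// (lt_le_trans q0).
rewrite -[in leLHS](subrK q p) (@powRDp _ (u k) (p - q) q u0) ler_wpM2r ?powR_ge0//.
by rewrite ge0_ler_powR ?nnegrE ?subr_ge0 ?(ltW u0)// (le_trans (ltW u0)).
Qed.


Lemma genergy_ge0' (p : R) u : 0 <= genergy n p u.
Proof. by apply: gmean_ge0 => k; exact: powR_ge0. Qed.

(** Some slope is at most t because the energy is at most t^p; from there the flux changes by at
    most C times the length of the circle. *)
Lemma spow_slope_le (p t C : R) u (w := fun k => spow (p - 1) (slope n u k)) :
  1 < p -> 0 < t -> genergy n p u <= t `^ p -> gper n u ->
  (forall k, `|w (k + 1) - w k| <= h * C) -> forall k, `|w k| <= t `^ (p - 1) + T * C.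
Proof.
move=> p1 t0 At up wC k; have h0 := @hstep_gt0 R n.
have p0 : 0 < p by exact: lt_trans p1.
have [m mle] := gmean_le_pt (fun k => apow p (slope n u k)).
have wp : gper n w by move=> j; rewrite /w /slope addrAC !up.
have sm : `|slope n u m%:Z| <= t.
  rewrite leNgt; apply/negP => ts; have := le_trans mle At; rewrite leNgt => /negP; apply.
  by rewrite /apow; apply: gt0_ltr_powR; rewrite ?nnegrE ?(ltW t0).
have wm : `|w m%:Z| <= t `^ (p - 1).
  by rewrite /w normr_spow ?subr_gt0// /apow ge0_ler_powR ?nnegrE ?subr_ge0 ?(ltW p1) ?(ltW t0).
have C0 : 0 <= C by have := le_trans (normr_ge0 _) (wC 0); rewrite pmulr_rge0.
have [i iN ->] := gper_reduce k m%:Z wp.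
have tele : `|w (m%:Z + i%:Z)| <= `|w m%:Z| + i%:R * (h * C).
  elim: i {iN} => [|i IH]; first by rewrite addr0 mul0r addr0.
  have -> : m%:Z + i.+1%:Z = m%:Z + i%:Z + 1 by rewrite -addn1 PoszD addrA.
  rewrite -[w (_ + 1)](subrKC (w (m%:Z + i%:Z))) -natr1 mulrDl mul1r [leRHS]addrA.
  apply: le_trans (ler_normD _ _) _; apply: lerD; [exact: IH|exact: wC].
apply: le_trans tele _; apply: lerD => //.
have -> : T = n.+1%:R * h by rewrite /hstep mulrCA divff ?mulr1// pnatr_eq0.
rewrite -mulrA; apply: ler_wpM2r; first by rewrite mulr_ge0// ltW.
by rewrite ler_nat ltnW.
Qed.

End DiscreteBounds.

Section MinimizerBounds.
Context {R : realType}.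
Notation T := (2 * pi : R).

(** With x = mu th(e) / a, the two quantities are the multipliers of the Euler-Lagrange equation.
    The exponent 2 / p - 1 is negative, hence the lower bound on P. *)
Lemma coefficient_bounds (p x D A P Y c0 K1 : R) : 2 < p -> `|x| <= D ->
  0 < A -> A `^ p^-1 <= Y -> 0 < c0 -> c0 <= P -> P <= K1 `^ p -> 0 < K1 ->
  `|x * P `^ (2 / p - 1) * A `^ (1 - 2 / p)| <= D * c0 `^ (2 / p - 1) * Y `^ (p - 2) /\
  `|A `^ (1 - 2 / p) * (A `^ (2 / p) - x * P `^ (2 / p))| <= Y `^ (p - 2) * (Y `^ 2 + D * K1 `^ 2).
Proof.
move=> hp xD A0 tY c00 cP PK K10.
have p0 : 0 < p by lra.
have pn0 : p != 0 by rewrite gt_eqF.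
have p2 : 0 <= p - 2 by lra.
set t := A `^ p^-1 in tY; have t0 : 0 < t by rewrite powR_gt0.
have Y0 : 0 < Y by exact: lt_le_trans tY.
have i1 : 2 / p - 1 <= 0 by rewrite subr_le0 ler_pdivrMr// mul1r ltW.
have i2 : 0 <= 2 / p by rewrite divr_ge0// ltW.
have D0 : 0 <= D by exact: le_trans xD.
have Am : A `^ (1 - 2 / p) <= Y `^ (p - 2).
  have -> : A `^ (1 - 2 / p) = t `^ (p - 2).
    by rewrite /t -powRrM; congr powR; field.
  by rewrite ge0_ler_powR ?nnegrE ?(ltW t0) ?(ltW Y0).
have A2 : A `^ (2 / p) <= Y `^ 2.
  have -> : A `^ (2 / p) = t `^ 2 by rewrite /t -powRrM mulrC.
  by rewrite ge0_ler_powR ?nnegrE ?(ltW t0) ?(ltW Y0).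
have P0 : 0 < P by exact: lt_le_trans cP.
have P2 : P `^ (2 / p) <= K1 `^ 2.
  have -> : K1 `^ 2 = (K1 `^ p) `^ (2 / p).
    by rewrite -powRrM; congr powR; field.
  by rewrite ge0_ler_powR ?nnegrE ?powR_ge0 ?(ltW P0).
have P1 : P `^ (2 / p - 1) <= c0 `^ (2 / p - 1) by exact: le_powR_neg.
split.
  rewrite normrM normrM (ger0_norm (powR_ge0 A _)) (ger0_norm (powR_ge0 P _)).
  apply: ler_pM Am; rewrite ?mulr_ge0 ?powR_ge0//.
  by apply: ler_pM; rewrite ?powR_ge0.
rewrite normrM (ger0_norm (powR_ge0 A _)).
apply: ler_pM Am _; rewrite ?powR_ge0//.
apply: le_trans (ler_normB _ _) _; apply: lerD.
  by rewrite ger0_norm ?powR_ge0.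
rewrite normrM (ger0_norm (powR_ge0 P _)).
by apply: ler_pM xD P2; rewrite ?powR_ge0.
Qed.

(** A negative value of the functional excludes constants, so the energy and e are positive. It also
    bounds the energy: with t = A^(1/p) the first term is t^2, while f(e) is at most linear in e,
    hence in the maximum of u, hence in t. *)
Lemma minimizer_bounds (p q mu C0 : R) (f th : R -> R) :
  2 < p -> p - 1 < q -> p != q -> 0 <= mu -> 0 <= C0 ->
  (forall s, s <= 0 -> f s <= 0) -> (forall s, 0 <= s -> f s <= C0 * s) ->
  (forall s, `|th s| <= C0) ->
  exists2 K : R, 0 < K & forall n (u : int -> R)
    (A := genergy n p u) (P := gpow n p u) (a := p - q)
    (e := a^-1 * (P `^ (2 / p) - 1))
    (al := mu * th e / a * P `^ (2 / p - 1) * A `^ (1 - 2 / p))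
    (ga := A `^ (1 - 2 / p) * (A `^ (2 / p) - mu * th e / a * P `^ (2 / p))),
  gper n u -> gpow n q u = 1 -> (forall k, 0 <= u k) ->
  A `^ (2 / p) - mu * f e < 0 ->
  [/\ 0 < A, K^-1 <= P <= K, 0 < e & forall k, u k <= K] /\
  [/\ `|al| <= K, `|ga| <= K &
  (forall k, spow (p - 1) (slope n u (k + 1)) - spow (p - 1) (slope n u k) = hstep n *
   - (al * apow (p - 1) (u (k + 1)) + ga * apow (q - 1) (u (k + 1)))) ->
   forall k, `|spow (p - 1) (slope n u k)| <= K].
Proof.
move=> hp hq pq mu0 C00 f0 fC thC.
have p0 : 0 < p by lra.
have q0 : 0 < q by lra.
have p1 : 1 < p by lra.
have q1 : 0 < q - 1 by lra.
have pm1 : 0 < p - 1 by lra.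
have T0 : 0 < T := two_pi_gt0 R.
have pi0 : 0 < pi :> R := pi_gt0 R.
have alp : p - q <= p by lra.
have al1 : (p - q) * 2 <= p by lra.
pose a := p - q; have an0 : a != 0 by rewrite subr_eq0.
have a0 : 0 < `|a| by rewrite normr_gt0.
pose D := mu * C0 / `|a|; have D0 : 0 <= D by rewrite !mulr_ge0 ?invr_ge0.
(* [Y] will bound A^(1/p), [K1] the values of u, [c0] the p-mean from below, [Ka] and [Kg] the
   multipliers, [Kw] the flux; each constant depends on the previous ones. *)
pose Y := 1 + D * (1 + 2 * T); have Y1 : 1 <= Y by rewrite lerDl mulr_ge0//; lra.
pose K1 := 1 + 2 * T * Y; have K11 : 1 <= K1 by rewrite lerDl; nra.
have K10 : 0 < K1 by exact: lt_le_trans K11.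
have Y0 : 0 < Y by exact: lt_le_trans Y1.
pose c0 := K1 `^ (- `|a|).
have c00 : 0 < c0 by rewrite powR_gt0.
pose Ka := D * c0 `^ (2 / p - 1) * Y `^ (p - 2).
have Ka0 : 0 <= Ka by rewrite !mulr_ge0 ?powR_ge0.
pose Kg := Y `^ (p - 2) * (Y `^ 2 + D * K1 `^ 2).
have Kg0 : 0 <= Kg by rewrite !mulr_ge0 ?addr_ge0 ?mulr_ge0 ?powR_ge0.
pose C := Ka * K1 `^ (p - 1) + Kg * K1 `^ (q - 1).
have Cge0 : 0 <= C.
  by apply: addr_ge0; apply: mulr_ge0 => //; exact: powR_ge0.
pose Kw := Y `^ (p - 1) + T * C.
have Kw0 : 0 <= Kw.
  by apply: addr_ge0; [exact: powR_ge0|apply: mulr_ge0; [exact: ltW T0|exact: Cge0]].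
pose K := c0^-1 + K1 `^ p + K1 + Ka + Kg + Kw.
have ic0 : 0 < c0^-1 by rewrite invr_gt0.
have K1p : 0 <= K1 `^ p by exact: powR_ge0.
have [KK KK1 KK2 KK3 [KK4 KK5 KK6]] : [/\ 0 < K, c0^-1 <= K, K1 `^ p <= K, K1 <= K &
    [/\ Ka <= K, Kg <= K & Kw <= K]].
  have sum6 (x y z v w r : R) (k := x + y + z + v + w + r) : 0 < x -> 0 <= y -> 0 < z ->
      0 <= v -> 0 <= w -> 0 <= r ->
      [/\ 0 < k, x <= k, y <= k, z <= k & [/\ v <= k, w <= k & r <= k]].
    by rewrite /k; clear => *; split; [..|split]; lra.
  exact: sum6.
exists K => //.
move=> n u A P a' e al ga up Q1 u0 neg.
have A0 : 0 <= A := genergy_ge0' n p u.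
have Pge0 : 0 <= P by apply: gmean_ge0 => k; exact: powR_ge0.
have muf : 0 < mu * f e by move: (powR_ge0 A (2 / p)) neg; clear; lra.
have e0 : 0 < e.
  rewrite ltNge; apply/negP => e0; have := f0 _ e0.
  by move: muf mu0; clear; move: (f e) => z *; nra.
have sup (t : R) : 0 < t -> A <= t `^ p -> forall k, u k <= 1 + 2 * T * t.
  by move=> t0 At; exact: (grid_sup_le p1 q0 t0 At up Q1 u0).
(* The sign of p - q and e > 0 decide on which side of 1 the p-mean lies; the other bound compares
   the p-mean and the q-mean through u <= B, the q-mean being 1. *)
have bnd B : 1 <= B -> (forall k, u k <= B) ->
    [/\ B `^ (- `|a|) <= P, P <= B `^ p & e <= B / `|a|].
  move=> B1 uB; have B0 : 0 < B by exact: lt_le_trans B1.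
  have uB' k : 0 <= u k <= B by rewrite u0 uB.
  have ge1 r : 0 <= r -> 1 <= B `^ r by exact: ge1_powR.
  have i0 : 0 < 2 / p by rewrite divr_gt0.
  have Xlt1 : P `^ (2 / p) < 1 -> P <= 1.
    by move=> X1; rewrite leNgt; apply: contraL X1 => /ltW P1; rewrite -leNgt ge1_powR// ltW.
  have Xgt1 : 1 < P `^ (2 / p) -> 1 <= P.
    move=> X1; rewrite leNgt; apply: contraL X1 => /ltW P1; rewrite -leNgt le1_powR ?(ltW i0)//.
    by rewrite Pge0.
  have [qp|pq'|E] := ltgtP q p; last by rewrite E eqxx in pq.
  - have ap : 0 < a by rewrite subr_gt0.
    rewrite (gtr0_norm ap).
    have X1 : 1 < P `^ (2 / p).
      by move: e0; rewrite /e pmulr_rgt0 ?invr_gt0// subr_gt0.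
    have PB : P <= B `^ a by have := gpow_le n (ltW qp) q0 uB'; rewrite Q1 mulr1.
    split.
    + apply: le_trans (_ : 1 <= _); last exact: Xgt1.
      by rewrite powRN invf_le1 ?powR_gt0// ge1 ?ltW.
    + by apply: le_trans PB _; rewrite ler_powR.
    + rewrite /e mulrC ler_wpM2r ?invr_ge0 ?(ltW ap)//.
      apply: le_trans (_ : P `^ (2 / p) <= _); first by rewrite lerBlDr lerDl.
      apply: le_trans (_ : (B `^ a) `^ (2 / p) <= _).
        by rewrite ge0_ler_powR ?nnegrE ?powR_ge0 ?(ltW i0).
      rewrite -powRrM -[leRHS](powRr1 (ltW B0)) ler_powR//.
      by rewrite mulrA ler_pdivrMr// mul1r.
  - have ap : a < 0 by rewrite subr_lt0.
    rewrite (ltr0_norm ap) opprK.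
    have X1 : P `^ (2 / p) < 1.
      by move: e0; rewrite /e nmulr_rgt0 ?invr_lt0// subr_lt0.
    have PB : 1 <= B `^ (- a) * P by have := gpow_le n (ltW pq') p0 uB'; rewrite Q1 opprB.
    split.
    + by rewrite -[a]opprK powRN -[leLHS]mulr1 ler_pdivrMl ?powR_gt0.
    + by apply: le_trans (Xlt1 X1) _; apply: ge1; exact: ltW.
    + rewrite /e -/a -mulrNN mulrC -invrN ler_wpM2r ?invr_ge0 ?oppr_ge0 ?(ltW ap)//.
      by rewrite opprB lerBlDr (le_trans B1)// lerDl powR_ge0.
(* With zero energy the supremum bound holds for every t > 0, so u <= 1; [bnd] with B = 1 then
   forces P = 1 and e = 0. *)
have Apos : 0 < A.
  rewrite lt_neqAle A0 andbT; apply/negP => /eqP Az.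
  have u1 k : u k <= 1.
    rewrite leNgt; apply/negP => uk.
    pose t := (u k - 1) / (4 * T).
    have t0 : 0 < t by rewrite divr_gt0 ?subr_gt0// mulr_gt0.
    have := sup t t0; rewrite -Az powR_ge0 => /(_ isT k).
    rewrite (_ : 2 * T * t = (u k - 1) / 2); first by move: uk; clear; lra.
    by rewrite /t; move: (T) (lt0r_neq0 T0) => z z0; field; rewrite z0.
  have [] := bnd 1 (lexx _) u1; rewrite !powR1 => P1 P1' _.
  have P1E : P = 1 by apply/eqP; rewrite eq_le P1' P1.
  by move: e0; rewrite /e P1E powR1 subrr mulr0 ltxx.
pose t := A `^ p^-1.
have t0 : 0 < t by rewrite powR_gt0.
have tp : t `^ p = A by rewrite /t -powRrM mulVf ?gt_eqF// powRr1.
have At : A <= t `^ p by rewrite tp.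
have A2p : A `^ (2 / p) = t ^+ 2.
  by rewrite -powR_mulrn ?(ltW t0)// /t -powRrM; congr powR; rewrite mulrC.
have tY : t <= Y.
  rewrite leNgt; apply/negP => Yt.
  have B1 : 1 <= 1 + 2 * T * t by rewrite lerDl; apply: mulr_ge0 (ltW t0); apply: mulr_ge0 (ltW T0).
  have [_ _ eB] := bnd _ B1 (sup t t0 At).
  have h1 : t ^+ 2 < mu * (C0 * ((1 + 2 * T * t) / `|a|)).
    have h2 : mu * f e <= mu * (C0 * e) by rewrite ler_wpM2l// fC// (ltW e0).
    have h3 : mu * (C0 * e) <= mu * (C0 * ((1 + 2 * T * t) / `|a|)).
      by apply: ler_wpM2l => //; apply: ler_wpM2l.
    by rewrite -A2p; move: neg h2 h3; clear; lra.
  have h2 : mu * (C0 * ((1 + 2 * T * t) / `|a|)) = D * (1 + 2 * T * t).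
    by rewrite /D; field; rewrite gt_eqF.
  rewrite h2 in h1; have t1 : 1 < t by exact: le_lt_trans Yt.
  have h3 : D * (1 + 2 * T * t) <= D * (1 + 2 * T) * t.
    by rewrite -[leRHS]mulrA; apply: ler_wpM2l => //; rewrite [leRHS](mulrDl 1) mul1r lerD2r ltW.
  move: h1 h3 Yt t0; rewrite /Y expr2; clear; move: (D * (1 + 2 * T)) (D * (1 + 2 * T * t)) => x y; move: t => z *; nra.
have uK1 k : u k <= K1.
  by apply: le_trans (sup t t0 At k) _; rewrite lerD2l ler_wpM2l// mulr_ge0// ltW.
have [cP PK eB] := bnd K1 K11 uK1.
have Ppos : 0 < P by exact: lt_le_trans cP.
have thD : `|mu * th e / a| <= D.
  rewrite !normrM normfV (ger0_norm mu0) /D ler_wpM2r ?invr_ge0//.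
  by rewrite ler_wpM2l.
have [alK gaK] := coefficient_bounds hp thD Apos tY c00 cP PK K10.
split; split.
- exact: Apos.
- apply/andP; split.
    apply: le_trans cP; rewrite -/c0 invf_ple ?posrE//.
  exact: le_trans PK KK2.
- exact: e0.
- by move=> k; exact: le_trans (uK1 k) KK3.
- exact: le_trans alK KK4.
- exact: le_trans gaK KK5.
move=> EL k.
apply: (@le_trans _ _ Kw); last exact: KK6.
apply: (@le_trans _ _ (t `^ (p - 1) + T * C)); last first.
  rewrite /Kw lerD2r.
  have p1' : 0 <= p - 1 by move: hp; clear; lra.
  exact: (ge0_ler_powR p1' (ltW t0 : t \is Num.nneg) (ltW Y0 : Y \is Num.nneg) tY).
apply: (spow_slope_le p1 t0 At up) => j; rewrite EL normrM (gtr0_norm (@hstep_gt0 R n)).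
rewrite ler_wpM2l ?(ltW (@hstep_gt0 R n))// normrN (le_trans (ler_normD _ _))//.
have uj r : 0 <= r -> apow r (u (j + 1)) <= K1 `^ r.
  by move=> r0; rewrite /apow ger0_norm// ge0_ler_powR ?nnegrE ?(ltW K10).
rewrite [`|al * _|]normrM [`|ga * _|]normrM !(ger0_norm (apow_ge0 _ _)) /C lerD//.
  by apply: ler_pM => //; [exact: apow_ge0|exact: uj (ltW pm1)].
by apply: ler_pM => //; [exact: apow_ge0|exact: uj (ltW q1)].
Qed.

End MinimizerBounds.

(** * The rigidity argument *)

Section Sampling.
Context {R : realType}.
Notation T := (2 * pi : R).

Lemma periodic_modulus (v : R -> R) e : continuous v -> (forall x, v (x + T) = v x) -> 0 < e ->
  exists2 d, 0 < d & forall x y, `|y - x| < d -> `|v y - v x| <= e.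
Proof.
move=> cv vT e0.
have [d d0 Hd] := cont_modulus (T + 1) cv e0.
exists (Num.min d 1); first by rewrite lt_min d0 ltr01.
move=> x y; rewrite lt_min => /andP[xd x1].
pose s := y - x.
have wT z : (fun z => v (z + s) - v z) (z + T) = (fun z => v (z + s) - v z) z.
  by rewrite /= addrAC !vT.
have [z /andP[z0 zT] /= E] := periodic_reduce wT x.
have -> : v y - v x = v (x + s) - v x by rewrite /s subrKC.
rewrite -E; apply: Hd.
- by rewrite ger0_norm// (le_trans (ltW zT))// lerDl.
- rewrite (le_trans (ler_normD _ _))// lerD// ?(ltW x1)//.
  by rewrite ger0_norm// ltW.
- by rewrite addrC addKr.
Qed.

Definition sample (v : R -> R) (n : nat) (k : int) : R := v (k%:~R * hstep n).

Lemma sample_per (v : R -> R) n : (forall x, v (x + T) = v x) -> gper n (sample v n).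
Proof.
move=> vT k; rewrite /sample intrD mulrDl.
by rewrite (_ : n.+1%:~R * hstep n = T) ?vT//; apply/hstepT.
Qed.

Lemma sample_mean (v : R -> R) (U : set_system nat) {UF : UltraFilter U} (ooU : \oo `<=` U) r :
  continuous v -> (forall x, v (x + T) = v x) -> 0 < r ->
  (fun n => gpow n r (sample v n)) @ U --> cint (fun x => apow r (v x)).
Proof.
move=> cv vT r0.
pose phi x := apow r (v x).
have cphi : continuous phi by exact: apow_comp_continuous.
have phiT x : phi (x + T) = phi x by rewrite /phi vT.
have [x0 _ H0] := periodic_max (cont_norm cphi) (fun x => congr1 Num.norm (phiT x)).
have h0 := @hstep_gt0 R.
apply: (@grid_mean R U UF ooU (fun n k => phi (k%:~R * hstep n)) phi `|phi x0|) => //.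
- move=> e e0; have [d d0 Hd] := periodic_modulus cphi phiT e0.
  exists d => // n k m hm; apply: Hd.
  rewrite intrD mulrDl addrC addKr mulrC normrM (gtr0_norm (h0 n)) ger0_norm; last by rewrite ler0z.
  exact: hm.
- move=> x.
  suff H : (fun n => (gfl (@hstep R) n x)%:~R * hstep n) @ U --> x.
    exact: (cvg_comp _ _ H (cphi x)).
  apply/cvgrPdist_le => e e0.
  have := @hstep_cvg R U ooU => /cvgrPdist_le /(_ e e0); apply: filterS => n.
  rewrite sub0r normrN (gtr0_norm (h0 n)); apply: le_trans.
  have /andP[k1 k2] := gfl_itv h0 n x.
  rewrite ger0_norm ?subr_ge0//; move: k2; rewrite mulrDl mul1r => k2.
  by rewrite lerBlDl ltW.
Qed.

End Sampling.

Section MainInequality.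
Context {R : realType}.
Notation T := (2 * pi : R).

Definition C1per (u v : R -> R) := [/\ forall x, u (x + T) = u x,
  forall x : R, is_derive x 1 u (v x) & continuous v].

(** The carre du champ estimate with the value of al inserted, mth being mu th(e). All terms share
    the factor A^(2-2/p) P^(-(1-2/p)). *)
Lemma carre_rescaled (p lam kap mth A P : R) : 0 < p -> 0 < A -> 0 < P ->
  lam * A `^ (2 - 2 / p) * P `^ (- (1 - 2 / p)) + kap * (A ^+ 2 / P) <=
    mth * P `^ (2 / p - 1) * A `^ (1 - 2 / p) * A ->
  lam + kap * (A `^ (2 / p) / P `^ (2 / p)) <= mth.
Proof.
move=> p0 A0 P0.
set Z := A `^ (2 - 2 / p) * P `^ (- (1 - 2 / p)).
have Z0 : 0 < Z by rewrite mulr_gt0 ?powR_gt0.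
have EA : A ^+ 2 = A `^ (2 - 2 / p) * A `^ (2 / p).
  by rewrite -powRDp// subrK powR_mulrn// ltW.
have EP : P^-1 = P `^ (- (1 - 2 / p)) * (P `^ (2 / p))^-1.
  rewrite -(powRN P) -powRDp// -powR_inv1 ?(ltW P0)//; congr (_ `^ _); ring.
have -> : A ^+ 2 / P = Z * (A `^ (2 / p) / P `^ (2 / p)) by rewrite EA EP mulrACA.
have -> : mth * P `^ (2 / p - 1) * A `^ (1 - 2 / p) * A = mth * Z.
  rewrite /Z; have <- : A `^ (1 - 2 / p) * A = A `^ (2 - 2 / p).
    rewrite -{2}(powRr1 (ltW A0)) -powRDp//; congr (_ `^ _); ring.
  have <- : 2 / p - 1 = - (1 - 2 / p) by ring.
  ring.
rewrite -(mulrA lam) -/Z; move: (A `^ (2 / p) / _) => r; clearbody Z.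
rewrite (_ : _ + _ = Z * (lam + kap * r)); last by ring.
by rewrite (mulrC mth) ler_pM2l.
Qed.

(* If the conclusion fails, it also fails with some [mu < lam] in front of [f];
   minimizers of the functional on grids then converge to a solution [u] of an
   Euler-Lagrange equation with [0 < e], for which the carre du champ estimate
   gives [lam + kap (A / P) ^ (2 / p) <= mu * th e], against either alternative
   of the last hypothesis. *)
Theorem rigidity_inequality (p q lam C0 : R) (f th : R -> R) :
  2 < p -> p - 1 < q -> p != q -> 0 < lam -> 0 <= C0 -> continuous f ->
  (forall s, s <= 0 -> f s <= 0) -> (forall s, 0 <= s -> f s <= C0 * s) ->
  (forall s : R, 0 < s -> is_derive s 1 f (th s)) -> continuous th ->
  (forall s, `|th s| <= C0) ->
  (forall u v, C1per u v ->
     lam * cint (fun x => apow p (u x - cint u)) `^ (2 / p) <= cint (fun x => apow p (v x)) `^ (2 / p)) ->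
  (forall u v (A := cint (fun x => apow p (v x))) (P := cint (fun x => apow p (u x)))
     (e := (p - q)^-1 * (P `^ (2 / p) - 1)), C1per u v -> (forall x, 0 <= u x) ->
     cint (fun x => apow q (u x)) = 1 -> 0 < e ->
     lam * f e <= A `^ (2 / p) \/
     lam * th e <= lam + (1 + q - p) * ((p - 1) ^+ 2 / (2 * p - 1)) * (A `^ (2 / p) / P `^ (2 / p))) ->
  forall v Av (Pv := cint (fun x => apow p (v x))) (Qv := cint (fun x => apow q (v x))),
    continuous v -> (forall x, v (x + T) = v x) -> 0 <= Av ->
    (forall n, genergy n p (sample v n) <= Av) -> 0 < Qv ->
    lam * f ((p - q)^-1 * (Pv `^ (2 / p) * Qv `^ (- (2 / q)) - 1)) <= Av `^ (2 / p) * Qv `^ (- (2 / q)).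
Proof.
move=> hp hq pq lam0 C00 cf f0 fC df cth thC Hpoinc H v Av Pv Qv cv vT Av0 HAv Qv0.
have p0 : 0 < p by lra.
have q0 : 0 < q by lra.
have q1 : 1 < q by lra.
have i0 : 0 < 2 / p by rewrite divr_gt0.
have i1 : 0 < 1 - 2 / p by rewrite subr_gt0 ltr_pdivrMr// mul1r.
set a := p - q; have an0 : a != 0 by rewrite subr_eq0.
set I := Av `^ (2 / p) * _; set G := f _.
rewrite leNgt; apply/negP => IG.
have I0 : 0 <= I by rewrite mulr_ge0 ?powR_ge0.
have G0 : 0 < G.
  rewrite ltNge; apply/negP => G0; move: IG I0 lam0; clearbody I G; move: G0; clear => *; nra.
(* The midpoint of I / G and lam. *)
have [mu [mu0 mulam muG]] : exists mu, [/\ 0 <= mu, mu < lam & I < mu * G].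
  exists ((I / G + lam) / 2).
  have IGl : I / G < lam by rewrite ltr_pdivrMr.
  have IG0 : 0 <= I / G by rewrite divr_ge0// ltW.
  have E : I = I / G * G by rewrite divfK ?gt_eqF.
  move: IGl IG0 E lam0 G0; move: (I / G) => z; clear => zl z0 E l0 G0; split; try lra.
  by rewrite {1}E; nra.
have [U [UF ooU]] := ultraFilterLemma eventually_filter.
have [K K0 HK] := minimizer_bounds hp hq pq mu0 C00 f0 fC thC.
pose vn n := sample v n.
pose good n := 0 < gpow n q (vn n) /\ gfun n p q mu a f (vn n) < 0.
have powA (r x : R) : 0 <= x -> apow r x = x `^ r by move=> x0; rewrite /apow ger0_norm.
have sel n : exists s : (int -> R) * (R * R), let u := s.1 in let al := s.2.1 in let ga := s.2.2 in
   [/\ gper n u, forall k, 0 <= u k, forall k, u k <= K,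
      forall k, `|spow (p - 1) (slope n u k)| <= K &
      [/\ `|al| <= K, `|ga| <= K &
      forall k, spow (p - 1) (slope n u (k + 1)) - spow (p - 1) (slope n u k) = hstep n *
        - (al * apow (p - 1) (u (k + 1)) + ga * apow (q - 1) (u (k + 1)))]] /\
   (good n -> [/\ gpow n q u = 1, K^-1 <= gpow n p u <= K,
      al = mu * th (a^-1 * (gpow n p u `^ (2 / p) - 1)) / a * gpow n p u `^ (2 / p - 1) * genergy n p u `^ (1 - 2 / p) &
      genergy n p u `^ (2 / p) - mu * f (a^-1 * (gpow n p u `^ (2 / p) - 1)) <= gfun n p q mu a f (vn n)]).
  (* A triple is chosen at every n: at a bad index the zero function with zero multipliers satisfies
     the uniform bounds and the discrete equation. *)
  have [[Qn gn]|ng] := pselect (good n); last first.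
    exists (fun=> 0, (0, 0)) => /=; split => //.
    have E : spow (p - 1) (slope n (fun=> 0) 0) = 0 :> R.
      by rewrite /slope subrr mul0r /spow sgr0 mul0r.
    split; [by []|by []|by move=> k; exact: ltW| |].
      by move=> k; rewrite /slope subrr mul0r /spow sgr0 mul0r normr0 ltW.
    split; [by rewrite normr0 ltW|by rewrite normr0 ltW|].
    by move=> k; rewrite /slope !subrr !mul0r addr0 oppr0 mulr0.
  have [u [up Q1 u0 umin]] := gfun_min_ge0 n mu a hp q1 cf.
  have gu := umin _ (sample_per n vT) Qn.
  have A0 := genergy_ge0' n p u.
  have Pn0 : 0 <= gpow n p u by apply: gmean_ge0 => k; exact: powR_ge0.
  have guE : gfun n p q mu a f u = genergy n p u `^ (2 / p) - mu * f (a^-1 * (gpow n p u `^ (2 / p) - 1)).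
    by rewrite /gfun Q1 gval_Q1 !powA.
  have neg : genergy n p u `^ (2 / p) - mu * f (a^-1 * (gpow n p u `^ (2 / p) - 1)) < 0.
    by rewrite -guE; exact: le_lt_trans gn.
  have [[Apos Pb epos uK] [alK gaK wK]] := HK n u up Q1 u0 neg.
  have Ppos : 0 < gpow n p u.
    by have /andP[+ _] := Pb; apply: lt_le_trans; rewrite invr_gt0.
  have EL := euler_lagrange hp q1 up Q1 u0 Apos Ppos (df _ epos) umin.
  exists (u, (mu * th (a^-1 * (gpow n p u `^ (2 / p) - 1)) / a * gpow n p u `^ (2 / p - 1) * genergy n p u `^ (1 - 2 / p),
   genergy n p u `^ (1 - 2 / p) * (genergy n p u `^ (2 / p) - mu * th (a^-1 * (gpow n p u `^ (2 / p) - 1)) / a * gpow n p u `^ (2 / p)))).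
  move=> /=; split.
    by split; [exact: up|exact: u0|exact: uK|exact: wK EL|split; [exact: alK|exact: gaK|exact: EL]].
  move=> _; split; [exact: Q1|exact: Pb|by []|by rewrite -guE].
have [s Hs] := choice sel.
pose uN n := (s n).1; pose alN n := (s n).2.1; pose gaN n := (s n).2.2.
have [u [w [al [ga [[u0 uT wT du dw] [Hal Hga Hpow Hen]]]]]] :
  exists (u w : R -> R) (al ga : R),
  [/\ forall x, 0 <= u x, forall x, u (x + T) = u x, forall x, w (x + T) = w x,
      forall x : R, is_derive x 1 u (spow (p - 1)^-1 (w x)) &
      forall x : R, is_derive x 1 w (- (al * u x `^ (p - 1) + ga * u x `^ (q - 1)))] /\
  [/\ alN @ U --> al, gaN @ U --> ga,
      forall r, 0 < r ->
      (fun n => n.+1%:R^-1 * \sum_(k < n.+1) apow r (uN n k%:Z)) @ U --> cint (fun x => apow r (u x)) &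
      (fun n => n.+1%:R^-1 * \sum_(k < n.+1) apow p (gslope uN n k%:Z)) @ U -->
        cint (fun x => apow (1 + (p - 1)^-1) (w x))].
  apply: (@grid_compactness R U UF ooU p q K uN alN gaN hp hq K0).
  - by move=> n k; have [[up _ _ _ _] _] := Hs n; exact: up.
  - by move=> n k; have [[_ u0 _ _ _] _] := Hs n; exact: u0.
  - by move=> n k; have [[_ _ uK _ _] _] := Hs n; exact: uK.
  - by move=> n k; have [[_ _ _ wK _] _] := Hs n; exact: wK.
  - by move=> n; have [[_ _ _ _ [alK _ _]] _] := Hs n; exact: alK.
  - by move=> n; have [[_ _ _ _ [_ gaK _]] _] := Hs n; exact: gaK.
  - by move=> n k; have [[_ _ _ _ [_ _ EL]] _] := Hs n; exact: EL.
set A := cint _ in Hen.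
pose P := cint (fun x => apow p (u x)).
have HP : (fun n => gpow n p (uN n)) @ U --> P := Hpow p p0.
have HQ : (fun n => gpow n q (uN n)) @ U --> cint (fun x => apow q (u x)) := Hpow q q0.
have {}Hen : (fun n => genergy n p (uN n)) @ U --> A := Hen.
have cvgpow (x : nat -> R) (l r : R) : 0 < l -> x @ U --> l -> (fun n => x n `^ r) @ U --> l `^ r.
  move=> l0 xl; have c : {for l, continuous (@powR R ^~ r)}.
    apply: differentiable_continuous; apply/derivable1_diffP.
    by apply: derivable_powR; rewrite in_itv/= andbT.
  exact: (cvg_comp _ _ xl c).
have cvgapow (x : nat -> R) (l r : R) : 0 < r -> x @ U --> l -> (fun n => apow r (x n)) @ U --> apow r l.
  by move=> r0 xl; exact: (cvg_comp _ _ xl (apow_continuous r0 (x := l))).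
have HPv : (fun n => gpow n p (vn n)) @ U --> Pv := @sample_mean R v U UF ooU p cv vT p0.
have HQv : (fun n => gpow n q (vn n)) @ U --> Qv := @sample_mean R v U UF ooU q cv vT q0.
have Pv0 : 0 <= Pv by apply: cint_ge0 => x; exact: apow_ge0.
have GvE : gval p q mu a f Av Pv Qv = I - mu * G by rewrite /gval !powA.
have Hgv : (fun n => gval p q mu a f Av (gpow n p (vn n)) (gpow n q (vn n))) @ U --> I - mu * G.
  rewrite -GvE /gval.
  have c1 := cvgpow _ _ (- (2 / q)) Qv0 HQv.
  have c2 := cvgapow _ _ _ i0 HPv.
  pose proof (cvgM c2 c1) as c3.
  pose proof (cvgM (cvg_cst a^-1) (cvgB c3 (cvg_cst (1 : R)))) as c4.
  pose proof (cvg_comp _ _ c4 (cf _)) as c5.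
  exact: (cvgB (cvgM (cvg_cst (apow (2 / p) Av)) c1) (cvgM (cvg_cst mu) c5)).
(* Energies of samples need not be shown to converge: the constant Av dominates them, and the
   remaining means converge. *)
have lev n : gfun n p q mu a f (vn n) <= gval p q mu a f Av (gpow n p (vn n)) (gpow n q (vn n)).
  by apply: (le_gval q mu a f hp); [exact: genergy_ge0'|exact: HAv].
have IGneg : I - mu * G < 0 by rewrite subr_lt0.
have goodU : \forall n \near U, good n.
  pose proof (cvgr_lt _ Hgv _ IGneg) as h1.
  pose proof (cvgr_gt _ HQv _ Qv0) as h2.
  by apply: filterS (filterI h1 h2) => n [{}h1 {}h2]; split => //; exact: le_lt_trans h1.
have Q1 : cint (fun x => apow q (u x)) = 1.
  apply: (cvg_unique (@Rhausdorff R) HQ).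
  apply: cvg_near_cst; apply: filterS goodU => n gn; have [_ /(_ gn)[+ _ _ _]] := Hs n.
  by [].
(* The lower bound survives in the limit and keeps the negative powers of P under control. *)
have PK : K^-1 <= P.
  apply: (cvgr_to_ge HP); apply: filterS goodU => n gn.
  by have [_ /(_ gn)[_ /andP[+ _] _ _]] := Hs n.
have P0 : 0 < P by apply: lt_le_trans PK; rewrite invr_gt0.
pose e := a^-1 * (P `^ (2 / p) - 1).
have He : (fun n => a^-1 * (gpow n p (uN n) `^ (2 / p) - 1)) @ U --> e.
  exact: (cvgM (cvg_cst a^-1) (cvgB (cvgpow _ _ _ P0 HP) (cvg_cst (1 : R)))).
have A0 : 0 <= A by apply: cint_ge0 => x; exact: apow_ge0.
have Anpow (r : R) : 0 < r -> (fun n => genergy n p (uN n) `^ r) @ U --> A `^ r.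
  move=> r0; rewrite -(powA r A A0).
  rewrite (_ : (fun n => _) = (fun n => apow r (genergy n p (uN n)))); first exact: (cvgapow _ _ _ r0 Hen).
  by apply/funext => n; rewrite powA// genergy_ge0'.
have low : A `^ (2 / p) - mu * f e <= I - mu * G.
  have c1 : (fun n => genergy n p (uN n) `^ (2 / p) - mu * f (a^-1 * (gpow n p (uN n) `^ (2 / p) - 1))) @ U -->
     A `^ (2 / p) - mu * f e.
    exact: (cvgB (Anpow _ i0) (cvgM (cvg_cst mu) (cvg_comp _ _ He (cf _)))).
  apply: (ler_cvg_to c1 Hgv); apply: filterS goodU => n gn.
  by have [_ /(_ gn)[_ _ _ +]] := Hs n => /le_trans; apply; exact: lev.
have alE : al = mu * th e / a * P `^ (2 / p - 1) * A `^ (1 - 2 / p).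
  apply: (cvg_unique (@Rhausdorff R) Hal).
  have c1 : (fun n => mu * th (a^-1 * (gpow n p (uN n) `^ (2 / p) - 1)) / a *
     gpow n p (uN n) `^ (2 / p - 1) * genergy n p (uN n) `^ (1 - 2 / p)) @ U -->
     mu * th e / a * P `^ (2 / p - 1) * A `^ (1 - 2 / p).
    pose proof (cvgM (cvgM (cvg_cst mu) (cvg_comp _ _ He (cth _))) (cvg_cst a^-1)) as c1.
    exact: (cvgM (cvgM c1 (cvgpow _ _ _ P0 HP)) (Anpow _ i1)).
  apply: cvg_trans c1; apply: near_eq_cvg; apply: filterS goodU => n gn.
  by have [_ /(_ gn)[_ _ + _]] := Hs n => E; first [exact: E|exact: esym E].
have fe : 0 < mu * f e.
  by move: low IGneg (powR_ge0 A (2 / p)); clear; move: (mu * f e) (A `^ _) (I - _) => *; lra.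
have e0 : 0 < e.
  rewrite ltNge; apply/negP => e0; have := f0 _ e0.
  by move: fe mu0; move: (f e) => z; clear => *; nra.
pose vv x := spow (p - 1)^-1 (w x).
have ip : 0 < (p - 1)^-1 by rewrite invr_gt0 subr_gt0 (lt_trans _ hp)// ltr1n.
have cw : continuous w by exact: is_derive_continuous dw.
have C1 : C1per u vv.
  by split => //; apply: cont_comp cw; exact: spow_continuous.
have AE : cint (fun x => apow p (vv x)) = A.
  apply: eq_cint => x; rewrite /vv apow_spow//; congr apow; field.
  by rewrite gt_eqF//; move: hp; clear; lra.
have HPu := Hpoinc _ _ C1; rewrite AE in HPu.
have cu : continuous u by exact: is_derive_continuous du.
(* If A vanished, the Poincare inequality would make u constant, equal to 1 by its q-mean, and e
   would be 0. *)
have Apos : 0 < A.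
  rewrite lt_neqAle A0 andbT; apply/negP => /eqP Az.
  move: HPu; rewrite -Az powR0 ?gt_eqF// => HPu.
  set m := cint u in HPu.
  have V0 : cint (fun x => apow p (u x - m)) = 0.
    have V0 : 0 <= cint (fun x => apow p (u x - m)) by apply: cint_ge0 => x; exact: apow_ge0.
    apply/eqP; rewrite eq_le V0 andbT leNgt; apply/negP => Vp.
    by move: HPu; rewrite leNgt mulr_gt0// powR_gt0.
  have um x : u x = m.
    have pT y : (fun x => apow p (u x - m)) (y + T) = (fun x => apow p (u x - m)) y by rewrite /= uT.
    have [y /andP[y0 yT] /= E] := periodic_reduce pT x.
    have cV : continuous (fun x => apow p (u x - m)) by cts.
    apply/eqP; rewrite -subr_eq0 -normr_eq0; apply/negPn/negP => ux.
    have uxp : 0 < apow p (u y - m) by rewrite E powR_gt0// lt_def ux normr_ge0.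
    have := cint_gt0 cV (fun x => apow_ge0 _ _) (_ : 0 <= y <= T) uxp.
    by rewrite V0 ltxx y0 (ltW yT) => /(_ isT).
  have m0 : 0 <= m by rewrite -(um 0).
  have mq : m `^ q = 1.
    rewrite -Q1 -[LHS](@cint_cst R); apply: eq_cint => x.
    by rewrite um powA.
  have m1 : m = 1.
    have := congr1 (fun x => x `^ q^-1) mq.
    by rewrite /= -powRrM divff ?gt_eqF// (powRr1 m0) powR1.
  have P1 : P = 1.
    by rewrite /P -[RHS](@cint_cst R); apply: eq_cint => x; rewrite um m1 powA ?powR1.
  by move: e0; rewrite /e P1 powR1 subrr mulr0 ltxx.
have key := carre_du_champ hp hq u0 uT wT du dw (ltW lam0) Apos P0 HPu.
have {}key : lam + (1 + q - p) * ((p - 1) ^+ 2 / (2 * p - 1)) * (A `^ (2 / p) / P `^ (2 / p)) <= mu * th e.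
  apply: (carre_rescaled p0 Apos P0); apply: le_trans key _.
  rewrite alE -/a le_eqVlt; apply/orP; left; apply/eqP.
  have cancel (m b X Y Z : R) : b != 0 -> m / b * X * Y * b * Z = m * X * Y * Z by move=> ?; field.
  exact: cancel.
(* The first alternative contradicts the negative value of the limit functional, as mu < lam and 0 <
   f(e). In the second, lam th(e) <= mu th(e) forces th(e) <= 0, while mu th(e) >= lam > 0. *)
have := H u vv C1 u0 Q1; rewrite AE => /(_ e0) [h|h].
  move: h low IGneg; rewrite -/P -/e.
  have fe0 : 0 < f e.
    rewrite ltNge; apply/negP => fe0; move: fe mu0 fe0; clear; move: (f e) => z *; nra.
  move: fe0 mulam; clear; move: (f e) (A `^ (2 / p)) (I - mu * G) => x y z *; nra.
have hk : lam * th e <= mu * th e by exact: le_trans h key.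
have kp : 0 <= (1 + q - p) * ((p - 1) ^+ 2 / (2 * p - 1)) * (A `^ (2 / p) / P `^ (2 / p)).
  apply: mulr_ge0; last exact: divr_ge0 (powR_ge0 _ _) (powR_ge0 _ _).
  apply: mulr_ge0; first by move: hp hq; clear; lra.
  by apply: divr_ge0 (sqr_ge0 _) _; move: hp; clear; lra.
move: key hk kp mulam mu0 lam0; clear; move: (_ * (_ / _)) (th e) => x y *; nra.
Qed.

End MainInequality.

(** * The Poincare constant *)

Section PoincareConstant.
Context {R : realType}.
Notation T := (2 * pi : R).
Implicit Types u v f g : R -> R.

Lemma cont_Lfun r f : 0 < r -> continuous f -> f \in Lfun (sigma R) r%:E.
Proof.
move=> r0 cf; rewrite inE; apply/andP; split; rewrite inE/=.
  exact: cont_measurable.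
by rewrite /finite_norm Lnorm_cont// ltry.
Qed.

Lemma derive1_smooth (phi : R -> R) : smooth_periodic phi ->
  (forall x : R, is_derive x 1 phi (derive1 phi x)) /\ continuous (derive1 phi).
Proof.
move=> [_ dphi]; split => x.
  have d0 : derivable phi x 1 := dphi 0%N x.
  by rewrite derive1E; apply: DeriveDef.
apply: differentiable_continuous; apply/derivable1_diffP.
exact: (dphi 1%N x).
Qed.

Lemma C1per_weak u v : C1per u v -> weak_derivative u v.
Proof.
move=> [uT du cv] phi sphi; have [dphi cphi'] := derive1_smooth sphi.
have cu := is_derive_continuous du; have cphi := is_derive_continuous dphi.
have H : cint (fun x => u x * derive1 phi x + v x * phi x) = 0.
  apply: (@cint_periodic _ (fun x => u x * phi x)).
  - move=> x; have := is_deriveM (du x) (dphi x).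
    by rewrite /GRing.scale /= [phi x * v x]mulrC.
  - by cts.
  - by rewrite -(uT 0) add0r; case: sphi => + _ => /(_ 0); rewrite add0r => ->.
move: H; rewrite cintD; [|by cts|by cts].
by move/eqP; rewrite addr_eq0 => /eqP.
Qed.

Lemma lambda1_lbound p : lbound [set l | exists v dv : R -> R, W1_mean0 p v dv /\
  l = norm_L p dv ^+ 2 / norm_L p v ^+ 2] 0.
Proof. by move=> l [v [dv [_ ->]]]; rewrite divr_ge0// sqr_ge0. Qed.

Lemma lambda1_ge0 (p : R) : 0 <= lambda1 p.
Proof.
rewrite /lambda1; set S := [set l | _].
have [->|S0] := eqVneq S set0; first by rewrite inf0.
by apply: lb_le_inf; [exact/set0P|exact: lambda1_lbound].
Qed.

Lemma powR_sqr (x r : R) : 0 <= x -> (x `^ r^-1) ^+ 2 = x `^ (2 / r).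
Proof. by move=> x0; rewrite -powR_mulrn ?powR_ge0// -powRrM mulrC. Qed.

Lemma C1per_cst0 (u : R -> R) x : (forall x, u (x + T) = u x) -> continuous u ->
  u x != 0 -> forall r, 0 < r -> 0 < cint (fun x => apow r (u x)).
Proof.
move=> uT cu ux r r0.
have [y /andP[y0 yT] E] := periodic_reduce uT x.
apply: (@cint_gt0 _ _ y).
- by cts.
- by move=> z; exact: apow_ge0.
- by rewrite y0 ltW.
- by rewrite E powR_gt0// normr_gt0.
Qed.

Lemma ae_zero_apow r u : 0 < r -> continuous u -> ae_zero u -> cint (fun x => apow r (u x)) = 0.
Proof.
move=> r0 cu u0; rewrite /cint /Rintegral (ae_eq_integral (cst 0%E))//=.
- by rewrite integral0.
- by apply/measurable_EFinP; apply: cont_measurable; cts.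
- move: u0; apply: filterS; first exact: (ae_filter_ringOfSetsType (sigma R)).
  by move=> x /= H _; rewrite (H I) /apow normr0 powR0// gt_eqF.
Qed.

Lemma poincare (p : R) u v : 2 < p -> C1per u v ->
  lambda1 p * cint (fun x => apow p (u x - cint u)) `^ (2 / p) <=
  cint (fun x => apow p (v x)) `^ (2 / p).
Proof.
move=> hp C1; have [uT du cv] := C1; have cu := is_derive_continuous du.
have p0 : 0 < p by exact: lt_trans hp.
set m := cint u; pose w x := u x - m.
have cw : continuous w by rewrite /w; cts.
have C1w : C1per w v.
  split => // x; first by rewrite /w uT.
  by rewrite -[v x]subr0; apply: is_deriveB.
have A0 : 0 <= cint (fun x => apow p (v x)) by apply: cint_ge0 => x; exact: apow_ge0.
have B0 : 0 <= cint (fun x => apow p (w x)) by apply: cint_ge0 => x; exact: apow_ge0.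
have [B1|B1] := eqVneq (cint (fun x => apow p (w x))) 0.
  by rewrite B1 powR0 ?mulr0 ?powR_ge0// gt_eqF// divr_gt0.
have Bp : 0 < cint (fun x => apow p (w x)) by rewrite lt_def B1.
have W : W1_mean0 p w v.
  split.
  - by split; [exact: cont_Lfun|exact: cont_Lfun|exact: C1per_weak].
  - by move=> /(ae_zero_apow p0 cw) E; rewrite E eqxx in B1.
  - by rewrite -/(cint w) /w cintB ?cint_cst ?subrr//; exact: cont_cst.
have H : lambda1 p <= norm_L p v ^+ 2 / norm_L p w ^+ 2.
  apply: ge_inf; first by exists 0; exact: lambda1_lbound.
  by exists w, v.
have EV : norm_L p v ^+ 2 = cint (fun x => apow p (v x)) `^ (2 / p).
  by rewrite (norm_L_cont p0 cv); exact: (powR_sqr _ A0).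
have EW : norm_L p w ^+ 2 = cint (fun x => apow p (w x)) `^ (2 / p).
  by rewrite (norm_L_cont p0 cw); exact: (powR_sqr _ B0).
rewrite EV EW in H.
have Wp := powR_gt0 (2 / p) Bp.
have fin (l X Y : R) : 0 < X -> l <= Y / X -> l * X <= Y by move=> X0; rewrite ler_pdivlMr.
exact: fin Wp H.
Qed.

Lemma C1per_cos : C1per (cos : R -> R) (fun x => - sin x) /\ C1per (sin : R -> R) cos.
Proof.
have cc : continuous (cos : R -> R) by exact: continuous_cos.
have cs : continuous (sin : R -> R) by exact: continuous_sin.
have E : T = pi *+ 2 by rewrite mulr2n mulrDl mul1r.
split; split.
- by move=> x; rewrite E cosD2pi.
- by move=> x; exact: is_derive_cos.
- exact: (contN cs).
- by move=> x; rewrite E sinD2pi.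
- by move=> x; exact: is_derive_sin.
- exact: cc.
Qed.

(* The quotients of cos and sin are inverse to each other. *)
Lemma lambda1_le1 (p : R) : 2 < p -> lambda1 p <= 1.
Proof.
move=> hp; have [C S] := C1per_cos; have p0 : 0 < p by exact: lt_trans hp.
have ip : 0 < 2 / p by rewrite divr_gt0.
have E : T = pi *+ 2 by rewrite mulr2n mulrDl mul1r.
have [cT dc cs'] := C; have [sT ds cc] := S; have cs := is_derive_continuous ds.
have m1 : cint (cos : R -> R) = 0.
  by apply: (cint_periodic ds cc); rewrite -(sT 0) add0r.
have m2 : cint (sin : R -> R) = 0.
  apply: (@cint_periodic _ (fun x => - cos x)); [|exact: cs|].
    by move=> x; rewrite -[sin x]opprK; apply: is_deriveN.
  by rewrite -(cT 0) add0r.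
have h1 := poincare hp C; have h2 := poincare hp S.
rewrite m1 in h1; rewrite m2 in h2.
have e0 f : (fun x : R => apow p (f x - 0)) = (fun x => apow p (f x)).
  by apply/funext => x; rewrite subr0.
have e1 : (fun x : R => apow p (- sin x)) = (fun x => apow p (sin x)).
  by apply/funext => x; rewrite /apow normrN.
rewrite e0 e1 in h1; rewrite e0 in h2.
have c0 : 0 < cint (fun x : R => apow p (cos x)).
  by apply: (C1per_cst0 (x := 0)) => //; rewrite cos0 oner_eq0.
rewrite leNgt; apply/negP => l1.
have X (a b l : R) : 1 < l -> 0 < a -> l * a <= b -> l * b <= a -> False.
  move=> l1' a0 h k.
  have ab : a < b by apply: lt_le_trans h; rewrite ltr_pMl.
  have bl : b < l * b by rewrite ltr_pMl// (lt_trans a0).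
  by have := lt_trans ab (lt_le_trans bl k); rewrite ltxx.
exact: X l1 (powR_gt0 (2 / p) c0) h1 h2.
Qed.

(** Convexity of the p-th power, read off from Young's inequality for the product |t| |s|^(p-1). *)
Lemma tangent_apow (p s t : R) : 1 < p ->
  apow p s + p * spow (p - 1) s * (t - s) <= apow p t.
Proof.
move=> p1; have p0 : 0 < p by exact: lt_trans p1.
have p10 : 0 < p - 1 by rewrite subr_gt0.
pose r := p / (p - 1).
have r0 : 0 < r by rewrite divr_gt0.
have H := @conjugate_powR R `|t| (`|s| `^ (p - 1)) p r (normr_ge0 _) (powR_ge0 _ _) p0 r0.
have pr : p^-1 + r^-1 = 1 by rewrite /r; field; rewrite !gt_eqF.
have {H} := H pr; rewrite -powRrM (_ : (p - 1) * r = p); last first.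
  by rewrite /r; field; rewrite gt_eqF.
rewrite -/(apow p t) -/(apow p s) /r => H.
have ss : spow (p - 1) s * s = apow p s.
  by rewrite spowM// subrK.
have st : spow (p - 1) s * t <= `|t| * `|s| `^ (p - 1).
  by apply: le_trans (ler_norm _) _; rewrite normrM (normr_spow _ p10) mulrC.
have {}H : p * (`|t| * `|s| `^ (p - 1)) <= apow p t + (p - 1) * apow p s.
  have -> : apow p t + (p - 1) * apow p s = p * (apow p t / p + apow p s / (p / (p - 1))).
    by field; rewrite !gt_eqF.
  by rewrite ler_pM2l.
have K : p * (spow (p - 1) s * t) <= p * (`|t| * `|s| `^ (p - 1)) by rewrite ler_pM2l.
have -> : p * spow (p - 1) s * (t - s) = p * (spow (p - 1) s * t) - p * apow p s.
  by rewrite -ss; ring.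
have := le_trans K H; clear; move: (p * (_ * _)) (apow p s) (apow p t) => a b c.
by rewrite mulrBl mul1r => *; lra.
Qed.

End PoincareConstant.

(** * The a priori bound *)

Section RealInequalities.
Context {R : realType}.
Implicit Types a b p s x y z : R.

Lemma ler_powR2r x y r : 0 <= r -> 0 <= x -> x <= y -> x `^ r <= y `^ r :> R.
Proof. by move=> r0 x0 xy; rewrite ge0_ler_powR ?nnegrE// (le_trans x0). Qed.

Lemma powR_ge_expR_lin x r c : 0 < x -> expR c <= x -> 0 <= r -> 1 + c * r <= x `^ r :> R.
Proof.
move=> x0 cx r0; rewrite /powR gt_eqF//.
apply: le_trans (expR_ge1Dx _) _; rewrite ler_expR mulrC ler_wpM2l//.
by rewrite -ler_expR lnK.
Qed.

(** With the next lemma, the numerical input of [powR_ge_expR_lin]: powers of 3 and of 2 grow at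
    least like 1 + r and 1 + 3 r / 5. The proof raises exp(-1/8) >= 7/8 to the eighth power. *)
Lemma expR1_le3 : expR 1 <= 3 :> R.
Proof.
have h : 7 / 8 <= expR (- (1 / 8)) :> R.
  by apply: le_trans (expR_ge1Dx _); lra.
have e : expR (- (1 / 8)) ^+ 8 = (expR 1)^-1 :> R.
  by rewrite -expRM_natl -expRN; congr expR; rewrite -mulr_natl; field.
have : (7 / 8) ^+ 8 <= (expR 1)^-1 :> R.
  by rewrite -e; apply: lerXn2r => //; rewrite nnegrE ?expR_ge0//; lra.
rewrite -[expR 1 <= 3]lef_pV2 ?posrE ?expR_gt0//.
apply: le_trans; lra.
Qed.

Lemma expR3_5_le2 : expR (3 / 5) <= 2 :> R.
Proof.
have h : 4 / 5 <= expR (- (1 / 5)) :> R.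
  by apply: le_trans (expR_ge1Dx _); lra.
have e : expR (- (1 / 5)) ^+ 3 = (expR (3 / 5))^-1 :> R.
  by rewrite -expRM_natl -expRN; congr expR; rewrite -mulr_natl; field.
have : (4 / 5) ^+ 3 <= (expR (3 / 5))^-1 :> R.
  by rewrite -e; apply: lerXn2r => //; rewrite nnegrE ?expR_ge0//; lra.
rewrite -[expR _ <= 2]lef_pV2 ?posrE ?expR_gt0//.
apply: le_trans; lra.
Qed.

(** Here s = p - 2, and 1 + s + s^2 / 2 is what is left of the exponent p r / 2 in [apriori_num]
    once (p - 1) / 2 is removed. Its three terms contribute the factors 2, 3 and 1 + s / 2. *)
Lemma apriori_large s z : 1 <= s -> 1 < z -> 2 <= z `^ s ->
  6 + 3 * s <= (1 + z) `^ (1 + s + s ^+ 2 / 2).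
Proof.
move=> s1 z1 zs.
have S0 : 0 < 1 + z by lra.
(* Since s >= 1, (1 + z)^s = (1 + z)^(s-1) + z (1 + z)^(s-1) >= 1 + z^s. *)
have w3 : 3 <= (1 + z) `^ s.
  have E : (1 + z) `^ s = (1 + z) * (1 + z) `^ (s - 1).
    by rewrite -{2}[1 + z](powRr1 (ltW S0)) -powRDp//; congr (_ `^ _); ring.
  have F : z `^ s = z * z `^ (s - 1).
    by rewrite -{2}[z]powRr1 -?powRDp; [congr (_ `^ _); ring| lra | lra].
  have h1 : 1 <= (1 + z) `^ (s - 1).
    by rewrite ge1_powR//; lra.
  have h2 : z `^ (s - 1) <= (1 + z) `^ (s - 1) by apply: ler_powR2r; lra.
  have : z * z `^ (s - 1) <= z * (1 + z) `^ (s - 1) by rewrite ler_wpM2l//; lra.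
  rewrite E mulrDl mul1r -F; lra.
have -> : 1 + s + s ^+ 2 / 2 = 1 + s + s * (s / 2) by field.
rewrite !powRDp// powRr1 ?(ltW S0)// powRrM.
have h3 : 1 + 1 * (s / 2) <= ((1 + z) `^ s) `^ (s / 2).
  by apply: powR_ge_expR_lin; [lra|apply: le_trans expR1_le3 w3|lra].
have -> : 6 + 3 * s = 2 * 3 * (1 + 1 * (s / 2)) by field.
apply: ler_pM; [lra|lra| |exact: h3].
by apply: ler_pM => //; lra.
Qed.

(** For s < 1 the bound 3 on (1 + z)^s drops to 2, but z^s >= 2 forces z >= 2^(1/s) >= 1 + 1 / s, so
    the first factor grows from 2 to 2 + 1 / s. *)
Lemma apriori_small s z : 0 < s -> s < 1 -> 1 < z -> 2 <= z `^ s ->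
  (2 + 1 / s) * 2 * (1 + 3 / 5 * (s / 2)) <= (1 + z) `^ (1 + s + s ^+ 2 / 2).
Proof.
move=> s0 s1 z1 zs.
have S0 : 0 < 1 + z by lra.
have z0 : 0 < z by lra.
have zlow : 1 + 1 / s <= z.
  have is1 : 1 <= s^-1 by rewrite invf_ge1// ltW.
  have h : 2 `^ s^-1 <= (z `^ s) `^ s^-1 by apply: ler_powR2r; lra.
  rewrite -powRrM divff ?gt_eqF// powRr1 ?(ltW z0)// in h.
  apply: le_trans h; rewrite div1r.
  have -> : 2 `^ s^-1 = 2 * 2 `^ (s^-1 - 1) :> R.
    by rewrite -{2}[2](@powRr1 R) -?powRDp//; congr (_ `^ _); ring.
  have h1 : 1 + 3 / 5 * (s^-1 - 1) <= 2 `^ (s^-1 - 1) :> R.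
    by apply: powR_ge_expR_lin; [lra|exact: expR3_5_le2|lra].
  lra.
have w2 : 2 <= (1 + z) `^ s by apply: le_trans zs _; apply: ler_powR2r; lra.
have -> : 1 + s + s ^+ 2 / 2 = 1 + s + s * (s / 2) by field.
rewrite !powRDp// powRr1 ?(ltW S0)// powRrM.
have h3 : 1 + 3 / 5 * (s / 2) <= ((1 + z) `^ s) `^ (s / 2).
  by apply: powR_ge_expR_lin; [lra|apply: le_trans expR3_5_le2 w2|lra].
have is0 : 0 < 1 / s by rewrite divr_gt0.
apply: ler_pM; [apply: mulr_ge0; lra|lra| |exact: h3].
by apply: ler_pM => //; lra.
Qed.

(* The constant 283/100 exceeds [sqrt 8], as needed to absorb [pi < 4] in the
   oscillation bound. *)
Lemma apriori_num p z (r := p - 1 + 1 / p) : 2 < p -> 1 < z -> 2 <= z `^ (p - 2) ->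
  283 / 100 * r * z `^ ((p - 1) / 2) + 1 <= (1 + z) `^ (p * r / 2).
Proof.
move=> hp z1 zs; set s := p - 2 in zs.
have s0 : 0 < s by rewrite /s; lra.
have z0 : 0 < z by lra.
have S0 : 0 < 1 + z by lra.
have p0 : p != 0 by rewrite gt_eqF//; lra.
have ip : 0 < 1 / p by rewrite divr_gt0//; lra.
have r0 : 0 <= r by rewrite /r; lra.
have key : 283 / 100 * r + 1 <= (1 + z) `^ (1 + s + s ^+ 2 / 2).
  have [s1|s1] := leP 1 s.
    apply: le_trans (apriori_large s1 z1 zs).
    have : 1 / p <= 1 / 2 by rewrite ler_pdivrMr; lra.
    rewrite /r /s; lra.
  apply: le_trans (apriori_small s0 s1 z1 zs).
  have h1 : r <= 3 / 2 + 5 / 6 * s.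
    (* The chord of the convex function 1 / p = 1 / (s + 2) between s = 0 and s = 1. *)
    have : 1 / p <= 1 / 2 - s / 6.
      rewrite ler_pdivrMr; last by lra.
      have : 0 <= s * (1 - s) by rewrite mulr_ge0//; lra.
      have e : p = s + 2 by rewrite /s; ring.
      rewrite e; clearbody s; lra.
    rewrite /r /s; lra.
  have h2 : 1 <= 1 / s by rewrite ler_pdivlMr//; lra.
  have h3 : 1 / s * s = 1 by rewrite divfK ?gt_eqF.
  have -> : (2 + 1 / s) * 2 * (1 + 3 / 5 * (s / 2)) =
    4 + 2 * (1 / s) + 6 / 5 * s + 3 / 5 * (1 / s * s) by field; rewrite gt_eqF.
  rewrite h3; lra.
have -> : p * r / 2 = (p - 1) / 2 + (1 + s + s ^+ 2 / 2) by rewrite /r /s; field.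
rewrite powRDp//.
have y1 : 1 <= z `^ ((p - 1) / 2) by rewrite ge1_powR//; lra.
have zS : z `^ ((p - 1) / 2) <= (1 + z) `^ ((p - 1) / 2) by apply: ler_powR2r; lra.
apply: le_trans (_ : z `^ ((p - 1) / 2) * (283 / 100 * r + 1) <= _).
  set y := z `^ _ in y1 *.
  by rewrite (_ : y * _ = 283 / 100 * r * y + y) ?lerD2l//; ring.
apply: ler_pM zS key; first by apply: le_trans y1.
by move: r0; clear; move: r => x x0; lra.
Qed.

Lemma bernoulli_le x a : 0 <= x -> 0 < a -> a < 1 -> (1 + x) `^ a <= 1 + a * x.
Proof.
move=> x0 a0 a1.
have b0 : 0 < 1 - a by lra.
have H := @conjugate_powR R ((1 + x) `^ a) 1 a^-1 (1 - a)^-1 (powR_ge0 _ _) ler01.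
have {}H := H ltac:(by rewrite invr_gt0) ltac:(by rewrite invr_gt0) ltac:(by rewrite !invrK; ring).
move: H; rewrite mulr1 -powRrM divff ?gt_eqF// powRr1 ?powR1 ?invrK; last by lra.
by move/le_trans; apply; lra.
Qed.

(** Bernoulli's inequality for the exponent -b, multiplied out. *)
Lemma bernoulli_neg x b : 0 <= x -> 0 <= b -> (1 + x) `^ b * (1 - b * x) <= 1.
Proof.
move=> x0 b0.
have S0 : 0 < 1 + x by lra.
apply: le_trans (_ : (1 + x) `^ b * expR (- (b * x)) <= _).
  by rewrite ler_wpM2l ?powR_ge0// expR_ge1Dx.
have -> : (1 + x) `^ b = expR (b * ln (1 + x)) by rewrite /powR gt_eqF.
rewrite -expRD; apply: le_trans (_ : expR 0 <= _); last by rewrite expR0.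
rewrite ler_expR subr_le0; apply: ler_wpM2l => //.
by apply: (@le_ln1Dx R x); lra.
Qed.

Lemma young_pow x r s : 0 <= x -> 0 < r -> r < s -> x `^ r <= r / s * x `^ s + (1 - r / s).
Proof.
move=> x0 r0 rs; have s0 : 0 < s by lra.
have t0 : 0 < r / s by rewrite divr_gt0.
have t1 : r / s < 1 by rewrite ltr_pdivrMr// mul1r.
have H := @conjugate_powR R (x `^ r) 1 (r / s)^-1 (1 - r / s)^-1 (powR_ge0 _ _) ler01.
have {}H := H ltac:(by rewrite invr_gt0) ltac:(by rewrite invr_gt0 subr_gt0) ltac:(by rewrite !invrK; ring).
move: H; rewrite mulr1 -powRrM powR1 !invrK (_ : r * (r / s)^-1 = s); last first.
  by field; rewrite !gt_eqF.
by move/le_trans; apply; rewrite mul1r mulrC.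
Qed.

Lemma apriori_final (r y t : R) : 1 < r -> 0 <= y -> 0 <= t ->
  283 / 100 * r * y <= 4 * (r * t) -> y ^+ 2 <= 2 * t ^+ 2.
Proof.
move=> r1 y0 t0 h2.
have h3 : 283 / 100 * y <= 4 * t.
  have X : r * (283 / 100 * y) <= r * (4 * t) by lra.
  by rewrite ler_pM2l in X; lra.
have h4 : (283 / 100 * y) ^+ 2 <= (4 * t) ^+ 2.
  have a0 : 0 <= 283 / 100 * y by move: y0; clear; lra.
  have b0 : 0 <= 4 * t by move: t0; clear; lra.
  exact: (lerXn2r 2 (a0 : _ \is Num.nneg) (b0 : _ \is Num.nneg) h3).
have := sqr_ge0 y; move: h4; rewrite !exprMn; move: (y ^+ 2) (t ^+ 2) => a b; lra.
Qed.

End RealInequalities.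

Section Intervals.
Context {R : realType}.
Notation mu := (@lebesgue_measure R).
Notation T := (2 * pi : R).

Definition prim (g : R -> R) (x : R) : R := \int[mu]_(t in `[0, x]) g t.

Lemma integrable_sub (g : R -> R) (x y : R) : mu.-integrable `[0, T] (EFin \o g) ->
  0 <= x -> y <= T -> mu.-integrable `[x, y] (EFin \o g).
Proof.
move=> ig x0 yT; apply: integrableS ig => //.
by apply: subset_itvScc; rewrite bnd_simp.
Qed.

Lemma primB (g : R -> R) (x y : R) : mu.-integrable `[0, T] (EFin \o g) ->
  0 <= x -> x <= y -> y <= T -> prim g y - prim g x = \int[mu]_(t in `[x, y]) g t.
Proof.
move=> ig x0 xy yT.
have ig' : mu.-integrable `[0, y] (EFin \o g) by exact: integrable_sub.
rewrite /prim Rintegral_itvB//; [|by rewrite bnd_simp..].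
rewrite Rintegral_itv_obnd_cbnd//.
apply: integrableS (integrable_sub ig x0 yT) => //.
exact: subset_itv_oc_cc.
Qed.

Lemma le_Rintegral_itv (f g : R -> R) (x y : R) :
  mu.-integrable `[x, y] (EFin \o f) -> mu.-integrable `[x, y] (EFin \o g) ->
  (forall t, f t <= g t) ->
  \int[mu]_(t in `[x, y]) f t <= \int[mu]_(t in `[x, y]) g t.
Proof. by move=> fi gi fg; apply: le_Rintegral. Qed.

Lemma Rintegral_itv_cst (c x y : R) : x <= y -> \int[mu]_(t in `[x, y]) c = c * (y - x).
Proof.
move=> xy.
have E : mu `[x, y] = (y - x)%:E.
  rewrite lebesgue_measure_itv/= lte_fin.
  by move: xy; rewrite le_eqVlt => /predU1P[->|->]; rewrite ?ltxx ?subrr// -EFinD.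
by rewrite Rintegral_cst//; congr (_ * _); exact: (congr1 fine E).
Qed.

(** Each of the two arcs joining the points carries the whole increment, so twice the increment is
    at most the total variation. This gives pi where a single arc would give 2 pi. *)
Lemma cyc_osc (U U' : R -> R) : (forall x, U (x + T) = U x) ->
  (forall x : R, is_derive x 1 U (U' x)) -> continuous U' ->
  forall x0 x1, U x1 - U x0 <= pi * cint (fun x => `|U' x|).
Proof.
move=> UT dU cU'.
have T0 : 0 < T := two_pi_gt0 R.
have cn : continuous (fun x => `|U' x|) by exact: cont_norm.
have seg x y : x <= y -> `|U y - U x| <= \int[mu]_(t in `[x, y]) `|U' t|.
  move=> xy; rewrite -(FTC_itv dU cU' xy).
  by apply: le_normr_Rintegral => //; exact: cont_integrable.
have i0 : mu.-integrable `[0, T] (EFin \o (fun x => `|U' x|)) by exact: cont_integrable.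
have segp x y : 0 <= x -> x <= y -> y <= T ->
    `|U y - U x| <= prim (fun x => `|U' x|) y - prim (fun x => `|U' x|) x.
  by move=> x0 xy yT; rewrite primB//; exact: seg.
have main x y : 0 <= x -> x <= y -> y <= T -> 2 * `|U y - U x| <= T * cint (fun x => `|U' x|).
  move=> x0 xy yT.
  have p0 : prim (fun x => `|U' x|) 0 = 0 by rewrite /prim set_itv1 Rintegral_set1.
  have -> : T * cint (fun x => `|U' x|) = prim (fun x => `|U' x|) T.
    rewrite /cint Rintegral_sigma; last exact: cont_measurable.
    by rewrite mulrA divff ?mul1r// gt_eqF.
  have h1 := segp 0 x (lexx _) x0 (le_trans xy yT).
  have h2 := segp x y x0 xy yT.
  have h3 := segp y T (le_trans x0 xy) yT (lexx _).
  have e : U T = U 0 by rewrite -(UT 0) add0r.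
  have h4 : `|U y - U x| <= `|U x - U 0| + `|U T - U y|.
    rewrite e; apply: le_trans (ler_normD _ _).
    by rewrite addrA subrK distrC.
  rewrite p0 in h1; lra.
move=> a b.
have [x /andP[x0 xT] <-] := periodic_reduce UT a.
have [y /andP[y0 yT] <-] := periodic_reduce UT b.
have : 2 * `|U y - U x| <= T * cint (fun x => `|U' x|).
  by have [xy|/ltW yx] := leP x y; [|rewrite distrC]; apply: main => //; exact: ltW.
have := ler_norm (U y - U x).
move: (U y - U x) (cint _) => c d h; rewrite -mulrA; lra.
Qed.

(** Jensen's inequality, by integrating the tangent at the mean s of g. On a grid cell the mean of
    the derivative is the discrete slope. *)
Lemma cell_convexity (p : R) (g : R -> R) (x y : R) : 1 < p -> x < y ->
  mu.-integrable `[x, y] (EFin \o g) ->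
  mu.-integrable `[x, y] (EFin \o (fun t => apow p (g t))) ->
  (y - x) * apow p ((\int[mu]_(t in `[x, y]) g t) / (y - x)) <=
  \int[mu]_(t in `[x, y]) apow p (g t).
Proof.
move=> p1 xy ig igp.
have h0 : 0 < y - x by rewrite subr_gt0.
set I := \int[mu]_(t in _) g t; set s := I / (y - x).
pose c := p * spow (p - 1) s.
have icst k : mu.-integrable `[x, y] (EFin \o (fun _ : R => k)).
  by apply: cont_integrable; exact: cont_cst.
have icg : mu.-integrable `[x, y] (EFin \o (fun t => c * g t)).
  by have := integrableZl _ c ig => /(_ (measurable_itv _)).
have E : (y - x) * apow p s = \int[mu]_(t in `[x, y]) ((apow p s - c * s) + c * g t).
  rewrite RintegralD// RintegralZl// Rintegral_itv_cst ?(ltW xy)// -/I.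
  have -> : I = s * (y - x) by rewrite /s divfK// gt_eqF.
  by ring.
rewrite E; apply: le_Rintegral_itv => //.
  by have := integrableD _ (icst (apow p s - c * s)) icg => /(_ (measurable_itv _)).
move=> t; have := tangent_apow s (g t) p1; rewrite -/c mulrBr; lra.
Qed.

Lemma energy_bound (p : R) (w g : R -> R) : 1 < p -> measurable_fun setT g ->
  (forall x, w (x + T) = w x) ->
  mu.-integrable `[0, T] (EFin \o g) ->
  mu.-integrable `[0, T] (EFin \o (fun t => apow p (g t))) ->
  (forall x y, 0 <= x -> x <= y -> y <= T -> w y - w x = \int[mu]_(t in `[x, y]) g t) ->
  forall n, genergy n p (sample w n) <= \int[sigma R]_x apow p (g x).
Proof.
move=> p1 mg wT ig igp H n.
have h0 := @hstep_gt0 R n.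
have hT : n.+1%:R * hstep n = T :> R by rewrite /hstep mulrC divfK// gt_eqF.
pose G := prim (fun t => apow p (g t)).
have cell (k : nat) : (k < n.+1)%N ->
    hstep n * apow p (slope n (sample w n) k%:Z) <= G (k.+1%:R * hstep n) - G (k%:R * hstep n).
  move=> kn.
  have x0 : 0 <= k%:R * hstep n :> R by rewrite mulr_ge0// ltW.
  have xy : k%:R * hstep n < k.+1%:R * hstep n :> R by rewrite ltr_pM2r// ltr_nat.
  have yT : k.+1%:R * hstep n <= T by rewrite -[leRHS]hT ler_pM2r// ler_nat.
  rewrite /G primB//; last exact: ltW.
  have := cell_convexity p1 xy (integrable_sub ig x0 yT) (integrable_sub igp x0 yT).
  have e : k.+1%:R * hstep n - k%:R * hstep n = hstep n :> R by rewrite -natr1; ring.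
  rewrite e -H//; last exact: ltW.
  by rewrite /slope /sample (_ : k%:Z + 1 = k.+1%:Z)//; lia.
rewrite /genergy /gmean Rintegral_sigma; last first.
  by apply: (measurableT_comp (f := apow p)) mg; apply: cont_measurable; apply: apow_continuous; lra.
have p0 : G 0 = 0 by rewrite /G /prim set_itv1 Rintegral_set1.
have S : hstep n * \sum_(k < n.+1) apow p (slope n (sample w n) k%:Z) <= G T.
  rewrite mulr_sumr; apply: le_trans (_ : \sum_(k < n.+1) (G (k.+1%:R * hstep n) - G (k%:R * hstep n)) <= _).
    by apply: ler_sum => k _; exact: cell.
  rewrite -(big_mkord xpredT (fun k => G (k.+1%:R * hstep n) - G (k%:R * hstep n))).
  have z0 : 0%:R * hstep n = 0 :> R by rewrite mul0r.
  by rewrite (telescope_sumr (fun k : nat => G (k%:R * hstep n)) (leq0n _)) hT z0 p0 subr0.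
have -> : n.+1%:R^-1 = T^-1 * hstep n :> R.
  have -> : T^-1 = n.+1%:R^-1 * (hstep n)^-1 by rewrite -invfM hT.
  by rewrite -mulrA mulVf ?mulr1// gt_eqF.
by rewrite -mulrA ler_pM2l// invr_gt0 two_pi_gt0.
Qed.

End Intervals.

Section AprioriBounds.
Context {R : realType}.
Notation mu := (@lebesgue_measure R).
Notation T := (2 * pi : R).

Lemma C1per_energy (p : R) (u v : R -> R) : 1 < p -> C1per u v ->
  forall n, genergy n p (sample u n) <= cint (fun x => apow p (v x)).
Proof.
move=> p1 [uT du cv]; apply: energy_bound => //.
- exact: cont_measurable.
- exact: cont_integrable.
- by apply: cont_integrable; apply: apow_comp_continuous => //; exact: lt_trans p1.
- by move=> x y x0 xy yT; rewrite (FTC_itv du cv).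
Qed.

Lemma basic_bound (p q : R) (u v : R -> R) : 2 < p -> p - 1 < q -> p != q -> 0 < lambda1 p ->
  C1per u v -> cint (fun x => apow q (u x)) = 1 ->
  lambda1 p * ((p - q)^-1 * (cint (fun x => apow p (u x)) `^ (2 / p) - 1)) <=
  cint (fun x => apow p (v x)) `^ (2 / p).
Proof.
move=> hp hq pq lam0 C1 Q1; have [uT du cv] := C1.
have p1 : 1 < p by lra.
have e1 : 1 `^ (- (2 / q)) = 1 :> R by rewrite powR1.
(* Generalizing the q-mean keeps it in the form required by the general inequality, applied with f
   the identity, before it is set to 1. *)
suff X Q : Q = cint (fun x => apow q (u x)) ->
    lambda1 p * id ((p - q)^-1 * (cint (fun x => apow p (u x)) `^ (2 / p) * Q `^ (- (2 / q)) - 1)) <=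
    cint (fun x => apow p (v x)) `^ (2 / p) * Q `^ (- (2 / q)).
  have Y (l a b c : R) : l * id (a * (b * 1 - 1)) <= c * 1 -> l * (a * (b - 1)) <= c.
    by rewrite !mulr1.
  by apply: Y; have := X 1 (esym Q1); rewrite e1.
move=> E; subst Q.
apply: (@rigidity_inequality R p q (lambda1 p) 1 id (fun=> 1)) => //.
- by move=> x; exact: cvg_id.
- by move=> s _; rewrite mul1r.
- exact: cont_cst.
- by move=> s; rewrite normr1.
- by move=> f g; exact: poincare.
- move=> f g A P e _ _ _ _; right; rewrite mulr1 lerDl.
  rewrite mulr_ge0 ?divr_ge0 ?powR_ge0// mulr_ge0 ?divr_ge0 ?sqr_ge0//; lra.
- exact: is_derive_continuous du.
- by apply: cint_ge0 => x; exact: apow_ge0.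
- exact: C1per_energy.
- by rewrite Q1.
Qed.

(** P^(2/p) = 1 + (p - q) e is compared with a power of the maximum M, the q-mean being 1.
    Bernoulli's inequality, for the exponent p - q < 1 or its negative counterpart, exchanges 1 + (p
    - q) e for (1 + e)^(p-q), after which p - q cancels. *)
Lemma sup_bound (p q : R) (u : R -> R) (x1 : R)
    (P := cint (fun x => apow p (u x))) (e := (p - q)^-1 * (P `^ (2 / p) - 1)) :
  2 < p -> p - 1 < q -> p != q -> continuous u -> (forall x, 0 <= u x) ->
  (forall x, u x <= u x1) -> cint (fun x => apow q (u x)) = 1 -> 0 < e ->
  (1 + e) `^ (p / 2) <= u x1.
Proof.
move=> hp hq pq cu u0 umax Q1 e0; set M := u x1.
have p0 : 0 < p by lra.
have q0 : 0 < q by lra.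
have cP : continuous (fun x => apow p (u x)) by cts.
have cQ : continuous (fun x => apow q (u x)) by cts.
have M0 : 0 < M.
  rewrite lt_def (u0 x1) andbT; apply/negP => /eqP Mz.
  have : cint (fun x => apow q (u x)) <= cint (fun=> 0 : R).
    apply: le_cint => //; first exact: cont_cst.
    move=> x; have ux : u x = 0 by apply/eqP; rewrite eq_le u0 -Mz umax.
    by rewrite ux /apow normr0 powR0// gt_eqF.
  by rewrite Q1 cint_cst ler10.
have P0 : 0 <= P by apply: cint_ge0 => x; exact: apow_ge0.
have uM (r s x : R) : 0 < r -> 0 < s -> apow (r + s) (u x) <= M `^ r * apow s (u x).
  move=> r0 s0; rewrite /apow ger0_norm//.
  have [->|ux] := eqVneq (u x) 0; first by rewrite !powR0 ?mulr0// gt_eqF// addr_gt0.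
  rewrite powRDp; last by rewrite lt_def ux u0.
  by rewrite ler_wpM2r ?powR_ge0// ler_powR2r// ?ltW.
have eP : P `^ (2 / p) = 1 + (p - q) * e.
  by rewrite /e mulrA divff ?subr_eq0// mul1r addrC subrK.
have fin (b : R) : 0 < b -> (1 + e) `^ b <= M `^ (b * (2 / p)) -> (1 + e) `^ (p / 2) <= M.
  move=> b0 h.
  have h2 : ((1 + e) `^ b) `^ (p / (2 * b)) <= (M `^ (b * (2 / p))) `^ (p / (2 * b)).
    by apply: ler_powR2r => //; [rewrite divr_ge0 ?mulr_ge0// ltW|exact: powR_ge0].
  rewrite -!powRrM in h2.
  have e1 : b * (p / (2 * b)) = p / 2 by field; rewrite gt_eqF.
  have e2 : b * (2 / p) * (p / (2 * b)) = 1 by field; rewrite !gt_eqF.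
  by rewrite e1 e2 powRr1 ?(ltW M0) in h2.
have i0 : 0 <= 2 / p by rewrite divr_ge0// ltW.
have [qp|pq'] := ltP q p.
  apply: (fin (p - q)); first by lra.
  apply: le_trans (bernoulli_le (ltW e0) _ _) _; [lra|lra|].
  rewrite -eP powRrM; apply: ler_powR2r => //.
  have : P <= cint (fun x => M `^ (p - q) * apow q (u x)).
    apply: le_cint => //; first exact: contZ.
    by move=> x; rewrite -{1}[p](subrK q); apply: uM => //; lra.
  by rewrite cintZ// Q1 mulr1.
have {}pq' : p < q by rewrite lt_def eq_sym pq.
apply: (fin (q - p)); first by lra.
have h1 : 1 <= M `^ (q - p) * P.
  rewrite -Q1 -cintZ//; apply: le_cint => //; first exact: contZ.
  by move=> x; rewrite -{1}[q](subrK p); apply: uM => //; lra.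
have h2 : 1 <= M `^ ((q - p) * (2 / p)) * P `^ (2 / p).
  apply: le_trans (_ : 1 `^ (2 / p) <= _); first by rewrite powR1.
  by rewrite powRrM -powRM ?powR_ge0//; apply: ler_powR2r.
have PP : 0 < P `^ (2 / p).
  rewrite lt_def powR_ge0 andbT; apply/negP => /eqP z.
  by move: h2; rewrite z mulr0 ler10.
have h3 := bernoulli_neg (ltW e0) (_ : 0 <= q - p).
rewrite -(ler_pM2r PP); apply: le_trans h2.
have -> : P `^ (2 / p) = 1 - (q - p) * e by rewrite eP; ring.
by apply: h3; rewrite subr_ge0 ltW.
Qed.

(* [r] is chosen such that [(r - 1) p / (p - 1) = p - 1 < q]. *)
Lemma oscillation_bound (p q : R) (u v : R -> R) (r := p - 1 + 1 / p) x1 :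
  2 < p -> p - 1 < q -> C1per u v -> (forall x, 0 <= u x) ->
  cint (fun x => apow q (u x)) = 1 ->
  u x1 `^ r - 1 <= pi * (r * cint (fun x => apow p (v x)) `^ p^-1).
Proof.
move=> hp hq [uT du cv] u0 Q1; have cu := is_derive_continuous du.
have p0 : 0 < p by lra.
have q0 : 0 < q by lra.
have p1 : 0 < p - 1 by lra.
have ip : 0 < 1 / p by rewrite divr_gt0.
have r1 : 1 < r by rewrite /r; lra.
have cQ : continuous (fun x => apow q (u x)) by cts.
have [x0 _ umin] := periodic_min cu uT.
have u1 : apow q (u x0) <= 1.
  rewrite -Q1 -[leLHS](@cint_cst R); apply: le_cint => //; first exact: cont_cst.
  move=> x; rewrite /apow !ger0_norm//; apply: ler_powR2r => //; exact: ltW.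
have u1' : u x0 <= 1.
  rewrite leNgt; apply/negP => h; move: u1; rewrite leNgt => /negP; apply.
  rewrite /apow ger0_norm//; apply: le_lt_trans (_ : 1 `^ q < _); first by rewrite powR1.
  by apply: gt0_ltr_powR; rewrite ?nnegrE.
have dU (x : R) : is_derive x 1 (fun x => apow r (u x)) (r * spow (r - 1) (u x) * v x).
  exact: (is_derive1_comp (is_derive_apow (u x) r1) (du x)).
have cs : continuous (fun x => spow (r - 1) (u x)).
  by apply: cont_comp cu; apply: spow_continuous; lra.
have cU' : continuous (fun x => r * spow (r - 1) (u x) * v x) by cts.
have osc := cyc_osc (fun x => congr1 (apow r) (uT x)) dU cU' x0 x1.
apply: le_trans (_ : apow r (u x1) - apow r (u x0) <= _).
  rewrite /apow !ger0_norm//; apply: lerB; first exact: lexx.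
  by apply: le1_powR; [rewrite u0 u1'|exact: ltW (lt_trans ltr01 r1)].
apply: le_trans osc _; rewrite ler_wpM2l ?pi_ge0//.
rewrite (_ : (fun x => `|_|) = (fun x => r * `|spow (r - 1) (u x) * v x|)); last first.
  by apply/funext => x; rewrite -mulrA normrM [`|r|]ger0_norm//; lra.
rewrite cintZ; last by apply: cont_norm; cts.
apply: ler_wpM2l; first exact: ltW (lt_trans ltr01 r1).
have s0 : 0 < p / (p - 1) by rewrite divr_gt0.
have ss : (p / (p - 1))^-1 + p^-1 = 1 by field; rewrite !gt_eqF.
apply: le_trans (cint_hoelder s0 p0 ss cs cv) _.
rewrite -[leRHS]mul1r ler_wpM2r ?powR_ge0//.
apply: le_trans (_ : 1 `^ (p / (p - 1))^-1 <= _); last by rewrite powR1.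
apply: ler_powR2r.
- by rewrite invr_ge0 ltW.
- by apply: cint_ge0 => x; exact: apow_ge0.
have cp : continuous (fun x => apow (p - 1) (u x)) by cts.
rewrite (_ : (fun x => apow _ (spow _ _)) = (fun x => apow (p - 1) (u x))); last first.
  apply/funext => x; rewrite /apow normr_spow /apow; last by lra.
  rewrite -powRrM; congr (_ `^ _); rewrite /r; field; rewrite !gt_eqF//.
(* Young's inequality bounds the mean of u^(p-1) by 1, since p - 1 < q and the q-mean is 1. *)
apply: le_trans (_ : cint (fun x => (p - 1) / q * apow q (u x) + (1 - (p - 1) / q)) <= _).
  apply: le_cint => //; first by cts.
  by move=> x; rewrite /apow !ger0_norm//; exact: young_pow.
rewrite cintD; [|by cts|exact: cont_cst].
by rewrite cintZ// Q1 cint_cst mulr1 addrC subrK.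
Qed.

(** Put z = lambda1 e. If z^(p-2) <= 2, then z^(p-1) <= 2 z and [basic_bound] concludes. Otherwise z
    > 1, and the bounds on the maximum and on the oscillation of u are combined; lambda1 <= 1 enters
    through z <= e. *)
Lemma apriori_bound (p q : R) (u v : R -> R)
    (A := cint (fun x => apow p (v x))) (P := cint (fun x => apow p (u x)))
    (e := (p - q)^-1 * (P `^ (2 / p) - 1)) : 2 < p -> p - 1 < q -> p != q -> 0 < lambda1 p ->
  C1per u v -> (forall x, 0 <= u x) -> cint (fun x => apow q (u x)) = 1 -> 0 < e ->
  (lambda1 p * e) `^ (p - 1) <= 2 * A `^ (2 / p).
Proof.
move=> hp hq pq lam0 C1 u0 Q1 e0; have [uT du cv] := C1.
have cu := is_derive_continuous du.
have zi : lambda1 p * e <= A `^ (2 / p) by exact: basic_bound.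
have lam1 := lambda1_le1 hp.
have z0 : 0 < lambda1 p * e by rewrite mulr_gt0.
have ze : lambda1 p * e <= e by rewrite ler_piMl// ltW.
set z := lambda1 p * e in zi z0 ze *.
have A0 : 0 <= A by apply: cint_ge0 => x; exact: apow_ge0.
have [z2|z2] := leP (z `^ (p - 2)) 2.
  rewrite (_ : p - 1 = (p - 2) + 1); last by ring.
  rewrite powRDp// powRr1 ?(ltW z0)//; apply: ler_pM => //; [exact: powR_ge0|exact: ltW].
have z1 : 1 < z.
  rewrite ltNge; apply/negP => z1; move: z2; rewrite ltNge => /negP; apply.
  by apply: le_trans (_ : 1 <= _); [apply: le1_powR; lra|lra].
have [x1 _ umax] := periodic_max cu uT.
have M1 := sup_bound hp hq pq cu u0 umax Q1 e0; rewrite -/P -/e in M1.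
have := oscillation_bound x1 hp hq C1 u0 Q1; rewrite -/A.
set r := p - 1 + 1 / p => osc.
have p0 : 0 < p by lra.
have ip : 0 < 1 / p by rewrite divr_gt0.
have r1 : 1 < r by rewrite /r; lra.
have num := apriori_num hp z1 (ltW z2); rewrite -/r in num.
have h1 : (1 + z) `^ (p * r / 2) <= u x1 `^ r.
  have -> : p * r / 2 = p / 2 * r by field.
  rewrite powRrM; apply: ler_powR2r; [lra|exact: powR_ge0|].
  apply: le_trans M1; apply: ler_powR2r; lra.
set y := z `^ ((p - 1) / 2) in num; set t := A `^ p^-1 in osc.
have t0 : 0 <= t by exact: powR_ge0.
have y0 : 0 <= y by exact: powR_ge0.
have pi4 : pi <= 4 :> R by have := @pihalf_lt2 R; lra.
have h2 : 283 / 100 * r * y <= 4 * (r * t).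
  have rt : 0 <= r * t by apply: (mulr_ge0 _ t0); exact: ltW (lt_trans ltr01 r1).
  have := le_trans osc (ler_wpM2r rt pi4).
  by move: num h1; clearbody y t; move: (u x1 `^ r) ((1 + z) `^ _) => a b; clear; lra.
have -> : z `^ (p - 1) = y ^+ 2.
  by rewrite -powR_mulrn ?powR_ge0// -powRrM; congr (_ `^ _); field.
have -> : A `^ (2 / p) = t ^+ 2 by rewrite powR_sqr.
exact: apriori_final r1 y0 t0 h2.
Qed.

End AprioriBounds.

(** * Weak derivatives and continuous representatives *)

Section Primitive.
Context {R : realType}.
Notation mu := (@lebesgue_measure R).
Notation T := (2 * pi : R).

Lemma Rintegral_itv_split (f : R -> R) (x y z : R) : mu.-integrable `[x, z] (EFin \o f) ->
  x <= y -> y <= z ->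
  \int[mu]_(t in `[x, z]) f t = \int[mu]_(t in `[x, y]) f t + \int[mu]_(t in `[y, z]) f t.
Proof.
move=> i xy yz.
have := @Rintegral_itvB R f (BLeft x) (BRight z) y i.
rewrite !bnd_simp => /(_ xy yz) /eqP; rewrite subr_eq addrC => /eqP ->.
congr (_ + _); rewrite Rintegral_itv_obnd_cbnd//.
apply: integrableS i => // t /=; rewrite !in_itv/= => /andP[h1 ->].
by rewrite andbT (le_trans xy)// ltW.
Qed.

Lemma increments_derive (F f : R -> R) : continuous f ->
  (forall x y, x <= y -> F y - F x = \int[mu]_(t in `[x, y]) f t) ->
  forall x : R, is_derive x 1 F (f x).
Proof.
move=> cf H x; apply: is_derive_epsP => e e0.
have /cf[d /= d0 Hd] : nbhs (f x) (ball (f x) e) by exact: nbhsx_ballx.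
exists d => // h hd.
have ci k a b : mu.-integrable `[a, b] (EFin \o (fun t => f t - k)).
  by apply: cont_integrable; apply: contB => //; exact: cont_cst.
have cc (k a b : R) : mu.-integrable `[a, b] (EFin \o (fun=> k)).
  by apply: cont_integrable; exact: cont_cst.
have seg a b : a <= b -> (forall t, a <= t <= b -> `|f t - f x| <= e) ->
    `|F b - F a - f x * (b - a)| <= e * (b - a).
  move=> ab bd; rewrite H// -(Rintegral_itv_cst (f x) ab) -RintegralB//; last first.
    exact: cont_integrable.
  apply: le_trans (_ : \int[mu]_(t in `[a, b]) `|f t - f x| <= _).
    by apply: le_normr_Rintegral => //; exact: ci.
  rewrite -(Rintegral_itv_cst _ ab); apply: le_Rintegral => //.
  - apply: cont_integrable; apply: cont_norm; apply: contB => //; exact: cont_cst.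
have nr t : `|t - x| < d -> `|f t - f x| <= e.
  by move=> td; rewrite distrC; apply/ltW/(Hd t); rewrite /= distrC.
have [h0|h0] := leP 0 h.
  have hn : `|h| = h by exact: ger0_norm.
  rewrite hn in hd *.
  have e1 : x + h - x = h by rewrite addrAC subrr add0r.
  have := seg x (x + h); rewrite e1 lerDl => /(_ h0); apply.
  move=> t /andP[t1 t2]; apply: nr; rewrite ger0_norm ?subr_ge0//.
  by apply: le_lt_trans hd; rewrite lerBlDl.
have hn : `|h| = - h by exact: ltr0_norm.
rewrite hn in hd *.
have e1 : x - (x + h) = - h by rewrite opprD addrA subrr add0r.
have := seg (x + h) x; rewrite e1 gerDl => /(_ (ltW h0)).
rewrite (_ : F (x + h) - F x - f x * h = - (F x - F (x + h) - f x * - h)); last by ring.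
rewrite (normrN (F x - _ - _)); apply => t /andP[t1 t2]; apply: nr; rewrite ler0_norm ?subr_le0// opprB.
by apply: le_lt_trans hd; rewrite lerBlDr addrC -lerBlDr opprK.
Qed.

Lemma primitive_exists (f : R -> R) : continuous f ->
  exists2 F : R -> R, F 0 = 0 & forall x : R, is_derive x 1 F (f x).
Proof.
move=> cf; have ci := fun a b => @cont_integrable R f a b cf.
pose I x y := \int[mu]_(t in `[x, y]) f t.
have I0 x y : y <= x -> I x y = 0.
  rewrite le_eqVlt => /predU1P[->|yx]; first by rewrite /I set_itv1 Rintegral_set1.
  by rewrite /I set_itv_ge ?Rintegral_set0// -leNgt bnd_simp.
(* The integral over [x, y] is 0 when y <= x, so at most one term is nonzero and the difference is
   the signed primitive on the whole line. *)
exists (fun x => I 0 x - I x 0); first by rewrite !I0 ?subrr.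
apply: increments_derive => // x y xy.
rewrite -/(I x y).
have spl a b c : a <= b -> b <= c -> I a c = I a b + I b c by move=> *; exact: Rintegral_itv_split.
have [x0|x0] := leP 0 x.
  rewrite (I0 x 0)// (I0 y 0) ?(le_trans x0)// (spl 0 x y)//; ring.
have [y0|y0] := leP 0 y.
  rewrite (I0 0 x) ?(ltW x0)// (I0 y 0)// (spl x 0 y) ?(ltW x0)//; ring.
rewrite (I0 0 x) ?(ltW x0)// (I0 0 y) ?(ltW y0)// (spl x y 0) ?(ltW y0)//; ring.
Qed.

Lemma bounded_convergence (D : set R) (g f : R -> R) (fn : nat -> R -> R) (C : R) :
  measurable D -> mu.-integrable D (EFin \o g) -> (forall n, measurable_fun D (fn n)) ->
  measurable_fun D f ->
  (forall n x, D x -> `|fn n x| <= C) -> 0 <= C -> (forall x, D x -> fn ^~ x @ \oo --> f x) ->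
  (fun n => \int[mu]_(x in D) (g x * fn n x)) @ \oo --> \int[mu]_(x in D) (g x * f x).
Proof.
move=> mD ig mfn mf bf C0 cf.
have mg : measurable_fun D g by apply/measurable_EFinP; exact: measurable_int ig.
have [] := @dominated_convergence _ _ _ mu D mD
  (fun n x => (g x * fn n x)%:E) (fun x => (g x * f x)%:E) (fun x => (C * `|g x|)%:E).
- by move=> n; apply/measurable_EFinP; exact: (measurable_funM mg (mfn n)).
- by apply/measurable_EFinP; exact: (measurable_funM mg mf).
- apply: aeW => x Dx; apply/fine_cvgP; split; first exact: nearW.
  exact: (cvgM (cvg_cst (g x)) (cf x Dx)).
- by have := integrableZl _ C (integrable_norm ig) => /(_ mD).
- apply: aeW => x n Dx; rewrite /= lee_fin normrM mulrC.
  by rewrite ler_wpM2r// bf.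
move=> H1 _ H3.
have F1 : (\int[mu]_(x in D) (g x * f x)%:E)%E \is a fin_num by exact: integrable_fin_num.
by rewrite -(fineK F1) in H3; exact: fine_cvg H3.
Qed.

End Primitive.

Section SmoothClosure.
Context {R : realType}.

(** Smooth test functions require all iterated derivatives; stability of a class under one
    derivative provides them by induction, without formulas. *)
Lemma closed_smooth (S : (R -> R) -> Prop) :
  (forall f, S f -> exists2 g, S g & forall x : R, is_derive x 1 f (g x)) ->
  forall f, S f -> forall n (x : R), derivable (derive1n n f) x 1.
Proof.
move=> H f Sf n.
have : S (derive1n n f).
  elim: n => [//|n Sn]; have [g Sg dg] := H _ Sn.
  rewrite derive1nS (_ : derive1 _ = g)//; apply/funext => x.
  by rewrite derive1E; exact: derive_val.
by move=> /H[g _ dg] x; exact: ex_derive.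
Qed.

(** An algebra containing the logistic windows used as mollified indicators. It is stable under
    differentiation because a logistic w = 1 / (1 + exp y) satisfies w' = - y' w (1 - w). *)
Inductive circle_class (a k : R) : (R -> R) -> Prop :=
| circle_class_cst c : circle_class a k (fun=> c)
| circle_class_sin b s : circle_class a k (fun x => sin (b * x + s))
| circle_class_cos b s : circle_class a k (fun x => cos (b * x + s))
| circle_class_win : circle_class a k (fun x => (1 + expR (k * (sin (2^-1 * x) * sin (2^-1 * x + - (a / 2)))))^-1)
| circle_class_add f g : circle_class a k f -> circle_class a k g -> circle_class a k (fun x => f x + g x)
| circle_class_mul f g : circle_class a k f -> circle_class a k g -> circle_class a k (fun x => f x * g x).

Lemma is_derive_affine (b s x : R) : is_derive x 1 (fun x : R => b * x + s) b.
Proof.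
have H := is_deriveD (is_deriveZ b (is_derive_id x 1)) (is_derive_cst s x 1).
by move: H; rewrite /GRing.scale /= mulr1 addr0.
Qed.

Lemma circle_class_derive (a k : R) f : circle_class a k f -> exists2 g, circle_class a k g & forall x : R, is_derive x 1 f (g x).
Proof.
elim=> {f} [c|b s|b s||f g Sf [f' Sf' df] Sg [g' Sg' dg]|f g Sf [f' Sf' df] Sg [g' Sg' dg]].
- by exists (fun=> 0); [exact: circle_class_cst|move=> x; exact: is_derive_cst].
- exists (fun x => cos (b * x + s) * b).
    by apply: circle_class_mul; [exact: circle_class_cos|exact: circle_class_cst].
  by move=> x; exact: (is_derive1_comp (is_derive_sin _) (is_derive_affine b s x)).
- exists (fun x => (-1) * sin (b * x + s) * b).
    by apply: circle_class_mul; [apply: circle_class_mul; [exact: circle_class_cst|exact: circle_class_sin]|exact: circle_class_cst].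
  move=> x; rewrite mulN1r.
  exact: (is_derive1_comp (is_derive_cos _) (is_derive_affine b s x)).
- pose w x := (1 + expR (k * (sin (2^-1 * x) * sin (2^-1 * x + - (a / 2)))))^-1.
  pose q' x := sin (2^-1 * x) * (cos (2^-1 * x + - (a / 2)) * 2^-1) +
    sin (2^-1 * x + - (a / 2)) * (cos (2^-1 * x) * 2^-1).
  exists (fun x => (- k) * ((sin (2^-1 * x + 0) * (cos (2^-1 * x + - (a / 2)) * 2^-1) +
    sin (2^-1 * x + - (a / 2)) * (cos (2^-1 * x + 0) * 2^-1)) * (w x * (1 + (-1) * w x)))).
    apply: circle_class_mul; first exact: circle_class_cst.
    apply: circle_class_mul.
      apply: circle_class_add; apply: circle_class_mul; first exact: circle_class_sin.
      - by apply: circle_class_mul; [exact: circle_class_cos|exact: circle_class_cst].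
      - exact: circle_class_sin.
      - by apply: circle_class_mul; [exact: circle_class_cos|exact: circle_class_cst].
    apply: circle_class_mul; first exact: circle_class_win.
    apply: circle_class_add; first exact: circle_class_cst.
    by apply: circle_class_mul; [exact: circle_class_cst|exact: circle_class_win].
  move=> x; rewrite !addr0.
  have ds : is_derive x 1 (fun x => sin (2^-1 * x)) (cos (2^-1 * x) * 2^-1).
    have := is_derive1_comp (is_derive_sin _) (is_derive_affine 2^-1 0 x).
    by rewrite (_ : _ \o _ = fun x => sin (2^-1 * x)) ?addr0//; apply/funext => y /=; rewrite addr0.
  have ds2 : is_derive x 1 (fun x => sin (2^-1 * x + - (a / 2))) (cos (2^-1 * x + - (a / 2)) * 2^-1).
    exact: (is_derive1_comp (is_derive_sin _) (is_derive_affine 2^-1 (- (a / 2)) x)).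
  have dq : is_derive x 1 (fun x => k * (sin (2^-1 * x) * sin (2^-1 * x + - (a / 2)))) (k * q' x).
    exact: (is_deriveZ k (is_deriveM ds ds2)).
  have dE := is_derive1_comp (is_derive_expR _) dq.
  have dD := is_deriveD (is_derive_cst (1 : R) x 1) dE.
  set E := expR _ in dE dD.
  have E0 : 0 < E by exact: expR_gt0.
  have n0 : 1 + E != 0 by rewrite gt_eqF// addr_gt0.
  have := is_deriveV (f := fun x => 1 + expR (k * (sin (2^-1 * x) * sin (2^-1 * x + - (a / 2))))) n0 dD.
  have wE : w x = (1 + E)^-1 by [].
  rewrite /GRing.scale /= add0r => H.
  have -> : - k * ((sin (2^-1 * x) * (cos (2^-1 * x + - (a / 2)) * 2^-1) +
    sin (2^-1 * x + - (a / 2)) * (cos (2^-1 * x) * 2^-1)) * (w x * (1 + (-1) * w x))) =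
    - (1 + E) ^- 2 * (E * (k * q' x)).
    by rewrite wE /q'; field.
  exact: H.
- by exists (fun x => f' x + g' x); [exact: circle_class_add|move=> x; exact: is_deriveD].
- exists (fun x => f x * g' x + g x * f' x).
    by apply: circle_class_add; apply: circle_class_mul.
  by move=> x; exact: (is_deriveM (df x) (dg x)).
Qed.

End SmoothClosure.

Section Window.
Context {R : realType}.
Notation mu := (@lebesgue_measure R).
Notation T := (2 * pi : R).

Lemma Rintegral_itv_oo_cc (f : R -> R) (x y : R) : mu.-integrable `[x, y] (EFin \o f) ->
  \int[mu]_(t in `[x, y]) f t = \int[mu]_(t in `]x, y[) f t.
Proof.
move=> i; rewrite -Rintegral_itv_obnd_cbnd; last first.
  by apply: integrableS i => //; exact: subset_itv_oc_cc.
rewrite -Rintegral_itv_bndo_bndc//.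
by apply: integrableS i => //; exact: subset_itv_oo_cc.
Qed.

Lemma segment_conv (g : R -> R) (h : nat -> R -> R) (x y c : R) :
  mu.-integrable `[x, y] (EFin \o g) -> (forall n, continuous (h n)) ->
  (forall n t, 0 <= h n t <= 1) -> (forall t, x < t < y -> h ^~ t @ \oo --> c) ->
  (fun n => \int[mu]_(t in `[x, y]) (g t * h n t)) @ \oo --> c * \int[mu]_(t in `[x, y]) g t.
Proof.
move=> ig ch h01 hc.
have mg : measurable_fun `[x, y] g by apply/measurable_EFinP; exact: measurable_int ig.
have igh n : mu.-integrable `[x, y] (EFin \o (fun t => g t * h n t)).
  apply: (le_integrable _ _ _ ig) => //.
    by apply/measurable_EFinP; apply: measurable_funM => //; apply: measurable_funTS; exact: cont_measurable.
  move=> t _; rewrite /= lee_fin normrM; have /andP[h0 h1] := h01 n t.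
  by rewrite (ger0_norm h0) ler_piMr.
have igo : mu.-integrable `]x, y[ (EFin \o g).
  by apply: integrableS ig => //; exact: subset_itv_oo_cc.
have -> : c * \int[mu]_(t in `[x, y]) g t = \int[mu]_(t in `]x, y[) (g t * c).
  by rewrite (Rintegral_itv_oo_cc ig) RintegralZr// mulrC.
rewrite (_ : (fun n => _) = (fun n => \int[mu]_(t in `]x, y[) (g t * h n t))); last first.
  by apply/funext => n; rewrite Rintegral_itv_oo_cc.
apply: (@bounded_convergence R _ g (fun=> c) h 1) => //.
- by move=> n; apply: measurable_funTS; exact: cont_measurable.
- by move=> n t _; have /andP[h0 h1] := h01 n t; rewrite ger0_norm.
Qed.

Lemma logistic_cvg0 (k : R) : 0 < k -> (fun n : nat => (1 + expR (n%:R * k))^-1) @ \oo --> (0 : R).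
Proof.
move=> k0; pose c := Num.min k 1.
have c0 : 0 < c by rewrite lt_min k0 ltr01.
apply: (@squeeze_cvgr _ _ _ _ (fun=> 0) (fun n => c^-1 * n.+1%:R^-1)).
- apply: nearW => n; have E0 := expR_gt0 (n%:R * k).
  have S0 : 0 < 1 + expR (n%:R * k) by rewrite addr_gt0.
  rewrite invr_ge0 ltW//= -invfM lef_pV2 ?posrE ?mulr_gt0//.
  rewrite -natr1 mulrDr mulr1 addrC lerD//; first by rewrite ge_min lexx orbT.
  apply: le_trans (expR_ge1Dx _); rewrite ler_wpDl// mulrC ler_wpM2l//.
  by rewrite ge_min lexx.
- exact: cvg_cst.
- rewrite -[0 in X in _ --> X](mulr0 c^-1); apply: cvgM; first exact: cvg_cst.
  exact: cvg_harmonic.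
Qed.

Lemma logistic_cvg1 (k : R) : k < 0 -> (fun n : nat => (1 + expR (n%:R * k))^-1) @ \oo --> (1 : R).
Proof.
move=> k0; rewrite (_ : (fun n => _) = (fun n : nat => 1 - (1 + expR (n%:R * - k))^-1)); last first.
  apply/funext => n; rewrite mulrN expRN.
  by have E0 := expR_gt0 (n%:R * k); field; rewrite !gt_eqF// addr_gt0.
rewrite -[1 in X in _ --> X]subr0; apply: cvgB; first exact: cvg_cst.
by apply: logistic_cvg0; rewrite oppr_gt0.
Qed.

(* As [n] grows this smooth function converges to the indicator of [0, a]: the
   product of sines is negative on ]0, a[ and positive on ]a, 2 pi[. *)
Definition window (a : R) (n : nat) (x : R) : R :=
  (1 + expR (n%:R * (sin (2^-1 * x) * sin (2^-1 * x + - (a / 2)))))^-1.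

Lemma window_continuous a n : continuous (window a n).
Proof.
have [g _ dg] := circle_class_derive (circle_class_win a n%:R).
exact: is_derive_continuous dg.
Qed.

Lemma window01 a n x : 0 <= window a n x <= 1.
Proof.
have E0 := expR_gt0 (n%:R * (sin (2^-1 * x) * sin (2^-1 * x + - (a / 2)))).
rewrite /window invr_ge0 ltW ?addr_gt0//= invf_le1 ?addr_gt0//.
by rewrite lerDl ltW.
Qed.

Lemma window_per a n x : window a n (x + T) = window a n x.
Proof.
have s y : sin (y + pi) = - sin y :> R by exact: sinDpi.
rewrite /window (_ : 2^-1 * (x + T) = 2^-1 * x + pi); last by field.
by rewrite s addrAC s mulrNN.
Qed.

Lemma window_cvg1 a x : 0 < a < T -> 0 < x < a -> (fun n => window a n x) @ \oo --> (1 : R).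
Proof.
move=> /andP[a0 aT] /andP[x0 xa]; apply: logistic_cvg1.
have s1 : 0 < sin (2^-1 * x) by apply: sin_gt0_pi; move: x0 xa aT; lra.
have s2 : 0 < sin (- (2^-1 * x + - (a / 2))) by apply: sin_gt0_pi; move: x0 xa aT; lra.
by rewrite sinN oppr_gt0 in s2; rewrite pmulr_rlt0.
Qed.

Lemma window_cvg0 a x : 0 < a < T -> a < x < T -> (fun n => window a n x) @ \oo --> (0 : R).
Proof.
move=> /andP[a0 aT] /andP[xa xT]; apply: logistic_cvg0; apply: mulr_gt0.
  by apply: sin_gt0_pi; move: a0 xa xT; lra.
by apply: sin_gt0_pi; move: a0 xa xT; lra.
Qed.

Lemma window_integral (g : R -> R) (a b : R) : 0 < a < T -> 0 <= b <= T ->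
  mu.-integrable `[0, T] (EFin \o g) ->
  (fun n => \int[mu]_(t in `[0, b]) (g t * window a n t)) @ \oo --> prim g (Num.min b a).
Proof.
move=> /[dup] aT /andP[a0 aT'] /andP[b0 bT] ig.
have [ba|ab] := leP b a.
  rewrite -[prim g b]mul1r; apply: segment_conv.
  - exact: (integrable_sub ig).
  - exact: window_continuous.
  - exact: window01.
  - move=> t /andP[t0 tb]; apply: window_cvg1 => //.
    by rewrite t0 (lt_le_trans tb).
have igw n : mu.-integrable `[0, T] (EFin \o (fun t => g t * window a n t)).
  apply: (le_integrable _ _ _ ig) => //.
    apply/measurable_EFinP; apply: measurable_funM.
      by apply/measurable_EFinP; exact: measurable_int ig.
    by apply: measurable_funTS; apply: cont_measurable; exact: window_continuous.
  move=> t _; rewrite /= lee_fin normrM; have /andP[h0 h1] := window01 a n t.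
  by rewrite (ger0_norm h0) ler_piMr.
rewrite (_ : (fun n => _) = (fun n => \int[mu]_(t in `[0, a]) (g t * window a n t) +
    \int[mu]_(t in `[a, b]) (g t * window a n t))); last first.
  apply/funext => n; apply: Rintegral_itv_split; [exact: (integrable_sub (igw n))|exact: ltW|exact: ltW].
have c1 : (fun n => \int[mu]_(t in `[0, a]) (g t * window a n t)) @ \oo --> 1 * prim g a.
  apply: segment_conv; [exact: (integrable_sub ig _ (ltW aT'))|exact: window_continuous|exact: window01|].
  by move=> t ta; exact: window_cvg1.
have c2 : (fun n => \int[mu]_(t in `[a, b]) (g t * window a n t)) @ \oo --> 0 * \int[mu]_(t in `[a, b]) g t.
  apply: segment_conv; [exact: (integrable_sub ig (ltW a0))|exact: window_continuous|exact: window01|].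
  by move=> t /andP[ta tb]; apply: window_cvg0 => //; rewrite ta (lt_le_trans tb).
have -> : prim g a = 1 * prim g a + 0 * \int[mu]_(t in `[a, b]) g t by ring.
exact: (cvgD c1 c2).
Qed.

(** The weak derivative is tested with the primitive of a window minus its mean, which is periodic
    and smooth. In the limit the test function becomes the tent min(t, a) - t a / (2 pi), and its
    derivative becomes the indicator of [0, a] minus its mean. *)
Lemma window_test (u g : R -> R) (a : R) : 0 < a < T ->
  measurable_fun setT u -> measurable_fun setT g ->
  mu.-integrable `[0, T] (EFin \o u) -> mu.-integrable `[0, T] (EFin \o g) ->
  weak_derivative u g ->
  prim u a - a / T * prim u T = - \int[mu]_(t in `[0, T]) (g t * (Num.min t a - t * (a / T))).
Proof.
move=> aT mu_ mg iu ig W; have T0 : 0 < T := two_pi_gt0 R.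
have [a0 aT'] := andP aT.
pose m n := T^-1 * \int[mu]_(t in `[0, T]) window a n t.
have ci n : mu.-integrable `[0, T] (EFin \o window a n).
  by apply: cont_integrable; exact: window_continuous.
have i1 : mu.-integrable `[0, T] (EFin \o (fun=> 1 : R)).
  by apply: cont_integrable; exact: cont_cst.
have prim1 (b : R) : 0 <= b -> prim (fun=> 1) b = b.
  by move=> b0; rewrite /prim Rintegral_itv_cst// mul1r subr0.
have cw b : 0 <= b <= T -> (fun n => \int[mu]_(t in `[0, b]) window a n t) @ \oo --> Num.min b a.
  move=> bT; have := window_integral aT bT i1; rewrite prim1; last first.
    by rewrite le_min (ltW a0) andbT; case/andP: bT.
  by under eq_fun do under eq_Rintegral do rewrite mul1r.
have cm : m @ \oo --> T^-1 * a.
  apply: cvgM; first exact: cvg_cst.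
  have TT : 0 <= T <= T by rewrite lexx ltW.
  by have := cw T TT; rewrite (min_idPr (ltW aT')).
have cont_wm n : continuous (fun t => window a n t - m n).
  by apply: contB; [exact: window_continuous|exact: cont_cst].
have ex n : exists F : R -> R, F 0 = 0 /\ forall x : R, is_derive x 1 F (window a n x - m n).
  by have [F F0 dF] := primitive_exists (cont_wm n); exists F.
have [F HF] := choice ex.
have FE n b : 0 <= b -> F n b = \int[mu]_(t in `[0, b]) window a n t - m n * b.
  move=> b0; have [F0 dF] := HF n.
  have := FTC_itv dF (cont_wm n) b0; rewrite F0 subr0 => <-.
  rewrite RintegralB//; last 2 first.
  - by apply: cont_integrable; exact: window_continuous.
  - by apply: cont_integrable; exact: cont_cst.
  by rewrite Rintegral_itv_cst// subr0.
have FT n : F n T = 0.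
  by rewrite FE ?ltW// /m mulrAC mulVf ?mul1r ?subrr// gt_eqF.
have Fper n x : F n (x + T) = F n x.
  have [F0 dF] := HF n.
  have H : forall x : R, is_derive x 1 (fun x => F n (1 * x + T) - F n x) 0.
    move=> y; have d1 := is_derive1_comp (dF _) (is_derive_affine 1 T y).
    have := is_deriveB d1 (dF y).
    by rewrite mulr1 mul1r window_per subrr.
  have := is_derive0_cst H x 0; rewrite !mul1r add0r FT F0 subrr => /eqP.
  by rewrite subr_eq0 => /eqP.
have sF n : smooth_periodic (F n).
  split; first exact: Fper.
  (* The primitive is added to the class by hand, as it is not given by a formula; its derivative
     does lie in the class. *)
  apply: (@closed_smooth _ (fun f => circle_class a n%:R f \/ f = F n)); last by right.
  move=> f [Sf|->].
    by have [f' Sf' df] := circle_class_derive Sf; exists f' => //; left.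
  exists (fun t => window a n t - m n); last by have [] := HF n.
  by left; apply: circle_class_add; [exact: circle_class_win|exact: circle_class_cst].
have dF1 n : derive1 (F n) = fun t => window a n t - m n.
  apply/funext => x; rewrite derive1E; have [_ dF] := HF n.
  by have dFx := dF x; rewrite derive_val.
have cF n : continuous (F n) by have [_ dF] := HF n; exact: is_derive_continuous dF.
have iuw n : mu.-integrable `[0, T] (EFin \o (fun t => u t * window a n t)).
  apply: (le_integrable _ _ _ iu) => //.
    apply/measurable_EFinP; apply: measurable_funTS; apply: measurable_funM => //.
    by apply: cont_measurable; exact: window_continuous.
  move=> t _; rewrite /= lee_fin normrM; have /andP[h0 h1] := window01 a n t.
  by rewrite (ger0_norm h0) ler_piMr.
have key n : \int[mu]_(t in `[0, T]) (u t * window a n t) - m n * prim u T =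
    - \int[mu]_(t in `[0, T]) (g t * F n t).
  have := W _ (sF n); rewrite dF1 !Rintegral_sigma; last 2 first.
  - by apply: measurable_funM => //; exact: cont_measurable.
  - by apply: measurable_funM => //; exact: cont_measurable.
  have Y (c x y : R) : c != 0 -> c * x = - (c * y) -> x = - y.
    by move=> c0 E; apply: (mulfI c0); rewrite mulrN.
  move=> /(Y _ _ _ (invr_neq0 (lt0r_neq0 T0))) <-.
  rewrite (_ : (fun t => u t * (window a n t - m n)) = (fun t => u t * window a n t - m n * u t)); last first.
    by apply/funext => t; ring.
  rewrite RintegralB ?RintegralZl//.
  by have := integrableZl _ (m n) iu => /(_ (measurable_itv _)).
have L : (fun n => \int[mu]_(t in `[0, T]) (u t * window a n t) - m n * prim u T) @ \oo -->
    prim u a - T^-1 * a * prim u T.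
  apply: cvgB; last by apply: cvgM => //; exact: cvg_cst.
  have TT : 0 <= T <= T by rewrite lexx ltW.
  by have := window_integral aT TT iu; rewrite (min_idPr (ltW aT')).
have Rr : (fun n => - \int[mu]_(t in `[0, T]) (g t * F n t)) @ \oo -->
    - \int[mu]_(t in `[0, T]) (g t * (Num.min t a - t * (a / T))).
  apply: cvgN; apply: (@bounded_convergence R _ g _ F (2 * T)) => //.
  - by move=> n; apply: measurable_funTS; exact: cont_measurable.
  - apply: measurable_funTS; apply: measurable_funB.
      by apply: measurable_minr => //; exact: measurable_cst.
    by apply: measurable_funM => //; exact: measurable_cst.
  - move=> n x /=; rewrite in_itv/= => /andP[x0 xT].
    have bd b : 0 <= b -> b <= T -> 0 <= \int[mu]_(t in `[0, b]) window a n t <= b.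
      move=> b0 bT; apply/andP; split.
        by apply: Rintegral_ge0 => t _; have /andP[] := window01 a n t.
      rewrite -[leRHS]subr0 -[leRHS]mul1r -(Rintegral_itv_cst 1 b0).
      apply: le_Rintegral => //.
      - by apply: cont_integrable; exact: window_continuous.
      - by apply: cont_integrable; exact: cont_cst.
      - by move=> t _; have /andP[] := window01 a n t.
    rewrite FE//; have /andP[h1 h2] := bd x x0 xT.
    have /andP[h3 h4] := bd T (ltW T0) (lexx _).
    have m0 : 0 <= m n by rewrite mulr_ge0// invr_ge0 ltW.
    have m1 : m n <= 1 by rewrite /m ler_pdivrMl// mulr1.
    apply: le_trans (ler_normB _ _) _; rewrite (ger0_norm h1) (ger0_norm (mulr_ge0 m0 x0)).
    have : m n * x <= x by rewrite ler_piMl.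
    by move: h2 xT; move: (m n * x) (Rintegral _ _ _) => y z; clear; lra.
  - by rewrite mulr_ge0// ltW.
  - move=> x /=; rewrite in_itv/= => /andP[x0 xT].
    rewrite (_ : (fun n => F n x) = (fun n => \int[mu]_(t in `[0, x]) window a n t - m n * x)); last first.
      by apply/funext => n; rewrite FE.
    apply: cvgB; first by apply: cw; rewrite x0.
    rewrite mulrC [a / T]mulrC; apply: cvgM => //; exact: cvg_cst.
rewrite (_ : (fun n => _) = (fun n => - \int[mu]_(t in `[0, T]) (g t * F n t))) in L; last first.
  by apply/funext => n; exact: key.
rewrite (mulrC T^-1 a) in L.
exact: (cvg_unique (@Rhausdorff R) L Rr).
Qed.

End Window.

Section Representative.
Context {R : realType}.
Notation mu := (@lebesgue_measure R).
Notation T := (2 * pi : R).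

Lemma integrable_mul_bounded (g k : R -> R) (C : R) : measurable_fun setT g ->
  mu.-integrable `[0, T] (EFin \o g) -> measurable_fun setT k ->
  (forall t, 0 <= t <= T -> `|k t| <= C) -> 0 <= C ->
  mu.-integrable `[0, T] (EFin \o (fun t => g t * k t)).
Proof.
move=> mg ig mk kC C0.
have igC : mu.-integrable `[0, T] (EFin \o (fun t => C * g t)).
  by have := integrableZl _ C ig => /(_ (measurable_itv _)).
apply: (le_integrable _ _ _ igC) => //.
  by apply/measurable_EFinP; apply: measurable_funTS; exact: measurable_funM.
move=> t /=; rewrite in_itv/= => tT; rewrite lee_fin !normrM mulrC (ger0_norm C0).
by rewrite ler_wpM2r// kC.
Qed.

(** The derivative of min(t, b) in b is the indicator of t > b, which leaves the integral of g over
    [a, 2 pi]. The error is h times an increment of the primitive of |g|, which is continuous. *)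
Lemma clamp_primitive_derive (g : R -> R) (a : R) : 0 < a < T ->
  measurable_fun setT g -> mu.-integrable `[0, T] (EFin \o g) ->
  is_derive a 1 (fun b => \int[mu]_(t in `[0, T]) (g t * Num.min t b))
    (prim g T - prim g a).
Proof.
move=> /andP[a0 aT] mg ig.
have T0 : 0 < T := two_pi_gt0 R.
have ig1 : mu.-integrable `[0, T] (EFin \o (fun t => `|g t|)).
  exact: integrable_norm ig.
have igM := fun k C => @integrable_mul_bounded g k C mg ig.
have mid : measurable_fun setT (fun t : R => t) by exact: measurable_id.
have igx : mu.-integrable `[0, T] (EFin \o (fun t => g t * t)).
  apply: (igM _ T) => //; last exact: ltW.
  by move=> t /andP[t0 tT]; rewrite ger0_norm.
have min_split b : 0 <= b <= T -> \int[mu]_(t in `[0, T]) (g t * Num.min t b) =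
    prim (fun t => g t * t) b + b * (prim g T - prim g b).
  move=> /andP[b0 bT].
  have igm : mu.-integrable `[0, T] (EFin \o (fun t => g t * Num.min t b)).
    apply: (igM _ T); last exact: ltW.
      by apply: measurable_minr => //; exact: measurable_cst.
    move=> t /andP[t0 tT]; rewrite ger0_norm ?le_min ?t0//.
    by rewrite ge_min tT.
  rewrite (Rintegral_itv_split igm b0 bT) primB//; congr (_ + _).
    by apply: eq_Rintegral => t; rewrite inE/= in_itv/= => /andP[_ tb]; rewrite (min_idPl tb).
  rewrite -RintegralZl//; last exact: (integrable_sub ig b0).
  by apply: eq_Rintegral => t; rewrite inE/= in_itv/= => /andP[tb _]; rewrite (min_idPr tb) mulrC.
have step b c : 0 <= b -> b <= c -> c <= T ->
    `|prim (fun t => g t * t) c + c * (prim g T - prim g c) -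
      (prim (fun t => g t * t) b + b * (prim g T - prim g b)) - (c - b) * (prim g T - prim g b)| <=
    (c - b) * (prim (fun t => `|g t|) c - prim (fun t => `|g t|) b).
  move=> b0 bc cT.
  have -> : prim (fun t => g t * t) c + c * (prim g T - prim g c) -
      (prim (fun t => g t * t) b + b * (prim g T - prim g b)) - (c - b) * (prim g T - prim g b) =
      (prim (fun t => g t * t) c - prim (fun t => g t * t) b) - c * (prim g c - prim g b) by ring.
  rewrite (primB igx b0 bc cT) (primB ig b0 bc cT) (primB ig1 b0 bc cT) -RintegralZl//; last exact: (integrable_sub ig b0).
  have icg : mu.-integrable `[b, c] (EFin \o (fun t => c * g t)).
    by have := integrableZl _ c (integrable_sub ig b0 cT) => /(_ (measurable_itv _)).
  rewrite -RintegralB//; last exact: (integrable_sub igx b0).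
  have iB : mu.-integrable `[b, c] (EFin \o (fun t => g t * t - c * g t)).
    by have := integrableB _ (integrable_sub igx b0 cT) icg => /(_ (measurable_itv _)).
  apply: le_trans (le_normr_Rintegral _ iB) _ => //.
  rewrite -RintegralZl//; last exact: (integrable_sub ig1 b0).
  apply: le_Rintegral => //.
  - exact: integrable_norm iB.
  - by have := integrableZl _ (c - b) (integrable_sub ig1 b0 cT) => /(_ (measurable_itv _)).
  - move=> t /=; rewrite in_itv/= => /andP[tb tc].
    rewrite mulrC -mulrBl normrM ler_wpM2r// ler0_norm ?subr_le0// opprB.
    by rewrite lerB.
have cG : {for a, continuous (prim (fun t => `|g t|))}.
  have := parameterized_integral_continuous (ltW T0) ig1.
  move=> /(continuous_within_itvP _ T0)[+ _ _]; apply.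
  by rewrite in_itv/= a0.
apply: is_derive_epsP => e e0.
have e2 : 0 < e / 2 by rewrite divr_gt0.
have /cG[d /= d0 Hd] : nbhs (prim (fun t => `|g t|) a) (ball (prim (fun t => `|g t|) a) (e / 2)).
  exact: nbhsx_ballx.
exists (Num.min d (Num.min a (T - a))); first by rewrite !lt_min d0 a0 subr_gt0.
move=> h; rewrite !lt_min => /and3P[hd ha hT].
have HG : `|prim (fun t => `|g t|) (a + h) - prim (fun t => `|g t|) a| < e / 2.
  have := Hd (a + h); rewrite /ball /= opprD addNKr normrN => /(_ hd).
  by rewrite distrC.
have a1 : 0 <= a + h by move: (ler_norm (- h)); rewrite normrN; lra.
have a2 : a + h <= T by move: (ler_norm h); lra.
rewrite !min_split; [|by rewrite (ltW a0) ltW|by rewrite a1].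
have Gle b c : 0 <= b -> b <= c -> c <= T -> `|prim g c - prim g b| <= prim (fun t => `|g t|) c - prim (fun t => `|g t|) b.
  move=> b0 bc cT; rewrite !primB//; apply: le_normr_Rintegral => //; exact: (integrable_sub ig b0).
have [h0|h0] := leP 0 h.
  have hn : `|h| = h by exact: ger0_norm.
  have ah : a <= a + h by rewrite lerDl.
  have e1 : a + h - a = h by rewrite addrAC subrr add0r.
  have s1 := step a (a + h) (ltW a0) ah a2; rewrite e1 in s1.
  rewrite hn (mulrC e) (mulrC (prim g T - prim g a) h).
  apply: le_trans s1 _; apply: ler_wpM2l => //.
  have := ler_norm (prim (fun t => `|g t|) (a + h) - prim (fun t => `|g t|) a).
  by move: HG; lra.
have hn : `|h| = - h by exact: ltr0_norm.
have ah : a + h <= a by rewrite gerDl ltW.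
have s1 := step (a + h) a a1 ah (ltW aT).
have s2 := Gle (a + h) a a1 ah (ltW aT).
have s3 := ler_norm (- (prim (fun t => `|g t|) (a + h) - prim (fun t => `|g t|) a)).
rewrite normrN in s3.
move: s1 s2 s3 HG; rewrite hn.
move: (prim (fun t => g t * t) (a + h)) (prim (fun t => g t * t) a) (prim g T) (prim g (a + h)) (prim g a)
  (prim (fun t => `|g t|) (a + h)) (prim (fun t => `|g t|) a) => X1 X0 GT G1 G0 N1 N0 s1 s2 s3 HG.
have nn : 0 <= - h by rewrite oppr_ge0 ltW.
have -> : X1 + (a + h) * (GT - G1) - (X0 + a * (GT - G0)) - (GT - G0) * h =
  - ((X0 + a * (GT - G0) - (X1 + (a + h) * (GT - G1)) - (a - (a + h)) * (GT - G1)) +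
     (- h) * (G0 - G1)) by ring.
rewrite normrN (le_trans (ler_normD _ _))// normrM (ger0_norm nn).
have -> : e * - h = - h * (e / 2) + - h * (e / 2) by field.
apply: lerD.
  apply: le_trans s1 _; rewrite opprD addNKr; apply: ler_wpM2l => //; lra.
by apply: ler_wpM2l => //; apply: le_trans s2 _; lra.
Qed.

(** A quantitative form of uniform integrability: |s| <= K + |s|^p / K for K >= 1, with K so large
    that the second term contributes at most e / 2. *)
Lemma prim_modulus (p : R) (g : R -> R) (e : R) : 2 <= p ->
  mu.-integrable `[0, T] (EFin \o g) ->
  mu.-integrable `[0, T] (EFin \o (fun t => apow p (g t))) -> 0 < e ->
  exists2 d, 0 < d & forall x y, 0 <= x -> x <= y -> y <= T -> y - x < d -> `|prim g y - prim g x| <= e.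
Proof.
move=> p2 ig igp e0.
set C := \int[mu]_(t in `[0, T]) apow p (g t).
have C0 : 0 <= C by apply: Rintegral_ge0 => t _; exact: apow_ge0.
pose K := 1 + 2 * C / e.
have K1 : 1 <= K by rewrite lerDl divr_ge0 ?mulr_ge0// ltW.
have K0 : 0 < K by exact: lt_le_trans K1.
have pt (s : R) : `|s| <= K + K^-1 * apow p s.
  have A0 : 0 <= apow p s by exact: apow_ge0.
  have [sK|Ks] := leP `|s| K.
    by apply: le_trans sK _; rewrite lerDl mulr_ge0// invr_ge0 ltW.
  rewrite -[leLHS]add0r lerD ?(ltW K0)// mulrC ler_pdivlMr//.
  apply: le_trans (_ : `|s| * `|s| <= _); first by rewrite ler_wpM2l// ltW.
  rewrite -expr2 -powR_mulrn//; apply: ler_powR => //.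
  by apply: ltW; apply: le_lt_trans Ks.
exists (e / (2 * K)); first by rewrite divr_gt0 ?mulr_gt0.
move=> x y x0 xy yT yx; rewrite primB//.
have i1 := integrable_sub ig x0 yT; have i2 := integrable_sub igp x0 yT.
have i3 : mu.-integrable `[x, y] (EFin \o (fun t => K^-1 * apow p (g t))).
  by have := integrableZl _ K^-1 i2 => /(_ (measurable_itv _)).
have i4 : mu.-integrable `[x, y] (EFin \o (fun=> K)).
  by apply: cont_integrable; exact: cont_cst.
apply: le_trans (le_normr_Rintegral _ i1) _ => //.
apply: le_trans (_ : \int[mu]_(t in `[x, y]) (K + K^-1 * apow p (g t)) <= _).
  apply: le_Rintegral_itv => //; first exact: integrable_norm i1.
  by have := integrableD _ i4 i3 => /(_ (measurable_itv _)).
rewrite RintegralD// RintegralZl// Rintegral_itv_cst//.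
have h1 : K * (y - x) <= e / 2.
  have : (y - x) * (2 * K) <= e by rewrite -ler_pdivlMr ?mulr_gt0// ltW.
  by move: (y - x) => z; lra.
have h2 : \int[mu]_(t in `[x, y]) apow p (g t) <= C.
  have p1 : 0 <= prim (fun t => apow p (g t)) x by apply: Rintegral_ge0 => t _; exact: apow_ge0.
  have p3 : 0 <= \int[mu]_(t in `[y, T]) apow p (g t) by apply: Rintegral_ge0 => t _; exact: apow_ge0.
  have CE : C = prim (fun t => apow p (g t)) T by [].
  have := primB igp (le_trans x0 xy) yT (lexx _); have := primB igp x0 xy yT.
  move: p1 p3; rewrite CE; move: (prim _ x) (prim _ y) (prim _ T) => a b c.
  by move: (Rintegral _ _ _) (Rintegral _ _ _) => I J; clear; lra.
have h3 : K^-1 * \int[mu]_(t in `[x, y]) apow p (g t) <= e / 2.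
  rewrite mulrC ler_pdivrMr//; apply: le_trans h2 _.
  have -> : e / 2 * K = e / 2 + C by rewrite /K; field; rewrite gt_eqF.
  by rewrite lerDr ltW// divr_gt0.
lra.
Qed.

Definition circle_rep (x : R) : R := x - T * (Num.floor (x / T))%:~R.

Lemma circle_rep_itv x : 0 <= circle_rep x < T.
Proof.
have T0 : 0 < T := two_pi_gt0 R.
have := floor_itv (x / T); rewrite ler_pdivlMr// ltr_pdivrMr// intrD /circle_rep.
by move: (Num.floor _)%:~R => n /andP[h1 h2]; apply/andP; split; lra.
Qed.

Lemma circle_rep_id x : 0 <= x < T -> circle_rep x = x.
Proof.
move=> /andP[x0 xT]; have T0 : 0 < T := two_pi_gt0 R.
rewrite /circle_rep (_ : Num.floor (x / T) = 0) ?mulr0 ?subr0//.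
by apply: floor_def; rewrite add0r divr_ge0 ?(ltW T0)//= ltr_pdivrMr// mul1r.
Qed.

Lemma circle_repDT x : circle_rep (x + T) = circle_rep x.
Proof.
have T0 : 0 < T := two_pi_gt0 R.
have e : (x + T) / T = x / T + 1 by rewrite mulrDl divff// gt_eqF.
rewrite /circle_rep e.
by rewrite (floorDrz _ (rpred1 _)) floor1 intrD; ring.
Qed.

Lemma circle_fun_continuous (G : R -> R) : G 0 = G T ->
  (forall e, 0 < e -> exists2 d, 0 < d & forall x y, 0 <= x -> x <= y -> y <= T -> y - x < d -> `|G y - G x| <= e) ->
  continuous (G \o circle_rep).
Proof.
move=> G0T HG; have T0 : 0 < T := two_pi_gt0 R.
have key e : 0 < e -> exists2 d, 0 < d & forall x y, x <= y -> y - x < d -> `|G (circle_rep y) - G (circle_rep x)| <= e.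
  move=> e0; have [d d0 Hd] := HG (e / 2) ltac:(by rewrite divr_gt0).
  exists (Num.min d T); first by rewrite lt_min d0.
  move=> x y xy; rewrite lt_min => /andP[yd yT].
  have := circle_rep_itv x; have := circle_rep_itv y.
  have xE : x = circle_rep x + T * (Num.floor (x / T))%:~R by rewrite subrK.
  have yE : y = circle_rep y + T * (Num.floor (y / T))%:~R by rewrite subrK.
  have fxy : Num.floor (x / T) <= Num.floor (y / T) by apply: le_floor; rewrite ler_pM2r// invr_gt0.
  move: xE yE fxy; move: (circle_rep x) (circle_rep y) (Num.floor (x / T)) (Num.floor (y / T)) => a b m n xE yE mn.
  move=> /andP[b0 bT] /andP[a0 aT].
  have [k nE] : exists k : nat, n = m + k%:Z.
    by exists `|n - m|%N; move: mn; clear; lia.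
  have yx : y - x = b - a + T * k%:R by rewrite yE xE nE intrD; ring.
  (* [k] counts the multiples of 2 pi crossed: none, one, where G 0 = G (2 pi) glues the two sides,
     or more, which y - x < 2 pi excludes. *)
  case: k nE yx => [|[|k]] nE yx.
  - rewrite mulr0 addr0 in yx.
    have := Hd a b a0 ltac:(by rewrite -subr_ge0 -yx subr_ge0) (ltW bT) ltac:(by rewrite -yx).
    by move/le_trans; apply; lra.
  - rewrite mulr1 in yx.
    have h1 := Hd 0 b (lexx _) b0 (ltW bT) ltac:(lra).
    have h2 := Hd a T a0 (ltW aT) (lexx _) ltac:(lra).
    have -> : G b - G a = (G b - G 0) + (G T - G a) by rewrite G0T; ring.
    by apply: le_trans (ler_normD _ _) _; lra.
  - exfalso; have k2 : 2%:R * T <= k.+2%:R * T by rewrite ler_pM2r// ler_nat.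
    rewrite (mulrC k.+2%:R) in k2; move: k2 yx yT aT b0; move: (T) (T * k.+2%:R) => t r; clear.
    by lra.
move=> x; apply: continuous_epsP => e e0.
have [d d0 Hd] := key e e0; exists d => // h hd /=.
have [h0|h0] := leP 0 h.
  by apply: Hd; rewrite ?lerDl// addrAC subrr add0r; move: hd; rewrite ger0_norm.
by rewrite distrC; apply: Hd; rewrite ?gerDl ?(ltW h0)// opprD addNKr; move: hd; rewrite ltr0_norm.
Qed.

End Representative.

Section SobolevRepresentative.
Context {R : realType}.
Notation mu := (@lebesgue_measure R).
Notation T := (2 * pi : R).

Lemma ae_sigma (P : R -> Prop) : {ae mu, forall x, 0 < x < T -> P x} ->
  \forall x \ae sigma R, P x.
Proof.
move=> [N [mN N0 HN]].
have T0 : 0 < T := two_pi_gt0 R.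
(* Outside ]0, 2 pi[ the measure sigma only sees the two end points, which form a null set. *)
pose M : set R := N `|` ~` `]0, T[.
have mM : measurable M by apply: measurableU => //; apply: measurableC; exact: measurable_itv.
exists M; split => //.
  have -> : sigma R M = (\int[sigma R]_x (\1_M x)%:E)%E by rewrite integral_indic// setIT.
  rewrite integral_sigma; last by apply/measurable_EFinP; exact: measurable_indic.
  rewrite integral_indic//.
  suff E : mu (M `&` `[0, T]) = 0%E.
    by transitivity ((T^-1)%:E * 0)%E; [congr (_ * _)%E; exact: E|rewrite mule0].
  apply/eqP; rewrite eq_le measure_ge0 andbT.
  have m3 : measurable (N `|` ([set 0] `|` [set T] : set R)).
    by apply: measurableU => //; apply: measurableU; exact: measurable_set1.
  apply: (@le_trans _ _ (mu (N `|` ([set 0] `|` [set T])))).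
    apply: le_measure; rewrite ?inE//; first exact: measurableI.
    move=> x [[Nx|]]; first by left.
    move=> /= h; rewrite in_itv/= => /andP[x0 xT]; right.
    move: h; rewrite in_itv/= => h.
    have [xz|xz] := eqVneq x 0; first by left.
    have [xz'|xz'] := eqVneq x T; first by right.
    by exfalso; apply: h; rewrite !lt_def xz x0 eq_sym xz' xT.
  have m2 : measurable ([set 0] `|` [set T] : set R) by apply: measurableU; exact: measurable_set1.
  have n2 : mu ([set 0] `|` [set T]) = 0%E.
    have ms := @measurable_set1 R.
    rewrite measureU0 ?lebesgue_measure_set1 //; exact: lebesgue_measure_set1.
  suff -> : mu (N `|` ([set 0] `|` [set T])) = 0%E by [].
  transitivity (mu N); [exact: measureU0|exact: N0].
move=> x nPx; have [x0|x0] := boolP (0 < x < T); last first.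
  by right => /=; rewrite in_itv/=; apply/negP.
by left; apply: HN => /= h; apply: nPx; exact: h.
Qed.

Lemma Lfun_measurable (r : R) (f : R -> R) : f \in Lfun (sigma R) r%:E -> measurable_fun setT f.
Proof. by rewrite inE => /andP[/[!inE]/=]. Qed.

Lemma Lfun_itv (p : R) (f : R -> R) : 1 <= p -> f \in Lfun (sigma R) p%:E ->
  [/\ (sigma R).-integrable setT (EFin \o (fun x => apow p (f x))),
      mu.-integrable `[0, T] (EFin \o f) &
      mu.-integrable `[0, T] (EFin \o (fun x => apow p (f x)))].
Proof.
move=> p1 fp; have mf := Lfun_measurable fp.
have ip : (sigma R).-integrable setT (EFin \o (fun x => apow p (f x))) := Lfun_integrable p1 fp.
have mp : measurable_fun setT (fun x => apow p (f x)).
  by apply/measurable_EFinP; exact: measurable_int ip.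
have i1 : (sigma R).-integrable setT (EFin \o (fun x => 1 + apow p (f x))).
  have := integrableD _ (cont_sigma (@cont_cst R 1)) ip => /(_ measurableT).
  exact.
split => //; last by apply/(integrable_sigma mp).
apply/(integrable_sigma mf); apply: (le_integrable _ _ _ i1) => //.
  exact/measurable_EFinP.
move=> x _; rewrite /= lee_fin [leRHS]ger0_norm ?addr_ge0// ?apow_ge0//.
have [f1|f1] := leP `|f x| 1.
  by apply: le_trans f1 _; rewrite lerDl apow_ge0.
rewrite -[leLHS]add0r lerD// -[leLHS](powRr1 (normr_ge0 _)).
by apply: ler_powR => //; exact: ltW.
Qed.

Lemma cst_smooth (c : R) : smooth_periodic (fun=> c).
Proof.
split; first by [].
by apply: (@closed_smooth _ (circle_class 0 0) (@circle_class_derive R 0 0)); exact: circle_class_cst.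
Qed.

(** Testing with the constant 1; this is what lets the primitive of g close up on the circle. *)
Lemma weak_derivative_mean0 (u g : R -> R) : measurable_fun setT g ->
  weak_derivative u g -> prim g T = 0.
Proof.
move=> mg /(_ _ (cst_smooth 1)).
rewrite (_ : (fun x => u x * _) = fun=> 0); last first.
  by apply/funext => x; rewrite derive1_cst mulr0.
rewrite (_ : (fun x => g x * _) = g); last by apply/funext => x; rewrite mulr1.
rewrite Rintegral_cst// mul0r Rintegral_sigma// => /eqP.
by rewrite eq_sym oppr_eq0 mulf_eq0 invr_eq0 gt_eqF ?two_pi_gt0//= => /eqP.
Qed.

(** [window_test] expresses the primitive of u at a through g. Differentiating in a gives c +
    [prim g a] on one side by [clamp_primitive_derive], and u a on the other for almost every a by
    Lebesgue differentiation. *)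
Lemma W1_primitive (u g : R -> R) : measurable_fun setT u -> measurable_fun setT g ->
  mu.-integrable `[0, T] (EFin \o u) -> mu.-integrable `[0, T] (EFin \o g) ->
  weak_derivative u g -> exists c, {ae mu, forall x, 0 < x < T -> u x = c + prim g x}.
Proof.
move=> mu_ mg iu ig W; have T0 : 0 < T := two_pi_gt0 R.
have GT := weak_derivative_mean0 mg W.
pose X := \int[mu]_(t in `[0, T]) (g t * t).
pose c := (prim u T + X) / T.
pose N b := \int[mu]_(t in `[0, T]) (g t * Num.min t b).
have igx : mu.-integrable `[0, T] (EFin \o (fun t => g t * t)).
  apply: (@integrable_mul_bounded R g _ T) => //; last exact: ltW.
  by move=> t /andP[t0 tT]; rewrite ger0_norm.
have HE a : 0 < a < T -> prim u a = c * a - N a.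
  move=> /[dup] aT /andP[a0 aT']; have := window_test aT mu_ mg iu ig W.
  have igm : mu.-integrable `[0, T] (EFin \o (fun t => g t * Num.min t a)).
    apply: (@integrable_mul_bounded R g _ T) => //; last exact: ltW.
      by apply: measurable_minr => //; exact: measurable_cst.
    move=> t /andP[t0 tT]; rewrite ger0_norm ?le_min ?t0 ?(ltW a0)//.
    by rewrite ge_min tT.
  rewrite (_ : (fun t => g t * (Num.min t a - t * (a / T))) =
    (fun t => g t * Num.min t a - a / T * (g t * t))); last by apply/funext => t; ring.
  have ia : mu.-integrable `[0, T] (EFin \o (fun t => a / T * (g t * t))).
    by have := integrableZl _ (a / T) igx => /(_ (measurable_itv _)).
  rewrite RintegralB// RintegralZl// -/(N a) -/X => E.
  have -> : prim u a = prim u a - a / T * prim u T + a / T * prim u T by ring.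
  have Y (U x n b t : R) : t != 0 -> - (n - b / t * x) + b / t * U = (U + x) / t * b - n.
    by move=> h; field.
  by rewrite E; apply: Y; rewrite gt_eqF.
have dN a : 0 < a < T -> is_derive a 1 (fun b => c * b - N b) (c + prim g a).
  move=> aT; have d1 := clamp_primitive_derive aT mg ig.
  have := is_deriveB (is_deriveZ c (is_derive_id a 1)) d1.
  by rewrite /GRing.scale /= mulr1 GT sub0r opprK.
pose f := u \_ `[0, T].
have if0 : mu.-integrable setT (EFin \o f).
  rewrite /f -restrict_EFin; apply/integrable_restrict => //.
  by rewrite setTI.
have := @FTC1 R f (BLeft 0) _ _.
have h1 y : mu.-integrable [set` Interval (BLeft 0) (BRight y)] (EFin \o f).
  exact: integrableS if0.
have h2 : locally_integrable [set: R] f by exact: integrable_locally.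
move=> /(_ h1 h2) H; exists c.
move: H; apply: filterS; first exact: (ae_filter_ringOfSetsType mu).
move=> x /= Hx /[dup] xT /andP[x0 xT'].
have [|_ fx] := Hx; first by rewrite lte_fin.
have -> : u x = f x by rewrite /f patchE mem_set//= in_itv/= !ltW.
rewrite -fx derive1E.
have dNx := dN x xT; rewrite -(@derive_val _ _ _ _ _ _ _ dNx).
apply: near_eq_derive.
have : \forall y \near x, y \in `]0, T[ by apply: near_in_itvoo; rewrite in_itv/= x0.
apply: filterS => y; rewrite in_itv/= => /[dup] yT /andP[y0 yT'].
rewrite -HE// /prim; apply: eq_Rintegral => t; rewrite inE/= in_itv/= => /andP[t0 ty].
by rewrite /f patchE mem_set//= in_itv/= t0 (le_trans ty)// ltW.
Qed.

Theorem W1_representative (p : R) (u g : R -> R) : 2 < p -> W1 p u g ->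
  exists w : R -> R, [/\ continuous w, forall x, w (x + T) = w x,
    u = w %[ae sigma R] &
    forall n, genergy n p (sample w n) <= \int[sigma R]_x apow p (g x)].
Proof.
move=> hp [Lu Lg W]; have T0 : 0 < T := two_pi_gt0 R.
have p1 : 1 < p by apply: lt_trans hp; rewrite ltr1n.
have mu_ := Lfun_measurable Lu; have mg := Lfun_measurable Lg.
have [_ iu _] := Lfun_itv (ltW p1) Lu; have [igs ig igp] := Lfun_itv (ltW p1) Lg.
have GT := weak_derivative_mean0 mg W.
have G0 : prim g 0 = 0 by rewrite /prim set_itv1 Rintegral_set1.
have [c Hc] := W1_primitive mu_ mg iu ig W.
pose G x := c + prim g x.
have GE : G 0 = G T by rewrite /G GT G0.
pose w x := G (circle_rep x).
have wT x : w (x + T) = w x by rewrite /w circle_repDT.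
have wE x : 0 <= x -> x <= T -> w x = G x.
  move=> x0; rewrite le_eqVlt => /predU1P[->|xT]; last by rewrite /w circle_rep_id// x0.
  by rewrite -[T]add0r wT /w circle_rep_id ?lexx// add0r.
exists w; split => //.
- apply: circle_fun_continuous => // e e0.
  have [d d0 Hd] := prim_modulus (ltW hp) ig igp e0.
  exists d => // x y x0 xy yT yx; rewrite /G opprD addrACA subrr add0r.
  exact: Hd.
- have : \forall x \ae sigma R, u x = w x.
    apply: ae_sigma; move: Hc; apply: filterS; first exact: (ae_filter_ringOfSetsType mu).
    move=> x H /[dup] xT /andP[x0 xT']; rewrite wE ?ltW//; exact: H.
  by apply: filterS; first exact: (ae_filter_ringOfSetsType (sigma R)).
- apply: energy_bound => // x y x0 xy yT.
  rewrite !wE ?(le_trans xy)// ?(le_trans x0)// /G opprD addrACA subrr add0r.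
  exact: primB.
Qed.

Lemma norm_L_ae (r : R) (u w : R -> R) : 0 < r -> measurable_fun setT u -> continuous w ->
  u = w %[ae sigma R] -> norm_L r u = cint (fun x => apow r (w x)) `^ r^-1.
Proof.
move=> r0 mu_ cw uw; rewrite -norm_L_cont// /norm_L unlock /=.
suff -> : (\int[sigma R]_x (`|u x| `^ r)%:E = \int[sigma R]_x (`|w x| `^ r)%:E)%E by [].
apply: ae_eq_integral => //.
- apply/measurable_EFinP; apply: (measurableT_comp (measurable_powR r)).
  exact: measurableT_comp.
- apply/measurable_EFinP; apply: (measurableT_comp (measurable_powR r)).
  by apply: measurableT_comp => //; exact: cont_measurable.
- move: uw; apply: filterS; first exact: (ae_filter_ringOfSetsType (sigma R)).
  by move=> x H xT; rewrite (H xT).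
Qed.

Lemma norm_L_integrable (r : R) (g : R -> R) : 0 < r ->
  (sigma R).-integrable setT (EFin \o (fun x => apow r (g x))) ->
  norm_L r g = (\int[sigma R]_x apow r (g x)) `^ r^-1.
Proof.
move=> r0 ig; rewrite /norm_L unlock /= /Rintegral.
by rewrite -[in RHS]fine_poweR ?fineK//; exact: integrable_fin_num.
Qed.

End SobolevRepresentative.

(** * The inequality for p <> q *)

Section PsiInequality.
Context {R : realType}.
Notation mu := (@lebesgue_measure R).
Notation T := (2 * pi : R).

(** Freezes the integrand of Psi outside [0, z], where its denominator could vanish; the resulting
    density is continuous and bounded on the line, as [rigidity_inequality] demands of f'. *)
Definition clamp (z s : R) : R := Num.min (Num.max s 0) z.

Lemma clamp_itv z s : 0 <= z -> 0 <= clamp z s <= z.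
Proof. by move=> z0; rewrite /clamp le_min le_max lexx orbT z0/= ge_min lexx orbT. Qed.

Lemma clamp_id z s : 0 <= s <= z -> clamp z s = s.
Proof. by move=> /andP[s0 sz]; rewrite /clamp (max_idPl s0) (min_idPl sz). Qed.

Lemma clamp_continuous z : continuous (clamp z).
Proof.
move=> x; apply: continuous_epsP => e e0; exists e => // h he.
apply: le_trans (ltW he); rewrite /clamp /Num.min /Num.max.
have := ler_norm h; have := ler_norm (- h); rewrite normrN ler_norml.
by move=> h1 h2; apply/andP; case: (ltP (x + h) 0) => ?; case: (ltP x 0) => ?;
  case: ltP => ?; case: ltP => ?; split; lra.
Qed.

Definition density (p q z s : R) : R :=
  apow (p - 1) (clamp z s) / (1 + (p - q) * clamp z s).

Lemma affine_gt0 (a z s : R) : 0 < 1 + a * z -> 0 <= s <= z -> Num.min 1 (1 + a * z) <= 1 + a * s.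
Proof.
move=> z1 /andP[s0 sz]; rewrite ge_min; have [a0|a0] := leP 0 a.
  by rewrite lerDl mulr_ge0.
by apply/orP; right; rewrite lerD2l ler_nM2l.
Qed.

Lemma density_continuous (p q z : R) : 1 < p -> 0 <= z -> 0 < 1 + (p - q) * z ->
  continuous (density p q z).
Proof.
move=> p1 z0 z1.
have cc := @clamp_continuous z.
have c1 : continuous (fun s => apow (p - 1) (clamp z s)).
  by apply: apow_comp_continuous => //; rewrite subr_gt0.
have c2 : continuous (fun s => 1 + (p - q) * clamp z s).
  by apply: contD; [exact: cont_cst|exact: contZ].
have c3 : continuous (fun s => (1 + (p - q) * clamp z s)^-1).
  move=> y; apply: cvgV; last exact: c2.
  rewrite gt_eqF//; apply: lt_le_trans (affine_gt0 z1 (clamp_itv y z0)).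
  by rewrite lt_min ltr01.
exact: (contM c1 c3).
Qed.

Lemma density_bounds (p q z s : R) : 1 < p -> 0 <= z -> 0 < 1 + (p - q) * z ->
  0 <= density p q z s <= z `^ (p - 1) / Num.min 1 (1 + (p - q) * z).
Proof.
move=> p1 z0 z1; have /andP[c0 cz] := clamp_itv s z0.
have m0 : 0 < Num.min 1 (1 + (p - q) * z) by rewrite lt_min ltr01.
have mle := affine_gt0 z1 (clamp_itv s z0).
have d0 := lt_le_trans m0 mle.
rewrite /density divr_ge0 ?apow_ge0 ?(ltW d0)//=.
apply: ler_pM; rewrite ?apow_ge0 ?invr_ge0 ?(ltW d0)//.
  by rewrite /apow ger0_norm//; apply: ler_powR2r => //; rewrite subr_ge0 ltW.
by rewrite lef_pV2 ?posrE.
Qed.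

(** The integrand of Psi is nondecreasing on its domain, for either sign of p - q, and clamping only
    lowers a nonnegative argument. *)
Lemma density_le (p q z e : R) : 2 < p -> 0 <= z -> 0 < 1 + (p - q) * z -> 0 <= e ->
  0 < 1 + (p - q) * e -> density p q z e <= e `^ (p - 1) / (1 + (p - q) * e).
Proof.
move=> hp z0 z1 e0 e1; have /andP[c0 cz] := clamp_itv e z0.
have ce : clamp z e <= e by rewrite /clamp ge_min (max_idPl e0) lexx.
have m0 : 0 < Num.min 1 (1 + (p - q) * z) by rewrite lt_min ltr01.
have d0 := lt_le_trans m0 (affine_gt0 z1 (clamp_itv e z0)).
rewrite /density /apow (ger0_norm c0).
move: (clamp z e) c0 cz ce d0 => c c0 cz ce d0.
rewrite ler_pdivrMr// mulrAC ler_pdivlMr//.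
have cle : c `^ (p - 2) <= e `^ (p - 2) by apply: ler_powR2r => //; lra.
have [->|cn] := eqVneq c 0.
  rewrite powR0 ?mul0r; last by rewrite gt_eqF//; lra.
  by rewrite mulr_ge0 ?powR_ge0// mulr0 addr0.
have cp : 0 < c by rewrite lt_def cn.
have ep : 0 < e by exact: lt_le_trans ce.
have powE x : 0 < x -> x `^ (p - 1) = x * x `^ (p - 2).
  by move=> x0; rewrite -{2}(powRr1 (ltW x0)) -powRDp//; congr (_ `^ _); ring.
have [a0|a0] := leP 0 (p - q).
  rewrite !powE//.
  have h1 : c * c `^ (p - 2) <= e * e `^ (p - 2) by apply: ler_pM => //; exact: powR_ge0.
  have h2 : (p - q) * c * e * c `^ (p - 2) <= (p - q) * c * e * e `^ (p - 2).
    by rewrite ler_wpM2l// !mulr_ge0.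
  move: h1 h2; move: (c `^ _) (e `^ _) (p - q) => C E a; clear; lra.
apply: ler_pM; rewrite ?powR_ge0 ?(ltW e1)//.
  by apply: ler_powR2r => //; lra.
by rewrite lerD2l ler_nM2l.
Qed.

Lemma PsiE (p q z : R) (K := (p - 1) ^+ 2 / (2 * (2 * p - 1)) * (1 + q - p) * lambda1 p `^ (p - 2)) :
  0 <= z -> Psi p q z = z + K * \int[mu]_(s in `[0, z]) density p q z s.
Proof.
move=> z0; rewrite /Psi; congr (_ + _ * _); apply: eq_Rintegral => s.
by rewrite inE/= in_itv/= => /[dup] sz /andP[s0 _]; rewrite /density clamp_id// /apow ger0_norm.
Qed.

Lemma Psi_constant (p q L : R) : 2 * p - 1 != 0 ->
  (p - 1) ^+ 2 / (2 * (2 * p - 1)) * (1 + q - p) * L =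
  (1 + q - p) * ((p - 1) ^+ 2 / (2 * p - 1)) / 2 * L.
Proof. by move=> h; field. Qed.

Theorem Psi_inequality (p q : R) (v : R -> R) (Av : R) (Pv := cint (fun x => apow p (v x)))
    (Qv := cint (fun x => apow q (v x))) (z := (p - q)^-1 * (Pv `^ (2 / p) * Qv `^ (- (2 / q)) - 1)) :
  2 < p -> p - 1 < q -> p != q -> 0 < lambda1 p -> continuous v -> (forall x, v (x + T) = v x) ->
  0 <= Av -> (forall n, genergy n p (sample v n) <= Av) -> 0 < Pv -> 0 < Qv -> 0 <= z ->
  lambda1 p * Psi p q z <= Av `^ (2 / p) * Qv `^ (- (2 / q)).
Proof.
move=> hp hq pq lam0 cv vT Av0 HAv Pv0 Qv0 z0.
have zdef : z = (p - q)^-1 * (Pv `^ (2 / p) * Qv `^ (- (2 / q)) - 1) by [].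
have PvE : Pv = cint (fun x => apow p (v x)) by [].
have QvE : Qv = cint (fun x => apow q (v x)) by [].
clearbody z Pv Qv.
have p1 : 1 < p by lra.
have n2 : 2 * p - 1 != 0 by rewrite gt_eqF//; lra.
have zE : 1 + (p - q) * z = Pv `^ (2 / p) * Qv `^ (- (2 / q)).
  by rewrite zdef mulrA divff ?subr_eq0// mul1r addrC subrK.
have z1 : 0 < 1 + (p - q) * z by rewrite zE mulr_gt0 ?powR_gt0.
have [kap kapE] : exists k, k = (1 + q - p) * ((p - 1) ^+ 2 / (2 * p - 1)) by eexists.
have kap0 : 0 <= kap.
  rewrite kapE; apply: mulr_ge0; first by lra.
  by apply: divr_ge0; [exact: sqr_ge0|lra].
have [K KE] : exists K, K = kap / 2 * lambda1 p `^ (p - 2) by eexists.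
have K0 : 0 <= K.
  rewrite KE; apply: mulr_ge0; last exact: powR_ge0.
  exact: divr_ge0.
(* The primitive f of [th] coincides with Psi on [0, z]; the inequality is wanted at z only, so
   beyond z a smaller slope is enough. *)
pose th s := 1 + K * density p q z s.
have cd : continuous (density p q z) by exact: density_continuous.
have cth : continuous th by apply: contD; [exact: cont_cst|exact: contZ].
pose C0 := 1 + K * (z `^ (p - 1) / Num.min 1 (1 + (p - q) * z)).
have th1 s : 1 <= th s <= C0.
  have /andP[d0 d1] := density_bounds s p1 z0 z1.
  by rewrite /th /C0 lerDl mulr_ge0//= lerD2l ler_wpM2l.
have C00 : 0 <= C0 by have /andP[h1 h2] := th1 0; lra.
have [f f0 df] := primitive_exists cth.
have fE a b : a <= b -> f b - f a = \int[mu]_(s in `[a, b]) th s.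
  by move=> ab; rewrite (FTC_itv df cth ab).
have fz : f z = Psi p q z.
  have := fE 0 z z0; rewrite f0 subr0 => ->.
  rewrite (PsiE p q z0) (Psi_constant q _ n2) -kapE -KE /th RintegralD.
  - rewrite (Rintegral_itv_cst 1 z0) subr0 mul1r RintegralZl //.
    exact: cont_integrable.
  - exact: measurable_itv.
  - by apply: cont_integrable; exact: cont_cst.
  - by apply: cont_integrable; exact: contZ.
rewrite -fz zdef PvE QvE; rewrite QvE in Qv0.
apply: (@rigidity_inequality R p q (lambda1 p) C0 f th) => //.
- exact: is_derive_continuous df.
- move=> s s0; have := fE s 0 s0; rewrite f0 sub0r.
  have : 0 <= \int[mu]_(s in `[s, 0]) th s.
    by apply: Rintegral_ge0 => t _; have /andP[+ _] := th1 t; apply: le_trans.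
  by move=> h E; rewrite -oppr_ge0 E.
- move=> s s0; have := fE 0 s s0; rewrite f0 subr0 => ->.
  rewrite -{2}[s]subr0 -(Rintegral_itv_cst C0 s0); apply: le_Rintegral_itv.
  + exact: cont_integrable.
  + by apply: cont_integrable; exact: cont_cst.
  + by move=> t; have /andP[] := th1 t.
- by move=> s; have /andP[h1 h2] := th1 s; rewrite ger0_norm//; apply: le_trans h1.
- by move=> a b; exact: poincare.
(* Since P^(2/p) = 1 + (p - q) e is also the denominator of the density at e, the condition on [th]
   reduces to (lambda1 e)^(p-1) <= 2 A^(2/p); the 2 meets the 1/2 in K. *)
move=> a b A P e C1 a0 Q1 e0; right.
have apb := apriori_bound hp hq pq lam0 C1 a0 Q1 e0; rewrite -/P -/A -/e in apb.
have [aT da cb] := C1; have ca := is_derive_continuous da.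
have P0 : 0 < P.
  have [x ax] : exists x, a x != 0.
    apply: contrapT => H; have a00 x : a x = 0.
      by apply/eqP/negPn/negP => ax; apply: H; exists x.
    have : cint (fun x => apow q (a x)) = cint (fun=> 0 : R).
      have q0 : q != 0 by rewrite gt_eqF//; move: hp hq; clear; lra.
      by apply: eq_cint => x; rewrite a00 /apow normr0 powR0.
    by rewrite Q1 cint_cst => /eqP; rewrite oner_eq0.
  by apply: (C1per_cst0 aT ca ax); move: hp; clear; lra.
have PE : P `^ (2 / p) = 1 + (p - q) * e.
  by rewrite /e mulrA divff ?subr_eq0// mul1r addrC subrK.
have e1 : 0 < 1 + (p - q) * e by rewrite -PE powR_gt0.
have dl := density_le hp z0 z1 (ltW e0) e1.
rewrite PE -kapE /th mulrDr mulr1 lerD2l.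
apply: le_trans (_ : lambda1 p * (K * (e `^ (p - 1) / (1 + (p - q) * e))) <= _).
  by rewrite !ler_wpM2l// ltW.
have lp : lambda1 p `^ (p - 1) = lambda1 p * lambda1 p `^ (p - 2).
  by rewrite -{2}[lambda1 p]powRr1 ?(ltW lam0)// -powRDp//; congr (_ `^ _); ring.
rewrite (powRM _ (ltW lam0) (ltW e0)) lp in apb.
rewrite KE; move: apb e1; move: (1 + (p - q) * e) (e `^ (p - 1)) (A `^ (2 / p)) => D X i apb D0.
rewrite [leLHS](_ : _ = kap / 2 * (lambda1 p * lambda1 p `^ (p - 2) * X) / D); last by ring.
rewrite [leRHS](_ : _ = kap / 2 * (2 * i) / D); last by field; rewrite gt_eqF.
apply: ler_wpM2r; first by rewrite invr_ge0 ltW.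
by apply: ler_wpM2l => //; exact: divr_ge0.
Qed.

End PsiInequality.

(** * The limit q -> p *)

Section PowerMeans.
Context {R : realType}.
Notation mu := (@lebesgue_measure R).
Notation T := (2 * pi : R).

Lemma power_mean (r s : R) (w : R -> R) : 0 < r -> r < s -> continuous w ->
  cint (fun x => apow r (w x)) `^ r^-1 <= cint (fun x => apow s (w x)) `^ s^-1.
Proof.
move=> r0 rs cw; have s0 : 0 < s by exact: lt_trans rs.
have sr : 0 < s - r by rewrite subr_gt0.
have a0 : 0 < s / r by rewrite divr_gt0.
have b0 : 0 < s / (s - r) by rewrite divr_gt0.
have ab : (s / r)^-1 + (s / (s - r))^-1 = 1 by field; rewrite !gt_eqF.
have cr : continuous (fun x => apow r (w x)) by exact: apow_comp_continuous.
have := cint_hoelder a0 b0 ab cr (@cont_cst R 1).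
rewrite (_ : (fun x => `|apow r (w x) * 1|) = (fun x => apow r (w x))); last first.
  by apply/funext => x; rewrite mulr1 ger0_norm// apow_ge0.
rewrite (_ : (fun x => apow (s / r) (apow r (w x))) = (fun x => apow s (w x))); last first.
  apply/funext => x; rewrite {1}/apow ger0_norm ?apow_ge0// /apow -powRrM.
  by congr (_ `^ _); field; rewrite gt_eqF.
rewrite (_ : (fun _ : R => apow _ 1) = fun=> 1); last first.
  by apply/funext => x; rewrite /apow normr1 powR1.
rewrite cint_cst powR1 mulr1 => H.
have X0 : 0 <= cint (fun x => apow r (w x)) by apply: cint_ge0 => x; exact: apow_ge0.
have ir : 0 <= r^-1 by rewrite invr_ge0 ltW.
have := ler_powR2r ir X0 H; rewrite -powRrM (_ : (s / r)^-1 * r^-1 = s^-1)//.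
by field; rewrite !gt_eqF.
Qed.

Lemma powR_div (x y r : R) : 0 <= x -> 0 < y -> (x / y) `^ r = x `^ r / y `^ r.
Proof.
move=> x0 y0; apply: (mulIf (lt0r_neq0 (powR_gt0 r y0))).
rewrite -powRM ?divr_ge0 ?(ltW y0)// divfK ?gt_eqF//.
by rewrite divfK// gt_eqF// powR_gt0.
Qed.

Lemma power_mean_gap (p q P Q : R) : p != q -> 0 < p -> 0 < q -> 0 < P -> 0 < Q ->
  (p < q -> P `^ p^-1 <= Q `^ q^-1) -> (q < p -> Q `^ q^-1 <= P `^ p^-1) ->
  0 <= (p - q)^-1 * (P `^ (2 / p) * Q `^ (- (2 / q)) - 1).
Proof.
move=> pq p0 q0 P0 Q0 h1 h2.
have sq (x r : R) : 0 < x -> x `^ (2 / r) = (x `^ r^-1) ^+ 2.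
  by move=> x0; rewrite powR_sqr// ltW.
have Qr : 0 < Q `^ q^-1 by exact: powR_gt0.
have Pr : 0 < P `^ p^-1 by exact: powR_gt0.
rewrite powRN !sq//; have [lt|lt] := ltP q p.
  apply: mulr_ge0; first by rewrite invr_ge0 subr_ge0 ltW.
  rewrite subr_ge0 ler_pdivlMr ?exprn_gt0// mul1r lerXn2r ?nnegrE ?(ltW Qr) ?(ltW Pr)//.
  exact: h2.
have {}lt : p < q by rewrite lt_def eq_sym pq.
rewrite -mulrNN -invrN; apply: mulr_ge0; first by rewrite invr_ge0 opprB subr_ge0 ltW.
rewrite opprB subr_ge0 ler_pdivrMr ?exprn_gt0// mul1r lerXn2r ?nnegrE ?(ltW Qr) ?(ltW Pr)//.
exact: h1.
Qed.

Definition xlogx (p s : R) : R := apow p s * ln `|s|.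

Lemma xlogx_continuous (p : R) : 2 < p -> continuous (xlogx p).
Proof.
move=> hp x; have p0 : 0 < p by lra.
have [->|x0] := eqVneq x 0.
  apply: continuous_epsP => e e0.
  have [|d d0 Hd] := @powR_small R (p - 1) e _ e0; first by lra.
  exists (Num.min d 1); first by rewrite lt_min d0 ltr01.
  move=> h; rewrite lt_min => /andP[hd h1].
  rewrite add0r {2}/xlogx /apow normr0 powR0 ?mul0r ?subr0; last by rewrite gt_eqF.
  have [->|h0] := eqVneq h 0; first by rewrite /xlogx /apow normr0 powR0 ?mul0r ?normr0 ?ltW// gt_eqF.
  have hp0 : 0 < `|h| by rewrite normr_gt0.
  apply: le_trans (Hd h hd).
  rewrite /xlogx normrM ger0_norm ?apow_ge0// /apow.
  (* One power of |h| is spent on the logarithm: |h| |ln |h|| <= 1 for |h| <= 1. *)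
  have -> : `|h| `^ p = `|h| `^ (p - 1) * `|h|.
    by rewrite -{3}(powRr1 (ltW hp0)) -powRDp// subrK.
  rewrite -mulrA ler_piMr ?powR_ge0//.
  rewrite ler0_norm; last by rewrite ln_le0// ltW.
  rewrite -lnV ?posrE// mulrC -ler_pdivlMr// mul1r ltW// ln_sublinear// invr_gt0//.
have cl : {for x, continuous (fun s : R => ln `|s|)}.
  apply: (@continuous_comp _ _ _ (fun s : R => `|s|) (@ln R)); first exact: norm_continuous.
  by apply: continuous_ln; rewrite normr_gt0.
exact: (continuousM (apow_continuous p0 (x := x)) cl).
Qed.

(** This is y ln y >= y - 1 at y = |s|^p. Integrated for a function of unit p-mean, it makes the
    entropy nonnegative. *)
Lemma xlogx_lower (p s : R) : 0 < p -> p^-1 * (apow p s - 1) <= xlogx p s.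
Proof.
move=> p0; rewrite /xlogx /apow; have [->|s0] := eqVneq s 0.
  by rewrite normr0 powR0 ?gt_eqF// mul0r sub0r mulrN1 oppr_le0 invr_ge0 ltW.
have x0 : 0 < `|s| by rewrite normr_gt0.
have y0 : 0 < `|s| `^ p by exact: powR_gt0.
rewrite mulrC ler_pdivrMr// -mulrA [ln _ * p]mulrC -ln_powR.
move: (`|s| `^ p) y0 => y y0.
have h : ln y^-1 <= y^-1 - 1.
  have := @le_ln1Dx R (y^-1 - 1); rewrite [1 + _]addrC subrK; apply.
  by rewrite ltrBrDl subrr invr_gt0.
rewrite lnV ?posrE// in h.
have : y * (- ln y) <= y * (y^-1 - 1) by rewrite ler_wpM2l// ltW.
by rewrite mulrN mulrBr mulr1 divff ?gt_eqF//; lra.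
Qed.

(** From |s|^t >= 1 + t ln |s|. Integrated, it gives Q >= 1 + t E for q = p + t, where E is the
    integral of [xlogx]. *)
Lemma apow_shift_lower (p t s : R) : 0 < p -> 0 < t ->
  apow p s + t * xlogx p s <= apow (p + t) s.
Proof.
move=> p0 t0; rewrite /xlogx /apow; have [->|s0] := eqVneq s 0.
  by rewrite normr0 !powR0 ?gt_eqF ?addr_gt0// mul0r mulr0 addr0.
have x0 : 0 < `|s| by rewrite normr_gt0.
rewrite powRDp// mulrCA -[X in X + _]mulr1 -mulrDr ler_wpM2l ?powR_ge0//.
have -> : `|s| `^ t = expR (t * ln `|s|) by rewrite /powR gt_eqF.
exact: expR_ge1Dx.
Qed.

Lemma powR_ln_lower (x y r : R) : 0 <= r -> 0 <= x -> 1 + x <= y ->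
  1 + r * (x / (1 + x)) <= y `^ r.
Proof.
move=> r0 x0 xy; have S0 : 0 < 1 + x by lra.
apply: le_trans (ler_powR2r r0 (ltW S0) xy).
have -> : (1 + x) `^ r = expR (r * ln (1 + x)) by rewrite /powR gt_eqF.
apply: le_trans (expR_ge1Dx _); rewrite lerD2l ler_wpM2l//.
have := @le_ln1Dx R ((1 + x)^-1 - 1); rewrite [1 + (_ - 1)]addrC subrK lnV ?posrE// => H.
have {}H : - ln (1 + x) <= (1 + x)^-1 - 1.
  by apply: H; rewrite ltrBrDl subrr invr_gt0.
have -> : x / (1 + x) = 1 - (1 + x)^-1 by field; rewrite gt_eqF.
lra.
Qed.

(** An explicit minorant of the argument of Psi at q = p + t and unit p-mean. It is continuous in t,
    with the value 2 E / p required by the entropy at t = 0. *)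
Lemma gap_lower (p t E Q : R) : 2 < p -> 0 < t -> 0 <= E -> 1 + t * E <= Q ->
  2 * E / ((p + t) * (1 + 2 * t * E)) <= (p - (p + t))^-1 * (Q `^ (- (2 / (p + t))) - 1).
Proof.
move=> hp t0 E0 QE.
have tE : 0 <= t * E by rewrite mulr_ge0// ltW.
have q0 : 0 < p + t by lra.
set r := 2 / (p + t).
have r0 : 0 < r by rewrite divr_gt0.
have r1 : r <= 1 by rewrite ler_pdivrMr//; lra.
have low := powR_ln_lower (ltW r0) tE QE.
have Y0 : 0 < Q `^ r by apply: powR_gt0; lra.
rewrite powRN (_ : p - (p + t) = - t); last by ring.
rewrite invrN mulNr -mulrN opprB.
have -> : 2 * E / ((p + t) * (1 + 2 * t * E)) = t^-1 * (r * (t * E) / (1 + 2 * (t * E))).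
  rewrite /r; field; rewrite !gt_eqF//=; lra.
apply: ler_wpM2l; first by rewrite invr_ge0 ltW.
set b := r * (t * E / (1 + t * E)) in low.
have b0 : 0 <= b by rewrite /b mulr_ge0 ?divr_ge0 ?(ltW r0)//; lra.
apply: le_trans (_ : 1 - (1 + b)^-1 <= _); last first.
  by rewrite lerB// lef_pV2 ?posrE//; lra.
have -> : 1 - (1 + b)^-1 = r * (t * E) / (1 + t * E + r * (t * E)).
  rewrite /b; move: (t * E) tE => x x0; field.
  have rx : 0 <= r * x by rewrite mulr_ge0// ltW.
  by rewrite !gt_eqF//; lra.
have rx : 0 <= r * (t * E) by rewrite mulr_ge0// ltW.
have rx1 : r * (t * E) <= t * E by rewrite ler_piMl.
apply: ler_wpM2l => //; rewrite lef_pV2 ?posrE; lra.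
Qed.

End PowerMeans.

Section CriticalCase.
Context {R : realType}.
Notation mu := (@lebesgue_measure R).
Notation T := (2 * pi : R).

Lemma Psi_critical (p : R) (F : R -> R) (K := (p - 1) ^+ 2 / (2 * (2 * p - 1)) * lambda1 p `^ (p - 2)) x :
  1 < p -> F 0 = 0 -> (forall x : R, is_derive x 1 F (apow (p - 1) x)) -> 0 <= x ->
  Psi p p x = x + K * F x.
Proof.
move=> p1 F0 dF x0; have ca : continuous (@apow R (p - 1)) by apply: apow_continuous; rewrite subr_gt0.
have := FTC_itv dF ca x0; rewrite F0 subr0 => <-.
rewrite /Psi addrK mulr1 /K; congr (_ + _ * _); apply: eq_Rintegral => s.
rewrite inE/= in_itv/= => /andP[s0 _].
by rewrite subrr mul0r addr0 divr1 /apow ger0_norm.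
Qed.

(** For q = p + t the factor 1 + q - p is 1 + t and the denominator 1 - t s is at most 1, so Psi
    dominates its form at q = p, which is moreover nondecreasing. *)
Lemma Psi_lower (p t z y : R) (F : R -> R) (K := (p - 1) ^+ 2 / (2 * (2 * p - 1)) * lambda1 p `^ (p - 2)) :
  2 < p -> 0 < t -> F 0 = 0 -> (forall x : R, is_derive x 1 F (apow (p - 1) x)) ->
  0 <= y -> y <= z -> 0 < 1 + (p - (p + t)) * z ->
  y + K * F y <= Psi p (p + t) z.
Proof.
move=> hp t0 F0 dF y0 yz z1; have z0 : 0 <= z by exact: le_trans yz.
have p1 : 1 < p by lra.
have ca : continuous (@apow R (p - 1)) by apply: apow_continuous; rewrite subr_gt0.
rewrite PsiE//; apply: lerD => //.
have K0 : 0 <= K.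
  by rewrite mulr_ge0 ?powR_ge0// divr_ge0 ?sqr_ge0//; lra.
have -> : (p - 1) ^+ 2 / (2 * (2 * p - 1)) * (1 + (p + t) - p) * lambda1 p `^ (p - 2) = K * (1 + t).
  by rewrite /K; ring.
have Fy0 : 0 <= F y.
  have := FTC_itv dF ca y0; rewrite F0 subr0 => <-.
  by apply: Rintegral_ge0 => s _; exact: apow_ge0.
have Fz : F y <= \int[mu]_(s in `[0, z]) density p (p + t) z s.
  apply: le_trans (_ : F z <= _).
    rewrite -subr_ge0 -(FTC_itv dF ca yz).
    by apply: Rintegral_ge0 => s _; exact: apow_ge0.
  have := FTC_itv dF ca z0; rewrite F0 subr0 => <-.
  apply: le_Rintegral => //.
  - exact: cont_integrable.
  - by apply: cont_integrable; exact: density_continuous.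
  - move=> s /= sz; rewrite in_itv/= in sz; have /andP[s0 sz'] := sz.
    have m0 : 0 < Num.min 1 (1 + (p - (p + t)) * z) by rewrite lt_min ltr01.
    have d0 := lt_le_trans m0 (affine_gt0 z1 sz).
    rewrite /density clamp_id// ler_pdivlMr// ler_piMr ?apow_ge0//.
    rewrite (_ : p - (p + t) = - t); last by ring.
    by rewrite mulNr gerBl mulr_ge0// ltW.
rewrite -mulrA; apply: ler_wpM2l => //.
have D0 := le_trans Fy0 Fz.
by apply: le_trans Fz _; apply: ler_peMl => //; lra.
Qed.

Lemma entropy_inequality (p Av : R) (y : R -> R) : 2 < p -> 0 < lambda1 p ->
  continuous y -> (forall x, y (x + T) = y x) -> 0 <= Av ->
  (forall n, genergy n p (sample y n) <= Av) -> cint (fun x => apow p (y x)) = 1 ->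
  lambda1 p * Psi p p (2 / p * cint (fun x => xlogx p (y x))) <= Av `^ (2 / p).
Proof.
move=> hp lam0 cy yT Av0 HAv P1.
have p0 : 0 < p by lra.
have p1 : 1 < p by lra.
have cx : continuous (fun x => xlogx p (y x)) by apply: cont_comp cy; exact: xlogx_continuous.
have cP r : 0 < r -> continuous (fun x => apow r (y x)) by move=> r0; exact: apow_comp_continuous.
have [E EE] : exists E, E = cint (fun x => xlogx p (y x)) by eexists.
have E0 : 0 <= E.
  rewrite EE; apply: le_trans (_ : cint (fun x => p^-1 * (apow p (y x) - 1)) <= _).
    rewrite cintZ; last by apply: contB; [exact: cP|exact: cont_cst].
    by rewrite cintB ?P1 ?cint_cst ?subrr ?mulr0//; [exact: cP|exact: cont_cst].
  apply: le_cint => //.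
    by apply: contZ; apply: contB; [exact: cP|exact: cont_cst].
  by move=> x; exact: xlogx_lower.
rewrite -EE.
have ca : continuous (@apow R (p - 1)) by apply: apow_continuous; rewrite subr_gt0.
have [F F0 dF] := primitive_exists ca.
pose K := (p - 1) ^+ 2 / (2 * (2 * p - 1)) * lambda1 p `^ (p - 2).
pose eta t := 2 * E / ((p + t) * (1 + 2 * t * E)).
pose phi t := lambda1 p * (eta t + K * F (eta t)).
have eta0 : eta 0 = 2 / p * E by rewrite /eta addr0 mulr0 mul0r addr0 mulr1; ring.
have -> : lambda1 p * Psi p p (2 / p * E) = phi 0.
  by rewrite (Psi_critical p1 F0 dF) -?eta0// eta0 mulr_ge0// divr_ge0// ltW.
(* Only the explicit minorant [phi] is shown continuous at t = 0; no limit of Psi or of norms in q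
   is taken. *)
apply: le_of_right_limit.
  have ce : {for 0, continuous eta}.
    rewrite /eta; apply: cvgM; first exact: cvg_cst.
    apply: cvgV; first by rewrite !(addr0, mulr0, mul0r) mulr1 gt_eqF.
    apply: cvgM; first by apply: cvgD; [exact: cvg_cst|exact: cvg_id].
    apply: cvgD; first exact: cvg_cst.
    apply: cvgM; last exact: cvg_cst.
    by apply: cvgM; [exact: cvg_cst|exact: cvg_id].
  have cF := is_derive_continuous dF.
  have cFe : {for 0, continuous (fun t => F (eta t))}.
    exact: (continuous_comp ce (cF (eta 0))).
  rewrite /phi; apply: cvgM; first exact: cvg_cst.
  apply: cvgD; first exact: ce.
  by apply: cvgM; [exact: cvg_cst|exact: cFe].
move=> t t0; rewrite add0r; apply: le_trans (_ : Av `^ (2 / p) <= _); last by rewrite lerDl ltW.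
have q0 : 0 < p + t by lra.
have pq : p != p + t by rewrite lt_eqF// ltrDl.
have QE : 1 + t * E <= cint (fun x => apow (p + t) (y x)).
  rewrite -P1 EE -cintZ// -cintD//; [|exact: cP|exact: contZ].
  apply: le_cint; [by apply: contD; [exact: cP|exact: contZ]|exact: cP|].
  by move=> x; exact: apow_shift_lower.
have [Q Qdef] : exists Q, Q = cint (fun x => apow (p + t) (y x)) by eexists.
rewrite -Qdef in QE.
have tE : 0 <= t * E by rewrite mulr_ge0// ltW.
have Q1 : 1 <= Q by lra.
have Q0 : 0 < Q by lra.
have gap := gap_lower hp t0 E0 QE; rewrite -/(eta t) in gap.
have e0 : 0 <= eta t.
  have d0 : 0 <= (p + t) * (1 + 2 * t * E).
    by apply: mulr_ge0; [exact: ltW|rewrite -mulrA; lra].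
  by apply: divr_ge0 => //; exact: mulr_ge0.
set z := (p - (p + t))^-1 * (Q `^ (- (2 / (p + t))) - 1) in gap.
have z0 : 0 <= z by exact: le_trans gap.
have zE : 1 + (p - (p + t)) * z = Q `^ (- (2 / (p + t))).
  by rewrite /z mulrA divff ?subr_eq0// mul1r addrC subrK.
have z1 : 0 < 1 + (p - (p + t)) * z by rewrite zE powR_gt0.
have PI : lambda1 p * Psi p (p + t) z <= Av `^ (2 / p) * Q `^ (- (2 / (p + t))).
  have e1 : 1 `^ (2 / p) * Q `^ (- (2 / (p + t))) = Q `^ (- (2 / (p + t))) by rewrite powR1 mul1r.
  have hq : p - 1 < p + t by lra.
  have P0' : 0 < cint (fun x => apow p (y x)) by rewrite P1.
  have Q0' : 0 < cint (fun x => apow (p + t) (y x)) by rewrite -Qdef.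
  have gz : 0 <= (p - (p + t))^-1 * (cint (fun x => apow p (y x)) `^ (2 / p) *
      cint (fun x => apow (p + t) (y x)) `^ (- (2 / (p + t))) - 1).
    by rewrite P1 -Qdef e1.
  by have := Psi_inequality hp hq pq lam0 cy yT Av0 HAv P0' Q0' gz; rewrite P1 -Qdef e1.
apply: le_trans (_ : lambda1 p * Psi p (p + t) z <= _).
  by apply: ler_wpM2l; [exact: ltW|exact: (Psi_lower hp t0 F0 dF e0 gap z1)].
(* As Q >= 1, the negative power of Q on the right is at most 1. *)
apply: le_trans PI _; rewrite ler_piMr ?powR_ge0//.
by rewrite powRN invf_le1 ?powR_gt0// ge1_powR// divr_ge0// ltW.
Qed.

End CriticalCase.

(** * Return to the norms of the Sobolev function *)

Section Final.
Context {R : realType}.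
Notation T := (2 * pi : R).

Lemma not_ae_zero (u w : R -> R) : u = w %[ae sigma R] -> ~ ae_zero u -> exists x, w x != 0.
Proof.
move=> uw u0; apply: contrapT => H; apply: u0.
move: uw; apply: filterS; first exact: (ae_filter_ringOfSetsType (sigma R)).
move=> x uw xT; rewrite (uw xT); apply/eqP/negPn/negP => wx.
by apply: H; exists x.
Qed.

Lemma entropy_ae (p : R) (u w : R -> R) : 2 < p -> measurable_fun setT u -> continuous w ->
  u = w %[ae sigma R] -> 0 < norm_L p u ->
  entropy p u = cint (fun x => xlogx p ((norm_L p u)^-1 * w x)).
Proof.
move=> hp mu_ cw uw N0; rewrite /entropy.
set N := norm_L p u in N0 *.
have E x : `|u x| `^ p / N `^ p * ln (`|u x| / N) = xlogx p (N^-1 * u x).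
  rewrite /xlogx /apow normrM [`|N^-1|]ger0_norm ?invr_ge0 ?(ltW N0)// (mulrC N^-1).
  by rewrite powR_div.
have cx : continuous (fun s => xlogx p (N^-1 * s)).
  apply: (@cont_comp R (fun s => N^-1 * s) (xlogx p)); first exact: xlogx_continuous.
  by apply: contZ => x; exact: cvg_id.
rewrite /cint /Rintegral; congr fine; apply: ae_eq_integral => //.
- apply/measurable_EFinP; rewrite (_ : (fun x => _) = (fun x => xlogx p (N^-1 * u x))); last first.
    by apply/funext => x; exact: E.
  exact: (measurableT_comp (cont_measurable cx)).
- apply/measurable_EFinP; apply: cont_measurable.
  exact: (cont_comp cx cw).
- move: uw; apply: filterS; first exact: (ae_filter_ringOfSetsType (sigma R)).
  by move=> x uw xT; rewrite E (uw xT).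
Qed.

Lemma norms_inequality (p q l A P Q : R) (psi : R -> R) : 0 <= A -> 0 < P -> 0 < Q ->
  l * psi ((p - q)^-1 * (P `^ (2 / p) * Q `^ (- (2 / q)) - 1)) <= A `^ (2 / p) * Q `^ (- (2 / q)) ->
  forall nd np nq : R, nd = A `^ p^-1 -> np = P `^ p^-1 -> nq = Q `^ q^-1 ->
  l * nq ^+ 2 * psi ((p - q)^-1 * ((np ^+ 2 - nq ^+ 2) / nq ^+ 2)) <= nd ^+ 2.
Proof.
move=> A0 P0 Q0 H nd np nq -> -> ->.
rewrite (powR_sqr _ A0) (powR_sqr _ (ltW P0)) (powR_sqr _ (ltW Q0)).
move: H (powR_gt0 (2 / q) Q0); rewrite powRN.
move: (P `^ _) (Q `^ _) (A `^ _) => X Y Z H Y0.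
have -> : (X - Y) / Y = X / Y - 1 by rewrite mulrBl divff// gt_eqF.
by rewrite ler_pdivlMr// mulrAC in H.
Qed.

Lemma critical_norms_inequality (p A : R) (w : R -> R) : 2 < p -> 0 < lambda1 p ->
  continuous w -> (forall x, w (x + T) = w x) -> 0 <= A ->
  (forall n, genergy n p (sample w n) <= A) -> 0 < cint (fun x => apow p (w x)) ->
  forall N nd e : R, 0 < N -> N = cint (fun x => apow p (w x)) `^ p^-1 -> nd = A `^ p^-1 ->
  e = cint (fun x => xlogx p (N^-1 * w x)) ->
  lambda1 p * N ^+ 2 * Psi p p (2 / p * e) <= nd ^+ 2.
Proof.
move=> hp lam0 cw wT A0 Hen P0 N nd e N0 NP -> ->.
have p0 : 0 < p by lra.
have Ni : 0 <= N^-1 by rewrite invr_ge0 ltW.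
pose y x := N^-1 * w x.
have cy : continuous y by exact: contZ.
have yT z : y (z + T) = y z by rewrite /y wT.
have NpP : N `^ p = cint (fun x => apow p (w x)).
  by rewrite NP -powRrM mulVf ?gt_eqF// powRr1// ltW.
have NiE : N^-1 `^ p = (N `^ p)^-1.
  by rewrite -[N^-1]mul1r powR_div// powR1 mul1r.
have y1 : cint (fun x => apow p (y x)) = 1.
  rewrite (_ : (fun x => apow p (y x)) = (fun x => N^-1 `^ p * apow p (w x))); last first.
    by apply/funext => z; rewrite /apow /y normrM (ger0_norm Ni) powRM.
  rewrite cintZ; last exact: apow_comp_continuous.
  by rewrite NiE NpP mulVf// gt_eqF.
have yen n : genergy n p (sample y n) <= A / N `^ p.
  have -> : sample y n = fun k => N^-1 * sample w n k by [].
  by rewrite genergy_scale// NiE mulrC ler_wpM2r ?invr_ge0 ?powR_ge0.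
have B0 : 0 <= A / N `^ p by rewrite divr_ge0 ?powR_ge0.
have := entropy_inequality hp lam0 cy yT B0 yen y1.
rewrite powR_div ?powR_gt0// -powRrM (_ : p * (2 / p) = 2); last by field; rewrite gt_eqF.
rewrite (powR_mulrn 2 (ltW N0)) (powR_sqr _ A0) ler_pdivlMr ?exprn_gt0//.
by rewrite mulrAC.
Qed.

End Final.

Theorem theorem3p1 (R : realType) (p q : R) (hp : 2 < p) (hq : p - 1 < q)
    (u du : R -> R) (hu : W1 p u du) (hu0 : ~ ae_zero u) :
  (p != q ->
     norm_L p du ^+ 2 >=
       lambda1 p * norm_L q u ^+ 2 *
       Psi p q ((p - q)^-1 *
                ((norm_L p u ^+ 2 - norm_L q u ^+ 2) / norm_L q u ^+ 2))) /\
  (p = q ->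
     norm_L p du ^+ 2 >=
       lambda1 p * norm_L p u ^+ 2 * Psi p q (2 / p * entropy p u)).
Proof.
have p0 : 0 < p by lra.
have p1 : 1 < p by lra.
have q0 : 0 < q by lra.
(* The rigidity argument takes a positive constant; for lambda1 = 0 both right-hand sides vanish. *)
have [lamz|lamn] := eqVneq (lambda1 p) 0.
  by rewrite lamz; split => _; rewrite !mul0r sqr_ge0.
have lam0 : 0 < lambda1 p by rewrite lt_def lamn lambda1_ge0.
have [w [cw wT uw Hen]] := W1_representative hp hu.
have [Lu Ldu _] := hu; have mu_ := Lfun_measurable Lu.
have [idu _ _] := Lfun_itv (ltW p1) Ldu.
have [x wx] := not_ae_zero uw hu0.
have P0 := C1per_cst0 wT cw wx p0; have Q0 := C1per_cst0 wT cw wx q0.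
have NP := norm_L_ae p0 mu_ cw uw; have NQ := norm_L_ae q0 mu_ cw uw.
have ND := norm_L_integrable p0 idu.
have [A AE] : exists A, A = \int[sigma R]_x apow p (du x) by eexists.
rewrite -AE in ND Hen.
have A0 : 0 <= A by rewrite AE; apply: Rintegral_ge0 => t _; exact: apow_ge0.
split => [pq|pq].
  have gap : 0 <= (p - q)^-1 * (cint (fun x => apow p (w x)) `^ (2 / p) *
      cint (fun x => apow q (w x)) `^ (- (2 / q)) - 1).
    exact: (power_mean_gap pq p0 q0 P0 Q0 (fun lt => power_mean p0 lt cw)
      (fun lt => power_mean q0 lt cw)).
  have H := Psi_inequality hp hq pq lam0 cw wT A0 Hen P0 Q0 gap.
  exact: (norms_inequality A0 P0 Q0 H ND NP NQ).
rewrite -pq; have N0 : 0 < norm_L p u by rewrite NP powR_gt0.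
exact: (critical_norms_inequality hp lam0 cw wT A0 Hen P0 N0 NP ND (entropy_ae hp mu_ cw uw N0)).
Qed.
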